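(* Let $\mu>0$, $H\in\mathcal I_\mu$, $t=\eta^{-1}(H)$, and $$\mathcal D_\infty=\{p\in\mathcal D: F^n(p)\in\mathcal D\text{ for every }n\ge0\}.$$ Then $F^n(p)\to(x_0(t),y_0(t))$ as $n\to\infty$ for every $p\in\mathcal D_\infty$. Hence every forward trajectory of $Z$ starting from a point of $\mathcal D_\infty$ converges orbitally to the simple-period cycle $\gamma_{(\mu,H)}$. This cycle is the unique crossing periodic orbit of $Z$; in particular, no crossing periodic orbit with a higher number of crossings (more than two intersection points with $\Sigma$) exists. The same convergence holds for any chain of flights starting at a point $(x,y)$ with $x>0$, $y\ge0$, for which all subsequent landing ordinates remain nonnegative. Such a chain has only finitely many zero-duration contacts with folds.
   Context: Let $f(x,y,z)=z$, $\Sigma=\{z=0\}\subset\mathbb R^3$, $S(x,y,z)=(-y,-x,-z)$. For $\mu>0$ and $H\in(0,1)\cup(1,\infty)$, the canonical system $Z=(X,Y)$ is the piecewise-linear Filippov system equal to $X$ on $\{z\ge0\}$ and to $Y=S\circ X\circ S$ on $\{z<0\}$, where $$X(x,y,z)=\bigl(-2\mu x-H(9\mu^2+1)z+H,\ 2\mu y-(1+\mu^2)z+1,\ y\bigr),$$ $$Y(x,y,z)=\bigl(2\mu x-(1+\mu^2)z-1,\ -2\mu y-H(9\mu^2+1)z-H,\ x\bigr).$$ On $\Sigma$, $Xf=y$, $Yf=x$; the crossing region is $\Sigma^{\rm c}=\{(x,y,0):xy>0\}$. Crossing trajectories follow $X$ in $z>0$, $Y$ in $z<0$, and are concatenated at points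 of $\Sigma^{\rm c}$. A crossing (crossing-only) periodic orbit is a periodic orbit $\gamma$ with $\varnothing\ne\gamma\cap\Sigma\subset\Sigma^{\rm c}$; it has simple period if $\gamma\cap\Sigma$ consists of exactly two distinct points. For $p=(x,y,0)$ with $y\ge0$, $\Pi_X(p)\in\Sigma$ is the first return (at positive time) to $\Sigma$ of the $X$-trajectory issued from $p$ (it exists). Points of $\Sigma$ are identified with $(x,y)$. $F=S\circ\Pi_X$ is the reduced map and $\mathcal D=\{(x,y,0): x>0,\ y>0\}$. Set $\zeta_\mu=\frac1{1+\mu^2}$, $\beta_\mu=\frac{2\mu}{1+\mu^2}$; $t_{\mathrm g}(\mu)\in(\pi,2\pi)$ is the solution of $\frac{\cos t-e^{-\mu t}}{\sin t}=\mu$; $H_{\mathrm g}(\mu)=e^{-2\mu t_{\mathrm g}(\mu)}$, $H_{\mathrm{crit}}(\mu)=\frac1{2\cosh(\pi\mu)-1}$, $\mathcal I_\mu=(H_{\mathrm g}(\mu),H_{\mathrm{crit}}(\mu))$. For $t\in(\pi,t_{\mathrm g}(\mu))$, $$y_0(t)=\zeta_\mu\Bigl(\tfrac{\cos t-e^{-\mu t}}{\sin t}-\mu\Bigr),\quad x_0(t)=\zeta_\mu\Bigl(\mu-\tfrac{e^{\mu t}-\cos t}{\sin t}\Bigr),\quad \eta(t)=\tfrac{x_0y_0+\zeta_\mu}{x_0^2+y_0^2-x_0y_0-\beta_\mu(x_0-y_0)+\zeta_\mu}.$$ The map $\eta:(\pi,t_{\mathrm g}(\mu))\to\mathcal I_\mu$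 is a strictly decreasing bijection; for $H\in\mathcal I_\mu$ and $t=\eta^{-1}(H)$, $\gamma_{(\mu,H)}$ denotes the crossing periodic orbit of simple period through $(x_0(t),y_0(t),0)$. A chain of flights is a sequence $(x_n,y_n)_{n\ge0}$ with $(x_{n+1},y_{n+1})=F(x_n,y_n)$; the ordinates $y_n$, $n\ge1$, are the landing ordinates, and a zero-duration contact with a fold is a landing with $y_n=0$ (from which the next flight is launched immediately). A trajectory converges orbitally to $\gamma$ if its distance to $\gamma$ tends to $0$ as time tends to $+\infty$. *)

(* Defs.v *)
(* Stdlib real numbers with Coquelicot. *)
From Stdlib Require Import Reals ClassicalEpsilon.
From Coquelicot Require Import Coquelicot.
Open Scope R_scope.

(* Coquelicot's product structures on [R * R * R] are used throughout for
   derivatives and limits; its product norm is the Euclidean norm. *)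
Definition R3 : Type := (R * R * R)%type.
Definition xc (p : R3) : R := fst (fst p).
Definition yc (p : R3) : R := snd (fst p).
Definition zc (p : R3) : R := snd p.

Definition Sym (p : R3) : R3 := (- yc p, - xc p, - zc p).

Definition fieldX (mu H : R) (p : R3) : R3 :=
  (- 2 * mu * xc p - H * (9 * mu ^ 2 + 1) * zc p + H,
   2 * mu * yc p - (1 + mu ^ 2) * zc p + 1,
   yc p).

Definition fieldY (mu H : R) (p : R3) : R3 :=
  (2 * mu * xc p - (1 + mu ^ 2) * zc p - 1,
   - 2 * mu * yc p - H * (9 * mu ^ 2 + 1) * zc p - H,
   xc p).

Lemma fieldY_conj (mu H : R) (p : R3) :
  fieldY mu H p = Sym (fieldX mu H (Sym p)).
Proof.
  unfold fieldY, fieldX, Sym, xc, yc, zc; simpl.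
  f_equal; [f_equal|]; ring.
Qed.

Definition on_Sigma (p : R3) : Prop := zc p = 0.
Definition in_Sigma_c (p : R3) : Prop := on_Sigma p /\ 0 < xc p * yc p.

(* On the switching plane Xf = y and Yf = x. *)
Definition crossing_up (p : R3) : Prop := in_Sigma_c p /\ 0 < yc p.
Definition crossing_down (p : R3) : Prop := in_Sigma_c p /\ yc p < 0.

Definition integral_curve (V : R3 -> R3) (psi : R -> R3) : Prop :=
  forall s : R, is_derive psi s (V (psi s)).

Definition follows_after
    (J : R -> Prop) (V : R3 -> R3) (phi : R -> R3) (s : R) : Prop :=
  exists psi : R -> R3, integral_curve V psi /\
    exists d : R, 0 < d /\
      forall r : R, J r -> s <= r < s + d -> phi r = psi r.

Definition follows_before
    (J : R -> Prop) (V : R3 -> R3) (phi : R -> R3) (s : R) : Prop :=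
  exists psi : R -> R3, integral_curve V psi /\
    exists d : R, 0 < d /\
      forall r : R, J r -> s - d < r <= s -> phi r = psi r.

(* [phi] is a trajectory of Z over the time interval [J].  Only continuity is
   required at points of Sigma outside the crossing region, so every way of
   continuing a Filippov solution there (sliding, folds) is admitted. *)
Definition Z_trajectory (mu H : R) (J : R -> Prop) (phi : R -> R3) : Prop :=
  forall s : R, J s ->
    filterlim phi (within J (locally s)) (locally (phi s)) /\
    (0 < zc (phi s) \/ crossing_up (phi s) ->
       follows_after J (fieldX mu H) phi s) /\
    (zc (phi s) < 0 \/ crossing_down (phi s) ->
       follows_after J (fieldY mu H) phi s) /\
    (0 < zc (phi s) \/ crossing_down (phi s) ->
       follows_before J (fieldX mu H) phi s) /\
    (zc (phi s) < 0 \/ crossing_up (phi s) ->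
       follows_before J (fieldY mu H) phi s).

Definition forward_trajectory (mu H : R) (phi : R -> R3) : Prop :=
  Z_trajectory mu H (fun s => 0 <= s) phi.

Definition periodic_orbit (mu H : R) (gamma : R3 -> Prop) : Prop :=
  exists (phi : R -> R3) (T : R),
    Z_trajectory mu H (fun _ => True) phi /\
    0 < T /\ (forall s : R, phi (s + T) = phi s) /\
    (forall q : R3, gamma q <-> exists s : R, phi s = q).

Definition crossing_periodic_orbit (mu H : R) (gamma : R3 -> Prop) : Prop :=
  periodic_orbit mu H gamma /\
  (exists q : R3, gamma q /\ on_Sigma q) /\
  (forall q : R3, gamma q -> on_Sigma q -> in_Sigma_c q).

Definition simple_period (gamma : R3 -> Prop) : Prop :=
  exists q1 q2 : R3, q1 <> q2 /\
    forall q : R3, (gamma q /\ on_Sigma q) <-> (q = q1 \/ q = q2).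

Definition dist_to (gamma : R3 -> Prop) (p : R3) : R :=
  real (Glb_Rbar (fun d => exists q : R3, gamma q /\ d = norm (minus p q))).

Definition converges_orbitally (phi : R -> R3) (gamma : R3 -> Prop) : Prop :=
  is_lim (fun s => dist_to gamma (phi s)) p_infty 0.

Definition first_return (mu H : R) (p q : R3) : Prop :=
  exists (psi : R -> R3) (s : R),
    integral_curve (fieldX mu H) psi /\ psi 0 = p /\
    0 < s /\ psi s = q /\ on_Sigma q /\
    (forall r : R, 0 < r < s -> ~ on_Sigma (psi r)).

(* Total by Hilbert's epsilon; meaningful where the first return exists, in
   particular on the points of Sigma with nonnegative ordinate. *)
Definition Pi_X (mu H : R) (p : R3) : R3 :=
  epsilon (inhabits p) (first_return mu H p).

Definition to_Sigma (p : R * R) : R3 := (fst p, snd p, 0).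

Definition F (mu H : R) (p : R * R) : R * R :=
  fst (Sym (Pi_X mu H (to_Sigma p))).

Definition D (p : R * R) : Prop := 0 < fst p /\ 0 < snd p.

Definition D_infty (mu H : R) (p : R * R) : Prop :=
  D p /\ forall n : nat, D (Nat.iter n (F mu H) p).

Definition chain_of_flights (mu H : R) (u : nat -> R * R) : Prop :=
  forall n : nat, u (S n) = F mu H (u n).

Definition zeta (mu : R) : R := 1 / (1 + mu ^ 2).
Definition beta (mu : R) : R := 2 * mu / (1 + mu ^ 2).

Definition is_t_g (mu tg : R) : Prop :=
  PI < tg < 2 * PI /\ (cos tg - exp (- mu * tg)) / sin tg = mu.

Definition H_g (mu tg : R) : R := exp (- 2 * mu * tg).
Definition H_crit (mu : R) : R := 1 / (2 * cosh (PI * mu) - 1).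

Definition y0 (mu t : R) : R :=
  zeta mu * ((cos t - exp (- mu * t)) / sin t - mu).
Definition x0 (mu t : R) : R :=
  zeta mu * (mu - (exp (mu * t) - cos t) / sin t).
Definition eta (mu t : R) : R :=
  (x0 mu t * y0 mu t + zeta mu) /
  (x0 mu t ^ 2 + y0 mu t ^ 2 - x0 mu t * y0 mu t
   - beta mu * (x0 mu t - y0 mu t) + zeta mu).

(* Main.v *)
Require Import Defs.
From Stdlib Require Import Reals Lra Lia Psatz ZArith Classical ClassicalEpsilon FunctionalExtensionality.
From Stdlib Require List Ring_polynom.
From Coquelicot Require Import Coquelicot.
Open Scope R_scope.

(** The reduced map has a strict Lyapunov function.

    Put [c = 1 + mu ^ 2], [r = exp (- mu * PI)] and [q = / r].  The flow of X is
    explicit.  A flight launched from [(x, y)] with [y >= 0] lasts [PI + s], where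
    [s] in [(0, s0]] is the solution of [V s = c * y] for a decreasing function [V]
    that vanishes at [s0 = t_g - PI].  It lands at abscissa [U s / c]
    ([F_explicit]).  In the variables [x] and [v] for the multiples by [c] of the
    coordinates, the reduced map is the recursion
    [x' = U], [v' + E * x = H * (U + E * v)], with
    [E = r ^ 2 * psi], [psi = exp (- 2 * mu * s)], and [U] and [psi] functions of
    [v].  It makes sense for all [v >= 0], contacts with the fold included, which
    is why a chain only has to keep its ordinates nonnegative.

    Let [(us, vs)] be the fixed point, [K = 1 - r + r ^ 2] and [th = H * K / r];
    the hypothesis [H < H_crit mu] says [th < 1].  The Lyapunov function is
    [(x - us - th * q * (v - vs)) ^ 2 / 2 + G v], where the derivative of [G] is a
    combination with positive coefficients of [v - vs], of the decrease of
    [D = U - q * v] and of the increase of [psi] from [vs] to [v].  Its decrease along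
    one step is bounded below by a quadratic form in [v - vs] and [v' - v]
    ([decrease]).  The properties of [D] and [psi] confine the coefficients of this
    form: [D] is a decreasing convex function of [v] with slope at least [- q],
    [v * (1 - psi)] increases, and so does [v * (1 - psi) / psi], though more slowly
    than [D] decreases ([D_convex], [om_decr], [Pi_decr], [PiD_incr]); the chords
    of [psi] have slopes bounded by two explicit constants ([weighted_slope_bound],
    [slope_bound]).  The discriminant of the form is concave in the remaining
    unknown [W], so its sign is decided at the ends of the interval of [W]
    ([Sform_pos]).  There it becomes twelve polynomial inequalities in four
    variables on the unit cube, whose homogenized polynomials have nonnegative
    coefficients ([Bernstein.eval_nonneg]).

    The sublevel sets of the function are bounded, so every chain with nonnegative
    ordinates converges to the fixed point ([chain_converges], [chain_limit_F]).
    Since the limit has a positive ordinate, only finitely many landings are on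
    the fold.

    A trajectory of Z starting in [D_infty] follows the flights of its chain, every
    other one reflected by [Sym] ([follow_chain]); the fixed point yields a periodic
    trajectory whose period consists of a flight and its reflection
    ([cycle_crossing], [cycle_simple]).  Continuity of the flow turns convergence of
    the launching points into orbital convergence ([orbital_convergence]).
    Finally, the contacts of a crossing periodic orbit form, up to reflection, a
    periodic orbit of the reduced map inside [D_infty]; as it converges, it is the
    fixed point, so that the orbit is the cycle just built ([cycle_unique]), with
    two contacts only. *)

(** * Polynomial inequalities on the unit cube *)

Module Bernstein.
Import List Ring_polynom.
Import ListNotations.

Inductive pexp : Set :=
| Cst (z : Z) | Var (n : nat) | Add (f g : pexp) | Sub (f g : pexp)
| Mul (f g : pexp) | Pow (f : pexp) (n : nat).

Fixpoint eval (x : nat -> R) (f : pexp) : R :=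
  match f with
  | Cst z => IZR z
  | Var n => x n
  | Add f g => eval x f + eval x g
  | Sub f g => eval x f - eval x g
  | Mul f g => eval x f * eval x g
  | Pow f n => eval x f ^ n
  end.

Notation peval := (PEeval 0 1 Rplus Rmult Rminus Ropp IZR N.to_nat pow).
Notation normal := (norm_aux 0%Z 1%Z Z.add Z.mul Z.sub Z.opp Z.eqb).

(** The homogenized polynomial lives in two ring variables per variable [x n],
    standing for [x n] and [1 - x n]; both are nonnegative on the cube. *)
Definition X (n : nat) : PExpr Z := PEX Z (Pos.of_succ_nat n)~0.
Definition Y (n : nat) : PExpr Z := PEX Z (Pos.of_succ_nat n)~1.

Definition vars : nat := 4.

(** Raising a form to the multidegree [d] multiplies it by powers of
    [x i + (1 - x i)], that is by 1. *)
Definition pad (d : list nat) (h : list nat * PExpr Z) : PExpr Z :=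
  fold_right (fun i p =>
    PEmul (PEpow (PEadd (X i) (Y i)) (N.of_nat (nth i d 0 - nth i (fst h) 0)%nat)) p)
    (snd h) (seq 0 vars).

Definition degrees (f : nat -> nat) : list nat := map f (seq 0 vars).

(** The pair of a multidegree and a polynomial that is homogeneous of that degree
    in each couple [x i, 1 - x i] and agrees with [f] on the cube.  Its
    coefficients are, up to positive binomial factors, the Bernstein coefficients
    of [f]. *)
Fixpoint hom (f : pexp) : list nat * PExpr Z :=
  match f with
  | Cst z => ([], PEc z)
  | Var n => (degrees (fun i => if Nat.eqb i n then 1 else 0)%nat, X n)
  | Add f g =>
      let h := hom f in let k := hom g in
      let d := degrees (fun i => Nat.max (nth i (fst h) 0) (nth i (fst k) 0))%nat in
      (d, PEadd (pad d h) (pad d k))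
  | Sub f g =>
      let h := hom f in let k := hom g in
      let d := degrees (fun i => Nat.max (nth i (fst h) 0) (nth i (fst k) 0))%nat in
      (d, PEsub (pad d h) (pad d k))
  | Mul f g =>
      let h := hom f in let k := hom g in
      (degrees (fun i => nth i (fst h) 0 + nth i (fst k) 0)%nat, PEmul (snd h) (snd k))
  | Pow f n =>
      let h := hom f in
      (degrees (fun i => nth i (fst h) 0 * n)%nat, PEpow (snd h) (N.of_nat n))
  end.

Fixpoint nonneg_coefs (p : Pol Z) : bool :=
  match p with
  | Pc c => (0 <=? c)%Z
  | Pinj _ p => nonneg_coefs p
  | PX p _ q => (nonneg_coefs p && nonneg_coefs q)%bool
  end.

Section S.
Variable x : nat -> R.
Definition env : list R :=
  0 :: flat_map (fun i => [x i; 1 - x i]) (seq 0 vars).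

Fixpoint vars_ok (f : pexp) : bool :=
  match f with
  | Cst _ => true | Var n => Nat.ltb n vars
  | Add f g | Sub f g | Mul f g => (vars_ok f && vars_ok g)%bool
  | Pow f _ => vars_ok f
  end.

Lemma env_XY n : (n < vars)%nat -> peval env (X n) = x n /\ peval env (Y n) = 1 - x n.
Proof.
unfold vars. intros H.
do 4 (destruct n as [|n]; [split; reflexivity|]). lia.
Qed.

Lemma pad_eval d h : peval env (pad d h) = peval env (snd h).
Proof.
unfold pad. assert (H : forall i, In i (seq 0 vars) -> (i < vars)%nat) by (intros i Hi; apply in_seq in Hi; lia).
induction (seq 0 vars) as [|i l IH]; [reflexivity|].
cbn [fold_right PEeval]. rewrite IH by (intros; apply H; right; auto).
destruct (env_XY i) as [-> ->]; [apply H; left; reflexivity|].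
replace (x i + (1 - x i)) with 1 by ring. rewrite pow1. ring.
Qed.

Lemma hom_eval f : vars_ok f = true -> peval env (snd (hom f)) = eval x f.
Proof.
induction f; cbn [vars_ok hom snd eval PEeval]; intros H;
  try (apply Bool.andb_true_iff in H; destruct H as [H1 H2]).
- reflexivity.
- apply env_XY. now apply Nat.ltb_lt.
- now rewrite !pad_eval, IHf1, IHf2.
- now rewrite !pad_eval, IHf1, IHf2.
- now rewrite IHf1, IHf2.
- now rewrite Nnat.Nat2N.id, IHf.
Qed.

Lemma nonneg_coefs_sound p : forall l, (forall a, In a l -> 0 <= a) ->
  nonneg_coefs p = true -> 0 <= Pphi 0 Rplus Rmult IZR l p.
Proof.
induction p as [?|j p IHp|p1 IHp1 j p2 IHp2]; intros l Hl H; cbn [nonneg_coefs Pphi] in *.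
- apply IZR_le. now apply Z.leb_le.
- apply IHp; auto. intros y Hy. apply Hl.
  clear -Hy. revert l Hy.
  assert (T : forall (l : list R) c, In c (tl l) -> In c l)
    by (intros [|? ?] ?; simpl; auto).
  induction j; simpl; intros; eauto.
- apply Bool.andb_true_iff in H as [H1 H2].
  assert (0 <= hd 0 l) by (destruct l; simpl; [lra|apply Hl; left; auto]).
  assert (forall p, 0 <= pow_pos Rmult (hd 0 l) p).
  { induction p; simpl; auto; repeat apply Rmult_le_pos; auto. }
  apply Rplus_le_le_0_compat; [apply Rmult_le_pos|]; auto.
  apply IHp2; auto. intros y Hy; apply Hl. destruct l; simpl in *; auto.
Qed.

(** A polynomial whose homogenization has nonnegative coefficients is a sum of
    products of nonnegative numbers.  The coefficients are integers obtained by
    the normalization of the [ring] tactic, so the test is a computation. *)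
Theorem eval_nonneg f :
  (forall i, (i < vars)%nat -> 0 <= x i <= 1) ->
  (vars_ok f && nonneg_coefs (normal (snd (hom f))))%bool = true ->
  0 <= eval x f.
Proof.
intros Hx H. apply Bool.andb_true_iff in H as [H1 H2].
rewrite <- hom_eval by assumption.
rewrite (norm_aux_spec (Eqsth R) (Eq_ext Rplus Rmult Ropp)
  (Rth_ARth (Eqsth R) (Eq_ext Rplus Rmult Ropp) RTheory) R_rm R_power_theory).
apply nonneg_coefs_sound; auto.
intros a Ha. unfold env in Ha. destruct Ha as [<-|Ha]; [lra|].
apply in_flat_map in Ha as [i [Hi Ha]]. apply in_seq in Hi.
assert (i < vars)%nat by lia. specialize (Hx i H).
destruct Ha as [<-|[<-|[]]]; lra.
Qed.
End S.

Ltac reify a b c d e :=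
  lazymatch e with
  | a => constr:(Var 0) | b => constr:(Var 1) | c => constr:(Var 2) | d => constr:(Var 3)
  | ?u + ?v => let u := reify a b c d u in let v := reify a b c d v in constr:(Add u v)
  | ?u - ?v => let u := reify a b c d u in let v := reify a b c d v in constr:(Sub u v)
  | ?u * ?v => let u := reify a b c d u in let v := reify a b c d v in constr:(Mul u v)
  | ?u ^ ?n => let u := reify a b c d u in constr:(Pow u n)
  | IZR ?z => constr:(Cst z)
  end.
Ltac prove_nonneg a b c d :=
  lazymatch goal with |- 0 <= ?e =>
    let f := reify a b c d e in
    apply (eval_nonneg (fun i => match i with 0 => a | 1 => b | 2 => c | _ => d end)%nat f);
    [ intros [|[|[|?]]] ?; assumption | vm_compute; reflexivity ]
  end.
End Bernstein.

(** * The polynomial inequality *)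

(** For [N = 1 - rho * psi ^ 2 * (1 + l)], [U = W - psi ^ 2 * g] and
    [P = W ^ 2 - psi ^ 2 * b ^ 2] one has
    [N * P - U ^ 2 = psi ^ 2 * Sform rho g b psi l W]: up to the factor [psi ^ 2]
    this is minus a quarter of the discriminant of the quadratic form
    [N * z ^ 2 + 2 * U * v * z + P * v ^ 2] met in the decrease of the Lyapunov
    function. *)
Definition Sform (rho g b psi l W : R) : R :=
  2 * W * g - rho * (1 + l) * (W ^ 2 - psi ^ 2 * b ^ 2) - b ^ 2 - psi ^ 2 * g ^ 2.

(** [Sform] with its denominators cleared: [psi] and [K * W] are counted in units
    of 1/26, and the product of [l] with its denominator [den] in units of 1/20,
    which makes all the coefficients of the instances below integers. *)
Definition Tform (K rho g b psi den lyn KW : R) : R :=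
  20 * den * (2 * 26 * K * KW * g - K ^ 2 * (26 ^ 2 * b ^ 2 + psi ^ 2 * g ^ 2))
  - rho * (20 * den + lyn) * (KW ^ 2 - K ^ 2 * psi ^ 2 * b ^ 2).

(** The slack [l] has two upper bounds, [13/10 * (1 - psi)] and [11/20 * (1 - r)];
    which one is smaller separates the cases A ([26 * (1 - psi)] below [11 * s])
    and B ([26 * (1 - psi)] between [11 * s] and its maximum [26 * s * (1 + r)],
    reached at [psi = r ^ 2]); [o] runs through the case.  In case II,
    [del < s * (1 + r ^ 2) * a], the bounds are multiplied by
    [x * (1 + r ^ 3) / (1 + r ^ 3 * x)]; in case I they are not.  In each case the
    coordinate [x] is chosen so that the unit cube parametrizes exactly the
    admissible values of [del].  The suffixes plus and minus stand for the upper
    and lower end of the interval of [W]. *)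
Section Cases.
Variables r a x o : R.
Hypotheses (Hr : 0 <= r <= 1) (Ha : 0 <= a <= 1) (Hx : 0 <= x <= 1) (Ho : 0 <= o <= 1).
Let s := 1 - r.
Let K := 1 - r + r ^ 2.
Let wA := 11 * s * o.
Let wB := s * (11 + o * (26 * (1 + r) - 11)).
Let lA := 11 * s * o.
Let lB := 11 * s.
Let dII := s * (1 + r ^ 2) * a * x.
Let dI := s * ((1 + r ^ 2) * a + x * (1 + r + r ^ 2 + r ^ 4 - (1 + r ^ 2) * a)).

Definition Tform_at (r a del w den lyn KW : R) :=
  let th := 1 - del in
  Tform (1 - r + r ^ 2) (1 - th * (1 - r)) (del + th * r * a) (r * (a - del)) (26 - w) den lyn KW.
Local Ltac go := unfold Tform_at, Tform, dII, dI, wA, wB, lA, lB, K, s; Bernstein.prove_nonneg r a x o.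

Lemma T_II_A_plus : 0 <= Tform_at r a dII wA (1 + r ^ 3 * x) (lA * (x * (1 + r ^ 3)))
   (K * (26 + wA * r) * dII + 26 * (1 - dII) * a).
Proof. go. Qed.
Lemma T_II_B_plus : 0 <= Tform_at r a dII wB (1 + r ^ 3 * x) (lB * (x * (1 + r ^ 3)))
   (K * (26 + wB * r) * dII + 26 * (1 - dII) * a).
Proof. go. Qed.
Lemma T_II_A_minus : 0 <= Tform_at r a dII wA (1 + r ^ 3 * x) (lA * (x * (1 + r ^ 3)))
   (K * (26 - wA) * dII + 26 * (1 - dII) * a).
Proof. go. Qed.
Lemma T_II_B_minus : 0 <= Tform_at r a dII wB (1 + r ^ 3 * x) (lB * (x * (1 + r ^ 3)))
   (K * (26 - wB) * dII + 26 * (1 - dII) * a).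
Proof. go. Qed.
Lemma T_I_A_plus : 0 <= Tform_at r a dI wA 1 lA (K * (26 + wA * r) * dI + 26 * (1 - dI) * a).
Proof. go. Qed.
Lemma T_I_B_plus : 0 <= Tform_at r a dI wB 1 lB (K * (26 + wB * r) * dI + 26 * (1 - dI) * a).
Proof. go. Qed.
Lemma T_I_A_minus : 0 <= Tform_at r a dI wA 1 lA (K * (26 - wA) * dI + 26 * (1 - dI) * a).
Proof. go. Qed.
Lemma T_I_B_minus : 0 <= Tform_at r a dI wB 1 lB (K * (26 - wB) * dI + 26 * (1 - dI) * a).
Proof. go. Qed.
End Cases.

(** The lower end of [W] has another form when [th > K], that is
    [del < 1 - K = r * s].  There [del = r * s * d], and the formulas are
    multiplied by [1 + r ^ 2] to avoid dividing in the parametrization of [a]. *)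
Section Cases'.
Variables r x d o : R.
Hypotheses (Hr : 0 <= r <= 1) (Hx : 0 <= x <= 1) (Hd : 0 <= d <= 1) (Ho : 0 <= o <= 1).
Let s := 1 - r.
Let K := 1 - r + r ^ 2.
Let wA := 11 * s * o.
Let wB := s * (11 + o * (26 * (1 + r) - 11)).
Let lA := 11 * s * o.
Let lB := 11 * s.
Let del := r * s * d.
(* In this section [aII] and [aI] are the values of [(1 + r ^ 2) * a]. *)
Let aII := d * r + x * (1 + r ^ 2 - d * r).
Let aI := x * d * r.
Definition Tform_scaled (r aR del w den lyn KW : R) :=
  let th := 1 - del in let dR := del * (1 + r ^ 2) in
  Tform (1 - r + r ^ 2) (1 - th * (1 - r)) (dR + th * r * aR) (r * (aR - dR)) (26 - w) den lyn KW.
Local Ltac go := unfold Tform_scaled, Tform, aII, aI, del, wA, wB, lA, lB, K, s; Bernstein.prove_nonneg r x d o.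
Let KW aR w := K * (26 - w) * (del * (1 + r ^ 2)) + 26 * (r + s ^ 2 * d) * aR.
Lemma T_II_A_low : 0 <= Tform_scaled r aII del wA (aII + r ^ 4 * d) (lA * (r * d * (1 + r ^ 3))) (KW aII wA).
Proof. unfold KW; go. Qed.
Lemma T_II_B_low : 0 <= Tform_scaled r aII del wB (aII + r ^ 4 * d) (lB * (r * d * (1 + r ^ 3))) (KW aII wB).
Proof. unfold KW; go. Qed.
Lemma T_I_A_low : 0 <= Tform_scaled r aI del wA 1 lA (KW aI wA).
Proof. unfold KW; go. Qed.
Lemma T_I_B_low : 0 <= Tform_scaled r aI del wB 1 lB (KW aI wB).
Proof. unfold KW; go. Qed.
End Cases'.

(** The coefficient of [W ^ 2] in [Sform] is [- rho * (1 + l)]; the interpolation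
    identity between [lo] and [hi] exhibits the concavity. *)
Lemma Sform_concave rho g b psi l lo hi W : 0 <= rho -> 0 <= l -> lo <= W <= hi ->
  0 <= Sform rho g b psi l lo -> 0 <= Sform rho g b psi l hi -> 0 <= Sform rho g b psi l W.
Proof.
intros Hr Hl HW H1 H2.
destruct (Req_dec lo hi) as [e|ne]; [replace W with lo by lra; exact H1|].
apply Rmult_le_reg_l with (hi - lo); [lra|]. rewrite Rmult_0_r.
replace ((hi - lo) * Sform rho g b psi l W) with
 ((hi - W) * Sform rho g b psi l lo + (W - lo) * Sform rho g b psi l hi
  + rho * (1 + l) * ((hi - lo) * ((W - lo) * (hi - W)))) by (unfold Sform; ring).
assert (0 <= (hi - W) * Sform rho g b psi l lo) by (apply Rmult_le_pos; lra).
assert (0 <= (W - lo) * Sform rho g b psi l hi) by (apply Rmult_le_pos; lra).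
assert (0 <= rho * (1 + l) * ((hi - lo) * ((W - lo) * (hi - W)))) by
 (repeat apply Rmult_le_pos; lra).
lra.
Qed.

Lemma Tform_inv K rho g b psi den l W lyn KW c : 0 < K -> 0 < den -> 0 < c ->
  lyn = 20 * (l * den) -> KW = c * (26 * (K * W)) ->
  0 <= Tform K rho (c * g) (c * b) (26 * psi) den lyn KW -> 0 <= Sform rho g b psi l W.
Proof.
intros HK Hd Hc -> ->.
replace (Tform K rho (c * g) (c * b) (26 * psi) den (20 * (l * den)) (c * (26 * (K * W))))
 with (20 * 26 ^ 2 * den * K ^ 2 * c ^ 2 * Sform rho g b psi l W)
 by (unfold Tform, Sform; ring).
intros H.
assert (0 < 20 * 26 ^ 2 * den * K ^ 2 * c ^ 2) by
 (repeat apply Rmult_lt_0_compat; try apply pow_lt; lra).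
apply Rmult_le_reg_l with (1 := H0). lra.
Qed.

(** The coefficient of [a] in the lower bound for [W].  With [h = th / K] it is [h]
    when [h <= 1] and [h - (h - 1) / r] otherwise, according to the sign of the
    factor [1 - h] in the decomposition of [W]. *)
Definition low_slope r th := let K := 1 - r + r ^ 2 in
  if Rle_dec th K then th / K else (r + (1 - r) * (1 - th) / r) / K.

Section Sform_bound.
Variables r th psi a : R.
Let s := 1 - r.
Let K := 1 - r + r ^ 2.
Let del := 1 - th.
Let rho := 1 - th * s.
Let g := del + th * r * a.
Let b := r * (a - del).
Hypothesis Hr : 0 < r < 1.
Hypothesis Hth : K * r ^ 3 <= th < 1.
Hypothesis Hpsi : r ^ 2 <= psi < 1.
Hypothesis Ha : 0 <= a <= 1.
Let hi := (1 + (1 - psi) * r) * del + th / K * a.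
Let lo := psi * del + low_slope r th * a.

Lemma K_pos : 0 < K. Proof. unfold K. nra. Qed.

(** Both factors of [(W - psi * b) * (W + psi * b)] are positive.  The first one is
    least at [W = lo]; for [th <= K] it is there affine in [a], hence a combination
    of its values at [a = 0] and [a = 1]. *)
Lemma lo_XY W : lo <= W -> 0 < W ^ 2 - psi ^ 2 * b ^ 2.
Proof.
pose proof K_pos as HK. intros HW.
assert (Hps : 0 < psi) by nra.
assert (Hdel : 0 < del) by (unfold del; lra).
assert (Hth0 : 0 < th) by (assert (0 < K * r ^ 3) by (apply Rmult_lt_0_compat; [|apply pow_lt]; lra); lra).
assert (P1 : 0 < psi * del) by (apply Rmult_lt_0_compat; lra).
assert (P2 : 0 < psi * del * (1 - r)) by (apply Rmult_lt_0_compat; lra).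
assert (P3 : 0 <= psi * r * a) by (repeat apply Rmult_le_pos; lra).
assert (Hh : 0 <= low_slope r th).
{ unfold low_slope. fold K. assert (0 < K * r ^ 3) by (apply Rmult_lt_0_compat; [|apply pow_lt]; lra).
  destruct (Rle_dec th K).
  - apply Rle_mult_inv_pos; lra.
  - apply Rle_mult_inv_pos; [|lra]. apply Rplus_le_le_0_compat; [lra|].
    apply Rle_mult_inv_pos; [|lra]. apply Rmult_le_pos; lra. }
assert (0 <= low_slope r th * a) by (apply Rmult_le_pos; lra).
assert (A1 : 0 < W + psi * b).
{ unfold lo in HW. unfold b. nra. }
assert (A2 : 0 < lo - psi * b).
{ unfold lo, b, low_slope. fold K. destruct (Rle_dec th K) as [h|h].
  - apply Rmult_lt_reg_l with K; [lra|]. rewrite Rmult_0_r.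
    replace (K * (psi * del + th / K * a - psi * (r * (a - del)))) with
      ((1 - a) * (psi * (1 - th) * (1 + r ^ 3)) + a * (K * psi + th * (1 - psi * (1 + r ^ 3))))
      by (unfold del, K; field; nra).
    assert (0 < psi * (1 - th) * (1 + r ^ 3)).
    { repeat apply Rmult_lt_0_compat; try lra. assert (0 < r ^ 3) by (apply pow_lt; lra). lra. }
    assert (0 < K * psi + th * (1 - psi * (1 + r ^ 3))).
    { assert (r ^ 3 < 1). { destruct (pow_lt_1_compat r 3); [lra|lia|lra]. }
      assert (psi * r ^ 3 < 1) by nra.
      destruct (Rle_dec 0 (1 - psi * (1 + r ^ 3))).
      - assert (0 <= th * (1 - psi * (1 + r ^ 3))) by (apply Rmult_le_pos; lra).
        assert (0 < K * psi) by (apply Rmult_lt_0_compat; lra). lra.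
      - assert (K * (1 - psi * (1 + r ^ 3)) <= th * (1 - psi * (1 + r ^ 3))) by nra.
        assert (0 < K * (1 - psi * r ^ 3)) by (apply Rmult_lt_0_compat; lra). nra. }
    destruct (Rle_dec a (1/2)).
    { apply Rplus_lt_le_0_compat; [apply Rmult_lt_0_compat|apply Rmult_le_pos]; lra. }
    { apply Rplus_le_lt_0_compat; [apply Rmult_le_pos|apply Rmult_lt_0_compat]; lra. }
  - assert (psi * r <= (r + (1 - r) * (1 - th) / r) / K).
    { apply Rmult_le_reg_r with K; [lra|].
      replace ((r + (1 - r) * (1 - th) / r) / K * K) with (r + (1 - r) * (1 - th) / r) by (field; lra).
      assert (0 <= (1 - r) * (1 - th) / r) by (apply Rle_mult_inv_pos; [apply Rmult_le_pos|]; lra).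
      assert (psi * K <= 1) by (unfold K; nra). nra. }
    nra. }
replace (W ^ 2 - psi ^ 2 * b ^ 2) with ((W - psi * b) * (W + psi * b)) by ring.
apply Rmult_lt_0_compat; lra.
Qed.

Lemma del_pos : 0 < del. Proof. unfold del; lra. Qed.
Lemma s_pos : 0 < s. Proof. unfold s; lra. Qed.
Lemma r3_pos : 0 < r ^ 3. Proof. apply pow_lt; lra. Qed.
Lemma cube_r : 0 <= r <= 1. Proof. lra. Qed.

Lemma lo_small : th <= K -> lo = psi * del + th / K * a.
Proof.
intros hK. unfold lo, low_slope; fold K. destruct (Rle_dec th K); [reflexivity|contradiction].
Qed.
Lemma lo_big : K < th -> K * lo = K * psi * del + (r + s * del / r) * a.
Proof.
intros hK. unfold lo, low_slope; fold K. destruct (Rle_dec th K); [lra|].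
unfold del, s. field. pose proof K_pos. lra.
Qed.
Lemma big_d : K < th -> exists d, 0 <= d <= 1 /\ r * s * d = del.
Proof.
intros hK. pose proof s_pos as Hs. pose proof del_pos.
assert (Hrs : 0 < r * s) by (apply Rmult_lt_0_compat; lra).
exists (del / (r * s)). split; [|field; lra].
split; [apply Rle_mult_inv_pos; lra|].
apply Rmult_le_reg_r with (1 := Hrs). unfold Rdiv; rewrite Rmult_assoc, Rinv_l by lra.
assert (r * s = 1 - K) by (unfold s, K; ring). unfold del; lra.
Qed.

(** The cases A and B, with [B0] the smaller of the two bounds for [l]. *)
Definition w_case (o B0 : R) : Prop :=
  (26 * (1 - psi) = 11 * s * o /\ 20 * B0 = 11 * s * o) \/
  (26 * (1 - psi) = s * (11 + o * (26 * (1 + r) - 11)) /\ 20 * B0 = 11 * s).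

(* [conclude] identifies an instance [T] of the cleared inequalities with the goal:
   [E] undoes the parametrization of [del] and [dn], [cc] are the denominators. *)
Ltac eqs := f_equal; try reflexivity; try (field; lra);
  try match goal with W1 : 26 * (1 - _) = ?x, W2 : 20 * ?B = ?x |- _ =>
    rewrite W1, <- W2; field; lra end;
  unfold rho, g, b, hi, del, K, s; try ring; (field; nra).
Ltac conclude T A E dn cc :=
  unfold Tform_at, Tform_scaled in T; cbv zeta in T; change (1 - r) with s in T; rewrite E in T;
  match goal with W1 : 26 * _ = _, W2 : 20 * _ = _ |- _ => rewrite <- ?W1, <- ?W2 in T end;
  (eapply (Tform_inv K) with (den := dn) (c := cc); [exact K_pos|lra|lra|reflexivity|A|]);
  refine (eq_ind _ (fun z => 0 <= z) T _ _); eqs.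

Section II.
Hypothesis h : del < s * (1 + r ^ 2) * a.
Variables o B0 : R.
Hypothesis Ho : 0 <= o <= 1.
Hypothesis Hw : w_case o B0.
Let x := del / (s * (1 + r ^ 2) * a).
Let y := x * (1 + r ^ 3) / (1 + r ^ 3 * x).

Lemma II_a_pos : 0 < s * (1 + r ^ 2) * a.
Proof. pose proof del_pos; lra. Qed.
Lemma II_x : 0 <= x <= 1.
Proof.
pose proof II_a_pos. pose proof del_pos. unfold x; split; [apply Rle_mult_inv_pos; lra|].
apply Rmult_le_reg_r with (1 := H).
unfold Rdiv; rewrite Rmult_assoc, Rinv_l; lra.
Qed.
Lemma II_del : s * (1 + r ^ 2) * a * x = del.
Proof. pose proof II_a_pos. unfold x. field. nra. Qed.
Lemma II_den : 0 < 1 + r ^ 3 * x.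
Proof. pose proof r3_pos. pose proof II_x. assert (0 <= r ^ 3 * x) by (apply Rmult_le_pos; lra). lra. Qed.

Lemma II_hi : 0 <= Sform rho g b psi (y * B0) hi.
Proof.
pose proof II_den. unfold y.
destruct Hw as [[W1 W2]|[W1 W2]].
- pose proof (T_II_A_plus r a x o cube_r Ha II_x Ho) as T.
  conclude T ltac:(reflexivity) II_del (1 + r ^ 3 * x) 1.
- pose proof (T_II_B_plus r a x o cube_r Ha II_x Ho) as T.
  conclude T ltac:(reflexivity) II_del (1 + r ^ 3 * x) 1.
Qed.

Lemma II_lo_small : th <= K -> 0 <= Sform rho g b psi (y * B0) lo.
Proof.
intros hK. pose proof II_den. rewrite (lo_small hK). unfold y.
destruct Hw as [[W1 W2]|[W1 W2]].
- pose proof (T_II_A_minus r a x o cube_r Ha II_x Ho) as T.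
  conclude T ltac:(reflexivity) II_del (1 + r ^ 3 * x) 1.
- pose proof (T_II_B_minus r a x o cube_r Ha II_x Ho) as T.
  conclude T ltac:(reflexivity) II_del (1 + r ^ 3 * x) 1.
Qed.

Lemma II_lo_big : K < th -> 0 <= Sform rho g b psi (y * B0) lo.
Proof.
intros hK. destruct (big_d hK) as (d & Hd & Edel).
pose proof r3_pos; pose proof II_a_pos; pose proof s_pos.
assert (HR : 0 < 1 + r ^ 2) by nra.
assert (Ha0 : 0 < a).
{ destruct (Req_dec a 0) as [e|]; [rewrite e in *; lra|lra]. }
assert (Hda : d * r < (1 + r ^ 2) * a) by (apply Rmult_lt_reg_l with (1 := s_pos); unfold s in *; nra).
assert (HR1 : 0 < 1 + r ^ 2 - d * r) by nra.
assert (Hr4 : 0 <= r ^ 4 * d) by (apply Rmult_le_pos; [apply pow_le|]; lra).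
assert (HRa : 0 < (1 + r ^ 2) * a) by (apply Rmult_lt_0_compat; lra).
set (x' := ((1 + r ^ 2) * a - d * r) / (1 + r ^ 2 - d * r)).
assert (Hx : 0 <= x' <= 1).
{ unfold x'; split; [apply Rle_mult_inv_pos; lra|].
  apply Rmult_le_reg_r with (1 := HR1). unfold Rdiv; rewrite Rmult_assoc, Rinv_l by lra. nra. }
assert (EaR : d * r + x' * (1 + r ^ 2 - d * r) = (1 + r ^ 2) * a) by (unfold x'; field; lra).
assert (Ed2 : s ^ 2 * d = s * del / r) by (rewrite <- Edel; field; lra).
assert (Ey : y = r * d * (1 + r ^ 3) / ((1 + r ^ 2) * a + r ^ 4 * d)).
{ unfold y, x. rewrite <- Edel. field. repeat split; nra. }
rewrite Ey.
destruct Hw as [[W1 W2]|[W1 W2]].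
- pose proof (T_II_A_low r x' d o cube_r Hx Hd Ho) as T. rewrite EaR in T.
  unfold Tform_scaled in T; cbv zeta in T; change (1 - r) with s in T; rewrite Ed2 in T.
  conclude T ltac:(rewrite (lo_big hK); reflexivity) Edel ((1 + r ^ 2) * a + r ^ 4 * d) (1 + r ^ 2).
- pose proof (T_II_B_low r x' d o cube_r Hx Hd Ho) as T. rewrite EaR in T.
  unfold Tform_scaled in T; cbv zeta in T; change (1 - r) with s in T; rewrite Ed2 in T.
  conclude T ltac:(rewrite (lo_big hK); reflexivity) Edel ((1 + r ^ 2) * a + r ^ 4 * d) (1 + r ^ 2).
Qed.
End II.

Section I.
Hypothesis h : s * (1 + r ^ 2) * a <= del.
Variables o B0 : R.
Hypothesis Ho : 0 <= o <= 1.
Hypothesis Hw : w_case o B0.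
Let m := 1 + r + r ^ 2 + r ^ 4 - (1 + r ^ 2) * a.
Let x := (del / s - (1 + r ^ 2) * a) / m.

Lemma I_m : 0 < m.
Proof. unfold m; assert (0 < r ^ 4) by (apply pow_lt; lra); nra. Qed.
Lemma I_x : 0 <= x <= 1.
Proof.
pose proof I_m; pose proof s_pos as Hs. unfold x; split.
- apply Rle_mult_inv_pos; [|lra].
  apply Rmult_le_reg_l with (1 := Hs).
  replace (s * (del / s - (1 + r ^ 2) * a)) with (del - s * (1 + r ^ 2) * a) by (field; lra). lra.
- apply Rmult_le_reg_r with m; [lra|].
  unfold Rdiv at 1; rewrite Rmult_assoc, Rinv_l by lra.
  apply Rmult_le_reg_l with (1 := Hs).
  replace (s * ((del / s - (1 + r ^ 2) * a) * 1)) with (del - s * (1 + r ^ 2) * a) by (field; lra).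
  replace (s * (1 * m)) with (1 - K * r ^ 3 - s * (1 + r ^ 2) * a) by (unfold m, s, K; ring).
  unfold del; lra.
Qed.
Lemma I_del : s * ((1 + r ^ 2) * a + x * m) = del.
Proof. pose proof I_m; pose proof s_pos. unfold x. field. lra. Qed.

Lemma I_hi : 0 <= Sform rho g b psi B0 hi.
Proof.
pose proof I_del as E. unfold m in E.
destruct Hw as [[W1 W2]|[W1 W2]].
- pose proof (T_I_A_plus r a x o cube_r Ha I_x Ho) as T. conclude T ltac:(reflexivity) E 1 1.
- pose proof (T_I_B_plus r a x o cube_r Ha I_x Ho) as T. conclude T ltac:(reflexivity) E 1 1.
Qed.

Lemma I_lo_small : th <= K -> 0 <= Sform rho g b psi B0 lo.
Proof.
intros hK. rewrite (lo_small hK). pose proof I_del as E. unfold m in E.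
destruct Hw as [[W1 W2]|[W1 W2]].
- pose proof (T_I_A_minus r a x o cube_r Ha I_x Ho) as T. conclude T ltac:(reflexivity) E 1 1.
- pose proof (T_I_B_minus r a x o cube_r Ha I_x Ho) as T. conclude T ltac:(reflexivity) E 1 1.
Qed.

Lemma I_lo_big : K < th -> 0 <= Sform rho g b psi B0 lo.
Proof.
intros hK. destruct (big_d hK) as (d & Hd & Edel).
pose proof s_pos. pose proof del_pos.
assert (HR : 0 < 1 + r ^ 2) by nra.
assert (Hd0 : 0 < d).
{ destruct (Req_dec d 0) as [e|]; [rewrite e in *; lra|lra]. }
assert (Hdr : 0 < d * r) by (apply Rmult_lt_0_compat; lra).
assert (Hda : (1 + r ^ 2) * a <= d * r) by (apply Rmult_le_reg_l with (1 := s_pos); unfold s in *; nra).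
set (x' := (1 + r ^ 2) * a / (d * r)).
assert (Hx : 0 <= x' <= 1).
{ unfold x'; split; [apply Rle_mult_inv_pos; [apply Rmult_le_pos|]; lra|].
  apply Rmult_le_reg_r with (1 := Hdr). unfold Rdiv; rewrite Rmult_assoc, Rinv_l by lra. lra. }
assert (Ed2 : s ^ 2 * d = s * del / r) by (rewrite <- Edel; field; lra).
assert (EaR : x' * d * r = (1 + r ^ 2) * a) by (unfold x'; field; lra).
destruct Hw as [[W1 W2]|[W1 W2]].
- pose proof (T_I_A_low r x' d o cube_r Hx Hd Ho) as T. rewrite EaR in T.
  unfold Tform_scaled in T; cbv zeta in T; change (1 - r) with s in T; rewrite Ed2 in T.
  conclude T ltac:(rewrite (lo_big hK); reflexivity) Edel 1 (1 + r ^ 2).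
- pose proof (T_I_B_low r x' d o cube_r Hx Hd Ho) as T. rewrite EaR in T.
  unfold Tform_scaled in T; cbv zeta in T; change (1 - r) with s in T; rewrite Ed2 in T.
  conclude T ltac:(rewrite (lo_big hK); reflexivity) Edel 1 (1 + r ^ 2).
Qed.
End I.

Lemma exists_w_case : exists o B0, 0 <= o <= 1 /\ w_case o B0 /\
  (B0 = 13/10 * (1 - psi) \/ B0 = 11/20 * s).
Proof.
destruct (Rle_dec (26 * (1 - psi)) (11 * s)) as [h|h].
- exists (26 * (1 - psi) / (11 * s)), (13/10 * (1 - psi)).
  assert (Hs : 0 < 11 * s) by (unfold s; lra).
  repeat split; try lra.
  + apply Rle_mult_inv_pos; lra.
  + apply Rmult_le_reg_r with (11 * s); [lra|]. field_simplify; [lra|unfold s; lra].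
  + left. split; field; unfold s; lra.
- exists ((26 * (1 - psi) - 11 * s) / (s * (26 * (1 + r) - 11))), (11/20 * s).
  assert (Hs : 0 < s * (26 * (1 + r) - 11)) by (apply Rmult_lt_0_compat; unfold s; lra).
  repeat split; try lra.
  + apply Rle_mult_inv_pos; lra.
  + apply Rmult_le_reg_r with (s * (26 * (1 + r) - 11)); [lra|].
    replace ((26 * (1 - psi) - 11 * s) / (s * (26 * (1 + r) - 11)) * (s * (26 * (1 + r) - 11)))
     with (26 * (1 - psi) - 11 * s) by (field; unfold s; lra).
    unfold s. nra.
  + right. split; [|lra]. field; unfold s; lra.
Qed.

(** [Sform] is decreasing in [l], since [W ^ 2 - psi ^ 2 * b ^ 2 > 0], and concave
    in [W]; so it is enough to know that it is nonnegative at the supremum of the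
    admissible values of [l] and at both ends of the interval of [W], where the
    polynomial inequalities apply. *)
Theorem Sform_pos l W :
  0 <= l -> l < 13/10 * (1 - psi) -> l < 11/20 * s ->
  l * (s * (1 + r ^ 2) * a + r ^ 3 * del) < del * (1 + r ^ 3) * (13/10 * (1 - psi)) ->
  l * (s * (1 + r ^ 2) * a + r ^ 3 * del) < del * (1 + r ^ 3) * (11/20 * s) ->
  lo <= W <= hi ->
  0 < Sform rho g b psi l W.
Proof.
intros Hl Hl1 Hl2 Hl3 Hl4 HW.
destruct exists_w_case as (o & B0 & Ho & Hw & HB0).
assert (HlB : l * (s * (1 + r ^ 2) * a + r ^ 3 * del) < del * (1 + r ^ 3) * B0)
  by (destruct HB0 as [-> | ->]; assumption).
assert (HlB' : l < B0) by (destruct HB0 as [-> | ->]; assumption).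
assert (Hrho : 0 < rho).
{ unfold rho. pose proof s_pos. assert (th * s < 1 * s) by (apply Rmult_lt_compat_r; lra).
  unfold s in *. lra. }
(* [l0] plays the supremum of the admissible [l]. *)
assert (J : forall l0, l < l0 -> 0 <= Sform rho g b psi l0 lo -> 0 <= Sform rho g b psi l0 hi ->
   0 < Sform rho g b psi l W).
{ intros l0 H0 H1 H2.
  assert (H3 := Sform_concave rho g b psi l0 lo hi W ltac:(lra) ltac:(lra) HW H1 H2).
  assert (HXY := lo_XY W ltac:(lra)).
  replace (Sform rho g b psi l W) with (Sform rho g b psi l0 W
    + rho * (l0 - l) * (W ^ 2 - psi ^ 2 * b ^ 2)) by (unfold Sform; ring).
  assert (0 < rho * (l0 - l) * (W ^ 2 - psi ^ 2 * b ^ 2)) by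
   (repeat apply Rmult_lt_0_compat; lra).
  lra. }
destruct (Rlt_dec del (s * (1 + r ^ 2) * a)) as [h|h].
- set (x := del / (s * (1 + r ^ 2) * a)).
  apply (J (x * (1 + r ^ 3) / (1 + r ^ 3 * x) * B0)).
  + pose proof (II_den h). pose proof (II_a_pos h) as Hsa. pose proof (II_del h) as Edel. fold x in H, Edel.
    apply Rmult_lt_reg_r with (1 := H).
    replace (x * (1 + r ^ 3) / (1 + r ^ 3 * x) * B0 * (1 + r ^ 3 * x)) with (x * (1 + r ^ 3) * B0)
      by (field; lra).
    apply Rmult_lt_reg_l with (1 := Hsa).
    replace (s * (1 + r ^ 2) * a * (l * (1 + r ^ 3 * x))) with
      (l * (s * (1 + r ^ 2) * a + r ^ 3 * (s * (1 + r ^ 2) * a * x))) by ring.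
    replace (s * (1 + r ^ 2) * a * (x * (1 + r ^ 3) * B0)) with
      (s * (1 + r ^ 2) * a * x * (1 + r ^ 3) * B0) by ring.
    rewrite Edel. exact HlB.
  + destruct (Rle_dec th K); [apply (II_lo_small h o)|apply (II_lo_big h o)]; auto; lra.
  + apply (II_hi h o); auto.
- apply (J B0 HlB').
  + destruct (Rle_dec th K); [apply (I_lo_small ltac:(lra) o)|apply (I_lo_big ltac:(lra) o)]; auto; lra.
  + apply (I_hi ltac:(lra) o); auto.
Qed.
End Sform_bound.

Section Quadratic_form.
Variables r th psi a l W Tc : R.
Let s := 1 - r.
Let K := 1 - r + r ^ 2.
Let del := 1 - th.
Let rho := 1 - th * s.
Let g := del + th * r * a.
Let b := r * (a - del).
Hypothesis Hr : 0 < r < 1.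
Hypothesis Hth : K * r ^ 3 <= th < 1.
Hypothesis Hpsi : r ^ 2 <= psi < 1.
Hypothesis Ha : 0 <= a <= 1.
Hypothesis HTc : 0 <= Tc.
Hypothesis Hl : 0 <= l.
Hypothesis Hl1 : l < 13/10 * (1 - psi).
Hypothesis Hl2 : l < 11/20 * s.
Hypothesis Hl3 : l * (s * (1 + r ^ 2) * a + r ^ 3 * del) < del * (1 + r ^ 3) * (13/10 * (1 - psi)).
Hypothesis Hl4 : l * (s * (1 + r ^ 2) * a + r ^ 3 * del) < del * (1 + r ^ 3) * (11/20 * s).
Hypothesis HW : psi * del + low_slope r th * a <= W <= (1 + (1 - psi) * r) * del + th / K * a.

Let N := 1 - rho * psi ^ 2 * (1 + l).
Let U := W + Tc - psi ^ 2 * (g + rho * Tc).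
Let XY := (W + Tc) ^ 2 - psi ^ 2 * b ^ 2.

(** For [Tc = 0] this is [Sform_pos].  With [n = 1 - rho * psi ^ 2], adding [Tc]
    turns [U] into [U + n * Tc] and [W] into [W + Tc]; the discriminant keeps its
    sign because [n ^ 2 <= N] and, as [U ^ 2 < N * W ^ 2], also [n * U <= N * W].
    The inequality [n ^ 2 <= N] amounts to [l <= n], which follows from the two
    bounds on [l], one serving small [psi] and the other large [psi]. *)
Theorem quad_disc : 0 < N /\ U ^ 2 < N * XY.
Proof.
assert (HS := Sform_pos r th psi a Hr Hth Hpsi Ha l W Hl Hl1 Hl2 Hl3 Hl4 HW).
assert (HXY := lo_XY r th psi a Hr Hth Hpsi Ha W (proj1 HW)).
fold s K del rho g b in HS, HXY.
set (n := 1 - rho * psi ^ 2).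
assert (Hth0 : 0 < th).
{ assert (0 < K * r ^ 3) by (apply Rmult_lt_0_compat; [unfold K; nra|apply pow_lt; lra]). lra. }
assert (Hrho : 0 < rho <= 1) by (unfold rho, s; nra).
assert (Hps : 0 < psi) by nra.
assert (Hln : l <= n).
{ unfold n. assert (rho * psi ^ 2 <= psi ^ 2) by nra.
  destruct (Rle_dec psi (3/10)).
  - assert (psi ^ 2 <= 9/100) by nra. unfold s in *; lra.
  - nra. }
assert (HN : n ^ 2 <= N).
{ assert (0 <= rho * psi ^ 2 * (n - l)) by (repeat apply Rmult_le_pos; nra).
  replace N with (n - rho * psi ^ 2 * l) by (unfold N, n; ring).
  assert (n = n ^ 2 + rho * psi ^ 2 * n) by (unfold n; ring). nra. }
assert (Hn0 : 0 < n). { unfold n. assert (psi ^ 2 < 1) by nra. nra. }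
assert (HNp : 0 < N) by nra.
split; [exact HNp|].
set (U0 := W - psi ^ 2 * g).
assert (H0 : U0 ^ 2 < N * (W ^ 2 - psi ^ 2 * b ^ 2)).
{ assert (0 < psi ^ 2 * Sform rho g b psi l W) by (apply Rmult_lt_0_compat; [apply pow_lt|]; lra).
  assert (psi ^ 2 * Sform rho g b psi l W = N * (W ^ 2 - psi ^ 2 * b ^ 2) - U0 ^ 2)
   by (unfold Sform, N, U0; ring). lra. }
assert (HWp : 0 < W).
{ assert (0 < psi * del) by (apply Rmult_lt_0_compat; unfold del; lra).
  assert (0 <= low_slope r th * a).
  { apply Rmult_le_pos; [|lra]. unfold low_slope. fold K.
    assert (0 < K) by (unfold K; nra).
    destruct (Rle_dec th K); apply Rle_mult_inv_pos; try lra.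
    apply Rplus_le_le_0_compat; [lra|]. apply Rle_mult_inv_pos; [apply Rmult_le_pos|]; lra. }
  lra. }
assert (Hcross : n * U0 <= N * W).
{ apply Rle_trans with (1 := Rle_abs _). rewrite <- (Rabs_pos_eq (N * W)) by nra.
  apply Rsqr_le_abs_0. unfold Rsqr.
  assert (0 <= psi ^ 2 * b ^ 2) by (apply Rmult_le_pos; apply pow2_ge_0).
  assert (U0 ^ 2 <= N * W ^ 2) by nra.
  assert (n ^ 2 * U0 ^ 2 <= N * (N * W ^ 2)).
  { apply Rmult_le_compat; try apply pow2_ge_0; assumption. }
  lra. }
replace U with (U0 + n * Tc) by (unfold U, U0, n; ring).
assert (2 * Tc * (n * U0) <= 2 * Tc * (N * W)) by (apply Rmult_le_compat_l; lra).
assert (n ^ 2 * Tc ^ 2 <= N * Tc ^ 2) by (apply Rmult_le_compat_r; [apply pow2_ge_0|lra]).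
unfold XY. nra.
Qed.

Theorem quad_pos vt z : vt <> 0 -> 0 < N * z ^ 2 + 2 * U * vt * z + XY * vt ^ 2.
Proof.
intros Hv. destruct quad_disc as [HN HU].
apply Rmult_lt_reg_l with N; [exact HN|]. rewrite Rmult_0_r.
replace (N * (N * z ^ 2 + 2 * U * vt * z + XY * vt ^ 2)) with
 ((N * z + U * vt) ^ 2 + (N * XY - U ^ 2) * vt ^ 2) by ring.
assert (0 < (N * XY - U ^ 2) * vt ^ 2) by (apply Rmult_lt_0_compat; [lra|nra]).
pose proof (pow2_ge_0 (N * z + U * vt)). lra.
Qed.
End Quadratic_form.

(** * Calculus *)

Lemma mvt (f f' : R -> R) (a b : R) : a < b ->
  (forall x, a <= x <= b -> is_derive f x (f' x)) ->
  exists c, a < c < b /\ f b - f a = f' c * (b - a).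
Proof.
intros Hab Hd. destruct (MVT_cor2 f f' a b Hab) as (c & E & Hc).
- intros c Hc. apply is_derive_Reals, Hd, Hc.
- exists c. split; assumption.
Qed.

Lemma increasing_between (f f' : R -> R) (a b : R) : a <= b ->
  (forall x, a <= x <= b -> is_derive f x (f' x)) ->
  (forall x, a < x < b -> 0 <= f' x) -> f a <= f b.
Proof.
intros Hab Hd Hs. destruct (Req_dec a b) as [->|]; [lra|].
destruct (mvt f f' a b ltac:(lra) Hd) as (c & Hc & E). specialize (Hs c Hc). nra.
Qed.

Lemma decreasing_between (f f' : R -> R) (a b : R) : a <= b ->
  (forall x, a <= x <= b -> is_derive f x (f' x)) ->
  (forall x, a < x < b -> f' x <= 0) -> f b <= f a.
Proof.
intros Hab Hd Hs. destruct (Req_dec a b) as [->|]; [lra|].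
destruct (mvt f f' a b ltac:(lra) Hd) as (c & Hc & E). specialize (Hs c Hc). nra.
Qed.

Lemma strictly_decreasing_between (f f' : R -> R) (a b : R) : a < b ->
  (forall x, a <= x <= b -> is_derive f x (f' x)) ->
  (forall x, a < x < b -> f' x < 0) -> f b < f a.
Proof.
intros Hab Hd Hs.
destruct (mvt f f' a b Hab Hd) as (c & Hc & E). specialize (Hs c Hc). nra.
Qed.

Lemma exp_taylor_le (n : nat) (x : R) : 0 <= x -> sum_f_R0 (fun k => / INR (fact k) * x ^ k) n <= exp x.
Proof.
intros Hx. apply sum_incr.
- unfold exp. destruct (exist_exp x) as [l Hl]. exact Hl.
- intros k. apply Rmult_le_pos; [|apply pow_le; exact Hx].
  left. apply Rinv_0_lt_compat, INR_fact_lt_0.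
Qed.

Lemma exp_mono (x y : R) : x <= y -> exp x <= exp y.
Proof. intros [H| ->]; [left; apply exp_increasing; exact H|right; reflexivity]. Qed.

Lemma exp_le_inv (x p : R) : 0 < p -> p <= exp x -> exp (- x) <= / p.
Proof. intros Hp H. rewrite exp_Ropp. apply Rinv_le_contravar; assumption. Qed.

Lemma exp_neg_bounds (x : R) : 0 <= x ->
  1 - x <= exp (- x) /\ exp (- x) <= 1 - x + x ^ 2 / 2 /\ 1 - x + x ^ 2 / 2 - x ^ 3 / 6 <= exp (- x).
Proof.
intros Hx.
assert (A : forall x, 0 <= x -> 1 - x <= exp (- x)).
{ intros y Hy. pose proof (exp_ineq1_le (- y)). lra. }
assert (B : forall x, 0 <= x -> exp (- x) <= 1 - x + x ^ 2 / 2).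
{ intros y Hy.
  pose proof (increasing_between (fun x => 1 - x + x ^ 2 / 2 - exp (- x)) (fun x => - 1 + x + exp (- x)) 0 y Hy) as I.
  cbv beta in I. rewrite Ropp_0, exp_0 in I.
  assert (1 - 0 + 0 ^ 2 / 2 - 1 <= 1 - y + y ^ 2 / 2 - exp (- y)); [|lra].
  apply I.
  - intros z _. auto_derive; [exact Logic.I|]. field.
  - intros z Hz. specialize (A z ltac:(lra)). lra. }
split; [auto|split; [auto|]].
pose proof (increasing_between (fun x => exp (- x) - (1 - x + x ^ 2 / 2 - x ^ 3 / 6)) (fun x => - exp (- x) + 1 - x + x ^ 2 / 2) 0 x Hx) as I.
cbv beta in I. rewrite Ropp_0, exp_0 in I.
assert (1 - (1 - 0 + 0 ^ 2 / 2 - 0 ^ 3 / 6) <= exp (- x) - (1 - x + x ^ 2 / 2 - x ^ 3 / 6)); [|lra].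
apply I.
- intros z _. auto_derive; [exact Logic.I|]. field.
- intros z Hz. specialize (B z ltac:(lra)). lra.
Qed.

Lemma sin_le (x : R) : 0 <= x -> sin x <= x.
Proof. intros Hx. destruct (Req_dec x 0) as [->|]; [rewrite sin_0; lra|]. left. apply sin_lt_x. lra. Qed.

Lemma cos_le_quartic (u : R) : - PI / 2 <= u <= PI / 2 -> cos u <= 1 - u ^ 2 / 2 + u ^ 4 / 24.
Proof.
intros Hu. destruct (cos_bound u 0) as [_ H]; try lra.
eapply Rle_trans; [exact H|]. unfold cos_approx, cos_term. simpl. lra.
Qed.

(** The value [sin (PI / 6) = 1 / 2] is compared with the Taylor bounds of the sine
    at the two candidates. *)
Lemma PI_bounds : 314 / 100 < PI < 315 / 100.
Proof.
assert (H6 : sin (PI / 6) = 1 / 2) by apply sin_PI6.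
pose proof PI_RGT_0. pose proof PI_4 as P4. pose proof PI2_3_2.
split.
- apply Rnot_le_lt. intros h.
  assert (sin (314/600) <= 4999/10000).
  { destruct (sin_bound (314/600) 0) as [_ C]; [lra|lra|].
    eapply Rle_trans; [exact C|]. unfold sin_approx, sin_term. simpl. lra. }
  assert (sin (PI / 6) <= sin (314 / 600)).
  { destruct (Req_dec PI (314/100)) as [->|]; [right; f_equal; lra|]. left. apply sin_increasing_1; lra. }
  lra.
- apply Rnot_le_lt. intros h.
  assert (5001/10000 <= sin (315/600)).
  { destruct (sin_bound (315/600) 0) as [C _]; [lra|lra|].
    eapply Rle_trans; [|exact C]. unfold sin_approx, sin_term. simpl. lra. }
  assert (sin (315 / 600) <= sin (PI / 6)).
  { destruct (Req_dec PI (315/100)) as [->|]; [right; f_equal; lra|]. left. apply sin_increasing_1; lra. }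
  lra.
Qed.

Lemma is_derive_cst (a x : R) : is_derive (fun _ : R => a) x 0.
Proof. auto_derive; [exact I|reflexivity]. Qed.

(** * Convergence of the recursion by a Lyapunov function *)

Lemma lipschitz_antiderivative (f : R -> R) (k a : R) : 0 <= k ->
  (forall x y, Rabs (f x - f y) <= k * Rabs (x - y)) ->
  exists G : R -> R, G a = 0 /\ forall x, is_derive G x (f x).
Proof.
intros Hk Hf.
assert (Hc : forall x, continuous f x).
{ intros x. apply continuity_pt_filterlim. intros eps Heps.
  exists (eps / (k + 1)). split; [apply Rlt_gt, Rdiv_lt_0_compat; lra|].
  intros y [_ Hy]. unfold dist in *; simpl in *; unfold R_dist in *.
  apply Rle_lt_trans with (1 := Hf y x).
  apply Rle_lt_trans with ((k + 1) * Rabs (y - x)).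
  - apply Rmult_le_compat_r; [apply Rabs_pos|lra].
  - apply Rmult_lt_reg_r with (/ (k + 1)); [apply Rinv_0_lt_compat; lra|].
    replace ((k + 1) * Rabs (y - x) * / (k + 1)) with (Rabs (y - x)) by (field; lra). exact Hy. }
exists (fun x => RInt f a x). split.
- rewrite RInt_point. reflexivity.
- intros x. apply (is_derive_RInt f _ a x); [|apply Hc].
  apply filter_forall. intros y. apply (@RInt_correct R_CompleteNormedModule).
  apply ex_RInt_continuous. intros; apply Hc.
Qed.

Lemma is_lim_seq_subseq' (u : nat -> R) (phi : nat -> nat) (l : R) :
  (forall n, (n <= phi n)%nat) -> is_lim_seq u l -> is_lim_seq (fun n => u (phi n)) l.
Proof.
intros Hphi Hu. apply (is_lim_seq_subseq u l phi); [|exact Hu].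
intros P [N HN]. exists N. intros n Hn. apply HN. specialize (Hphi n). lia.
Qed.

Lemma bounded_subsequence (u : nat -> R) (A : R) : (forall n, Rabs (u n) <= A) ->
  exists (phi : nat -> nat) (l : R), (forall n, (n <= phi n)%nat) /\ is_lim_seq (fun n => u (phi n)) l.
Proof.
intros HA.
destruct (Bolzano_Weierstrass u (fun x => - A <= x <= A) (compact_P3 (- A) A)) as [l Hl].
{ intros n. specialize (HA n). pose proof (Rle_abs (u n)). pose proof (Rle_abs (- u n)) as B.
  rewrite Rabs_Ropp in B. lra. }
assert (C : forall n, exists p, (n <= p)%nat /\ Rabs (u p - l) < / (INR n + 1)).
{ intros n. pose proof (pos_INR n) as Hn.
  assert (He : 0 < / (INR n + 1)) by (apply Rinv_0_lt_compat; lra).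
  destruct (Hl (disc l (mkposreal _ He)) n) as (p & Hp & Hd).
  - exists (mkposreal _ He). intros x Hx; exact Hx.
  - exists p. split; [exact Hp|exact Hd]. }
exists (fun n => proj1_sig (constructive_indefinite_description _ (C n))), l. split.
- intros n. apply (proj2_sig (constructive_indefinite_description _ (C n))).
- apply is_lim_seq_spec. intros eps.
  destruct (archimed_cor1 eps (cond_pos eps)) as (N & HN & HN0).
  exists N. intros n Hn.
  destruct (proj2_sig (constructive_indefinite_description _ (C n))) as [_ Hp].
  apply Rlt_trans with (1 := Hp). apply Rle_lt_trans with (2 := HN).
  apply Rinv_le_contravar; [apply lt_0_INR; exact HN0|]. apply le_INR in Hn. lra.
Qed.

Lemma min_by_sign (G g : R -> R) (a x : R) :
  (forall y, is_derive G y (g y)) ->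
  (forall y, Rmin a x <= y <= Rmax a x -> 0 <= g y * (y - a)) ->
  G a <= G x.
Proof.
intros HG Hg.
destruct (Rtotal_order a x) as [h|[->|h]]; [|lra|].
- rewrite Rmin_left, Rmax_right in Hg by lra.
  destruct (mvt G g a x h) as (c & Hc & E); [intros; apply HG|].
  specialize (Hg c ltac:(lra)).
  assert (0 <= g c) by (apply Rmult_le_reg_r with (c - a); lra). nra.
- rewrite Rmin_right, Rmax_left in Hg by lra.
  destruct (mvt G g x a h) as (c & Hc & E); [intros; apply HG|].
  specialize (Hg c ltac:(lra)).
  assert (g c <= 0) by nra. nra.
Qed.

(** The recursion is
    [x' = uf v], [v' + r ^ 2 * ps v * x = H * (uf v + r ^ 2 * ps v * v)],
    where [uf v = Df v + v / r].  The hypotheses collect what is needed of the two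
    functions: [Df] is decreasing and convex with slope at least [- q]; [om] and
    [om / ps] are increasing, the latter more slowly than [Df] decreases; the
    chords of [ps] have slopes bounded by a constant [K0] and, relatively to
    [1 - ps], by a constant [kap]; the two numerical conditions bound these
    constants.  The bound [th < 1] on the parameter means [H < H_crit mu] when
    [r = exp (- mu * PI)]. *)
Section Lyapunov.
Variables (r H : R) (Df ps : R -> R) (kap K0 vs : R).
Let s := 1 - r.
Let K := 1 - r + r ^ 2.
Let q := / r.
Let th := H * (K / r).
Let del := 1 - th.
Let rho := 1 - th * s.
Let uf v := Df v + q * v.
Let om v := v * (1 - ps v).
Let us := uf vs.
Let Ds := Df vs.
Let pss := ps vs.

Hypothesis Hr : 0 < r < 1.
Hypothesis Hth : th < 1.
Hypothesis Hvs : 0 <= vs.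
Hypothesis Hps : forall v, 0 <= v -> r ^ 2 <= ps v < 1.
Hypothesis HDpos : forall v, 0 <= v -> 0 < Df v.
Hypothesis HD : forall v1 v2, 0 <= v1 <= v2 -> 0 <= Df v1 - Df v2 <= q * (v2 - v1).
Hypothesis HDconv : forall v1 v2 v3, 0 <= v1 <= v2 -> v2 <= v3 ->
  (Df v2 - Df v3) * (v2 - v1) <= (Df v1 - Df v2) * (v3 - v2).
Hypothesis Hom : forall v1 v2, 0 <= v1 <= v2 -> om v1 <= om v2.
Hypothesis Hp : forall v1 v2, 0 <= v1 <= v2 ->
  0 <= om v2 / ps v2 - om v1 / ps v1 <= Df v1 - Df v2.
Hypothesis Hkap : forall v1 v2, 0 <= v1 -> 0 <= v2 ->
  Rabs (ps v2 - ps v1) <= kap * (1 - ps v1) * Rabs (v2 - v1).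
Hypothesis HK0 : forall v1 v2, 0 <= v1 -> 0 <= v2 ->
  Rabs (ps v2 - ps v1) <= K0 * Rabs (v2 - v1).
Hypothesis Hpsmon : forall v1 v2, 0 <= v1 <= v2 -> ps v1 <= ps v2.
Hypothesis Hkap1 : 0 <= kap /\ r ^ 2 * Df 0 * kap < 13/10.
Hypothesis HK01 : 0 <= K0 /\ r ^ 2 * Df 0 * K0 < 11/20 * s.
Hypothesis Hfix : H * (us + r ^ 2 * pss * vs) = vs + r ^ 2 * pss * us.

Let h := th / K.

Lemma qr : q * r = 1. Proof. unfold q. field. lra. Qed.
Lemma q_gt1 : 1 < q. Proof. pose proof qr. assert (0 < q) by (unfold q; apply Rinv_0_lt_compat; lra). nra. Qed.
Lemma K_pos' : 0 < K. Proof. unfold K; nra. Qed.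
Lemma Hrh : H = r * h. Proof. unfold h, th. field. pose proof K_pos'. lra. Qed.
Lemma us_pos : 0 < us.
Proof. unfold us, uf. pose proof (HDpos vs Hvs). pose proof q_gt1. nra. Qed.
(** By the fixed point equation [H] is the weighted value
    [(vs + e * us) / (us + e * vs)] with [e = r ^ 2 * pss < 1],
    and [vs + e * us >= e * (us + e * vs)]. *)
Lemma H_ge_Es : r ^ 2 * pss <= H.
Proof.
pose proof us_pos as Hu. pose proof (Hps vs Hvs) as P. fold pss in P.
set (E := r ^ 2 * pss) in *.
assert (Hr2 : 0 < r ^ 2 < 1) by nra.
assert (HE : 0 < E < 1) by (unfold E; nra).
assert (0 <= E * vs) by (apply Rmult_le_pos; lra).
apply Rmult_le_reg_r with (us + E * vs); [lra|]. rewrite Hfix.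
assert (0 <= vs * (1 - E ^ 2)) by (apply Rmult_le_pos; nra). nra.
Qed.
Lemma th_range : K * r ^ 3 <= th < 1.
Proof.
split; [|exact Hth]. pose proof H_ge_Es. pose proof (Hps vs Hvs) as P. fold pss in P.
unfold th. replace (K * r ^ 3) with (r ^ 4 * (K / r)) by (field; lra).
apply Rmult_le_compat_r.
- apply Rle_mult_inv_pos; [pose proof K_pos'|]; lra.
- assert (0 < r ^ 2) by nra. nra.
Qed.

(** The defect of the fixed point equation at [v]; the recursion moves [v] by an
    amount governed by [M v]. *)
Let M v := v - H * uf v + r ^ 2 * ps v * (uf v - H * v).
Lemma M_formula v :
  M v = (1 + r) * del * v - r ^ 2 * (q - H) * om v + Df v * (ps v * r ^ 2 - H).
Proof. unfold M, uf, del, th, om, K, q. field. lra. Qed.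
Lemma M_vs : M vs = 0.
Proof. unfold M. fold us pss. lra. Qed.
Lemma fix_M : (1 + r) * del * vs = r ^ 2 * (q - H) * om vs + Ds * (H - r ^ 2 * pss).
Proof. pose proof M_vs as E. rewrite M_formula in E. fold Ds pss in E. lra. Qed.

Lemma del_pos' : 0 < del. Proof. unfold del; lra. Qed.

(** When the slope [q * a] of a chord of [Df] at [vs] is large, convexity forces
    [Ds] to be small compared with [Df 0]; this is what allows the factor
    [del * (1 + r ^ 3) / (s * (1 + r ^ 2) * a + r ^ 3 * del)] in the bounds for
    the slack [l].  The fixed point equation gives [Ds * s * (1 + r ^ 2) <= del *
    (Ds + (q + r ^ 2) * vs)], and [vs] is bounded in terms of [Df 0 - Ds]. *)
Lemma y_bound a : 0 <= a <= 1 -> q * a * vs <= Df 0 - Ds ->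
  Ds * (s * (1 + r ^ 2) * a + r ^ 3 * del) <= del * (1 + r ^ 3) * Df 0.
Proof.
intros Ha Hav. pose proof qr. pose proof q_gt1. pose proof del_pos'.
pose proof (Hps vs Hvs) as P. fold pss in P.
pose proof (HDpos vs Hvs) as HDs. fold Ds in HDs.
assert (E : del * (us + r ^ 2 * pss * vs) = Ds * (1 - K * r * pss) + (1 - pss) * vs * s).
{ transitivity ((us + r ^ 2 * pss * vs) - K / r * (H * (us + r ^ 2 * pss * vs))).
  - unfold del, th; ring.
  - rewrite Hfix. unfold us, uf. fold Ds. unfold K, q, s. field. lra. }
assert (A1 : Ds * (s * (1 + r ^ 2)) <= Ds * (1 - K * r * pss)).
{ apply Rmult_le_compat_l; [lra|]. replace (s * (1 + r ^ 2)) with (1 - K * r * 1) by (unfold s, K; ring).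
  pose proof K_pos'. assert (0 < K * r) by (apply Rmult_lt_0_compat; lra). nra. }
assert (A2 : 0 <= (1 - pss) * vs * s) by (repeat apply Rmult_le_pos; unfold s; lra).
assert (A3 : us + r ^ 2 * pss * vs <= Ds + (q + r ^ 2) * vs).
{ unfold us, uf. fold Ds. assert (r ^ 2 * pss * vs <= r ^ 2 * 1 * vs).
  { apply Rmult_le_compat_r; [lra|]. apply Rmult_le_compat_l; [apply pow2_ge_0|lra]. } lra. }
assert (A4 : Ds * (s * (1 + r ^ 2)) <= del * (Ds + (q + r ^ 2) * vs)).
{ apply Rle_trans with (del * (us + r ^ 2 * pss * vs)); [lra|]. apply Rmult_le_compat_l; lra. }
assert (A5 : (q + r ^ 2) * vs * a <= (1 + r ^ 3) * (Df 0 - Ds)).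
{ replace ((q + r ^ 2) * vs * a) with ((1 + r ^ 3) * (q * a * vs)) by (unfold q; field; lra).
  apply Rmult_le_compat_l; [|exact Hav]. assert (0 < r ^ 3) by (apply pow_lt; lra). lra. }
assert (A6 : a * (Ds * (s * (1 + r ^ 2))) <= a * (del * (Ds + (q + r ^ 2) * vs))) by (apply Rmult_le_compat_l; lra).
assert (A7 : del * ((q + r ^ 2) * vs * a) <= del * ((1 + r ^ 3) * (Df 0 - Ds))) by (apply Rmult_le_compat_l; lra).
assert (A8 : a * (del * Ds) <= 1 * (del * Ds)) by (apply Rmult_le_compat_r; [apply Rmult_le_pos|]; lra).
lra.
Qed.

(** All increments from [vs] to [v] are written as chord slopes times [v - vs]. *)
Section Slopes.
Variable v : R.
Hypothesis Hv : 0 <= v.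
Hypothesis Hne : v <> vs.
Let vt := v - vs.
Let a := (Ds - Df v) / (q * vt).
Let chi := (ps v - pss) / vt.
Let Lam := (om v - om vs) / vt.
Let Pi := (om v / ps v - om vs / pss) / vt.
Let psi := ps v.

Lemma slope_range (f : R -> R) lo hi :
  (forall v1 v2, 0 <= v1 <= v2 -> lo * (v2 - v1) <= f v2 - f v1 <= hi * (v2 - v1)) ->
  lo <= (f v - f vs) / vt <= hi.
Proof.
intros Hf. destruct (Rtotal_order v vs) as [h1|[h1|h1]]; [| lra |].
- specialize (Hf v vs ltac:(lra)).
  replace ((f v - f vs) / vt) with ((f vs - f v) / (vs - v)) by (unfold vt; field; lra).
  split; apply Rmult_le_reg_r with (vs - v); try lra; unfold Rdiv; rewrite Rmult_assoc, Rinv_l; lra.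
- specialize (Hf vs v ltac:(lra)). unfold vt.
  split; apply Rmult_le_reg_r with (v - vs); try lra; unfold Rdiv; rewrite Rmult_assoc, Rinv_l; lra.
Qed.

Lemma vt_ne : vt <> 0. Proof. unfold vt; lra. Qed.

Lemma a_slope : a = r * - ((Df v - Df vs) / vt).
Proof. unfold a, Ds, q. field. split; [exact vt_ne|lra]. Qed.

Lemma a_range : 0 <= a <= 1.
Proof.
rewrite a_slope. pose proof qr.
destruct (slope_range Df (- q) 0) as [H1 H2].
{ intros v1 v2 H12. specialize (HD v1 v2 H12). lra. }
split; [apply Rmult_le_pos; lra|]. nra.
Qed.

(** By convexity the chord of [Df] from [0] to [vs] is at least as steep as the one
    between [vs] and [v]. *)
Lemma a_vs : q * a * vs <= Df 0 - Ds.
Proof.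
replace (q * a * vs) with (vs * - ((Df v - Df vs) / vt)) by (rewrite a_slope; unfold q; field; split; [exact vt_ne|lra]).
destruct (Rtotal_order v vs) as [h1|[h1|h1]]; [| lra |].
- pose proof (HDconv 0 v vs ltac:(lra) ltac:(lra)) as C. fold Ds in C |- *.
  assert (Hpp : 0 < vs - v) by lra.
  apply Rmult_le_reg_r with (1 := Hpp).
  replace (vs * - ((Df v - Ds) / vt) * (vs - v)) with (vs * (Df v - Ds)) by (unfold vt; field; lra).
  nra.
- pose proof (HDconv 0 vs v ltac:(lra) ltac:(lra)) as C. fold Ds in C |- *.
  assert (Hpp : 0 < v - vs) by lra.
  apply Rmult_le_reg_r with (1 := Hpp).
  replace (vs * - ((Df v - Ds) / vt) * (v - vs)) with (vs * (Ds - Df v)) by (unfold vt; field; lra).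
  nra.
Qed.

Lemma chi_pos : 0 <= chi.
Proof.
unfold chi, pss. destruct (Rtotal_order v vs) as [h1|[h1|h1]]; [| lra |].
- pose proof (Hpsmon v vs ltac:(lra)).
  replace ((ps v - ps vs) / vt) with ((ps vs - ps v) / (vs - v)) by (unfold vt; field; lra).
  apply Rle_mult_inv_pos; lra.
- pose proof (Hpsmon vs v ltac:(lra)). unfold vt. apply Rle_mult_inv_pos; lra.
Qed.

Lemma Lam_pos : 0 <= Lam.
Proof.
unfold Lam. destruct (Rtotal_order v vs) as [h1|[h1|h1]]; [| lra |].
- pose proof (Hom v vs ltac:(lra)).
  replace ((om v - om vs) / vt) with ((om vs - om v) / (vs - v)) by (unfold vt; field; lra).
  apply Rle_mult_inv_pos; lra.
- pose proof (Hom vs v ltac:(lra)). unfold vt. apply Rle_mult_inv_pos; lra.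
Qed.

Lemma Pi_range : 0 <= Pi <= q * a.
Proof.
destruct (slope_range (fun v => om v / ps v) 0 (q + q + 1) ) as [H1 _]; [|].
{ intros v1 v2 H12. specialize (Hp v1 v2 H12). specialize (HD v1 v2 H12). lra || nra. }
destruct (slope_range (fun v => om v / ps v + Df v) (- (q + 1)) 0 ) as [_ H2]; [|].
{ intros v1 v2 H12. specialize (Hp v1 v2 H12). specialize (HD v1 v2 H12). split; nra || lra. }
split; [exact H1|].
replace (q * a) with (- ((Df v - Df vs) / vt)) by (rewrite a_slope; unfold q; field; split; [exact vt_ne|lra]).
replace Pi with ((om v / ps v + Df v - (om vs / ps vs + Df vs)) / vt - (Df v - Df vs) / vt) by (unfold Pi, pss; field; repeat split; try exact vt_ne; pose proof (Hps v Hv); pose proof (Hps vs Hvs); nra).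
lra.
Qed.

Let Tc := chi * Ds * r ^ 2.
Let W := (1 + (1 - psi) * r) * del + th / K * a - r ^ 2 * (q - H) * Lam.
Let b := r * (a - del).

Lemma M_slope : M v = (W + Tc - psi * b) * vt.
Proof.
pose proof M_vs as E. rewrite M_formula in E. fold Ds pss in E.
replace (M v) with (M v - M vs) by (rewrite M_vs; ring).
rewrite !M_formula. unfold W, Tc, b, chi, Lam, a. fold Ds pss psi h.
replace h with (q * H) by (rewrite Hrh; unfold q; field; lra).
unfold q, vt. field. repeat split; lra.
Qed.

(** Subtracting a multiple of the fixed point equation from the definition of [W]
    makes it a sum of terms with known signs; this is the source of the lower
    bound for [W], whereas the definition gives the upper bound. *)
Lemma W_T1 : W = psi * del + h * a + (1 - h) * psi * Pi + (H / (r ^ 2 * pss) - 1) * Tc.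
Proof.
pose proof fix_M as E. pose proof (Hps vs Hvs) as P1; pose proof (Hps v Hv) as P2.
assert (E' : (1 + r) * del * vs - r ^ 2 * (q - H) * om vs = Ds * (H - r ^ 2 * pss)) by lra.
pose proof vt_ne.
assert (W - (psi * del + h * a + (1 - h) * psi * Pi + (H / (r ^ 2 * pss) - 1) * Tc) = 0); [|lra].
transitivity ((psi / pss * (1 - pss) - (1 - psi)) / vt * ((1 + r) * del * vs - r ^ 2 * (q - H) * om vs - Ds * (H - r ^ 2 * pss))).
- unfold W, Tc, Pi, chi, Lam. fold h.
  assert (Ed : del = 1 - K * h) by (unfold del, h; field; pose proof K_pos'; lra). rewrite Ed, Hrh.
  unfold om, K, q, vt. fold psi pss.
  field. unfold psi, pss. repeat split; nra.
- rewrite E'. ring.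
Qed.

Lemma q_gt_H : 0 < q - H.
Proof.
pose proof K_pos'. apply Rmult_lt_reg_r with (r * K); [apply Rmult_lt_0_compat; lra|].
rewrite Rmult_0_l, Hrh. unfold q, h.
replace ((/ r - r * (th / K)) * (r * K)) with (K - r ^ 2 * th) by (field; lra).
pose proof th_range as [T1 T2]. assert (0 < r ^ 2) by nra.
assert (r ^ 2 * th < r ^ 2 * 1) by (apply Rmult_lt_compat_l; lra). unfold K; lra.
Qed.
Lemma Tc_pos : 0 <= Tc.
Proof.
unfold Tc. pose proof chi_pos. pose proof (HDpos vs Hvs).
apply Rmult_le_pos; [apply Rmult_le_pos; [assumption|unfold Ds; lra]|apply pow2_ge_0].
Qed.

Lemma W_range : psi * del + low_slope r th * a <= W <= (1 + (1 - psi) * r) * del + th / K * a.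
Proof.
pose proof (Hps vs Hvs) as P1; pose proof (Hps v Hv) as P2. fold pss in P1; fold psi in P2.
pose proof Tc_pos as HT. pose proof a_range as Ha. pose proof Pi_range as HP. pose proof q_gt1.
split.
- rewrite W_T1.
  assert (A : 0 <= (H / (r ^ 2 * pss) - 1) * Tc).
  { apply Rmult_le_pos; [|exact HT]. pose proof H_ge_Es.
    assert (Hr2 : 0 < r ^ 2) by nra.
    assert (0 < r ^ 2 * pss) by (apply Rmult_lt_0_compat; lra).
    apply Rmult_le_reg_r with (1 := H2). unfold Rdiv. rewrite Rmult_minus_distr_r, Rmult_assoc, Rinv_l; lra. }
  unfold low_slope. fold K. pose proof K_pos' as HK. destruct (Rle_dec th K) as [hk|hk].
  + fold h. assert (h <= 1).
    { unfold h. apply Rmult_le_reg_r with (1 := HK). unfold Rdiv. rewrite Rmult_assoc, Rinv_l; lra. }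
    assert (0 <= (1 - h) * psi * Pi) by (apply Rmult_le_pos; [apply Rmult_le_pos|]; nra). lra.
  + assert (1 < h).
    { unfold h. apply Rmult_lt_reg_r with (1 := HK). unfold Rdiv. rewrite Rmult_assoc, Rinv_l; lra. }
    assert (0 <= (h - 1) * (q * a - psi * Pi)).
    { apply Rmult_le_pos; [lra|]. assert (psi * Pi <= 1 * Pi) by (apply Rmult_le_compat_r; lra). lra. }
    replace ((r + (1 - r) * (1 - th) / r) / K) with (h - (h - 1) * q)
      by (replace th with (K * h) by (unfold h; field; lra); unfold q, K; field; unfold K in HK; lra).
    lra.
- unfold W. pose proof Lam_pos. pose proof q_gt_H.
  assert (0 <= r ^ 2 * (q - H) * Lam) by (apply Rmult_le_pos; [apply Rmult_le_pos; [apply pow2_ge_0|]|]; lra). lra.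
Qed.

Let kh := Rmin (kap * (1 - psi)) K0.
Let l := r ^ 2 * Ds * kh.

Lemma Ds_D0 : 0 < Ds <= Df 0.
Proof. unfold Ds. pose proof (HDpos vs Hvs). pose proof (HD 0 vs ltac:(lra)). lra. Qed.

Lemma l_bounds a' : 0 <= a' <= 1 -> q * a' * vs <= Df 0 - Ds ->
  0 <= l /\ l < 13/10 * (1 - psi) /\ l < 11/20 * s /\
  l * (s * (1 + r ^ 2) * a' + r ^ 3 * del) < del * (1 + r ^ 3) * (13/10 * (1 - psi)) /\
  l * (s * (1 + r ^ 2) * a' + r ^ 3 * del) < del * (1 + r ^ 3) * (11/20 * s).
Proof.
intros Ha' Hav. pose proof Ds_D0 as HDs. destruct Hkap1 as [k1 k2]; destruct HK01 as [k3 k4].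
pose proof (Hps v Hv) as P2; fold psi in P2. pose proof del_pos' as Hd.
assert (Hr2 : 0 < r ^ 2) by nra. assert (Hr3 : 0 < r ^ 3) by (apply pow_lt; lra).
assert (Hk : 0 <= kh) by (unfold kh; apply Rmin_glb; [apply Rmult_le_pos|]; lra).
set (f := s * (1 + r ^ 2) * a' + r ^ 3 * del).
assert (Hf : 0 < f).
{ unfold f. assert (0 < r ^ 3 * del) by (apply Rmult_lt_0_compat; lra).
  assert (0 <= s * (1 + r ^ 2) * a') by (repeat apply Rmult_le_pos; unfold s; nra). lra. }
pose proof (y_bound a' Ha' Hav) as Y. fold f in Y.
assert (Q : forall B, 0 < B -> r ^ 2 * Df 0 * kh < B -> l < B /\ l * f < del * (1 + r ^ 3) * B).
{ intros B HB HB'. unfold l. split.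
  - apply Rle_lt_trans with (2 := HB'). apply Rmult_le_compat_r; [lra|]. apply Rmult_le_compat_l; lra.
  - apply Rmult_lt_reg_r with (Df 0); [lra|].
    apply Rlt_le_trans with (Ds * f * B).
    + replace (r ^ 2 * Ds * kh * f * Df 0) with (Ds * f * (r ^ 2 * Df 0 * kh)) by ring.
      apply Rmult_lt_compat_l; [apply Rmult_lt_0_compat|]; lra.
    + replace (del * (1 + r ^ 3) * B * Df 0) with (del * (1 + r ^ 3) * Df 0 * B) by ring.
      apply Rmult_le_compat_r; lra. }
assert (R0 : 0 < r ^ 2 * Df 0) by (apply Rmult_lt_0_compat; lra).
destruct (Q (13/10 * (1 - psi))) as [Q1 Q2]; [lra| |].
{ apply Rle_lt_trans with (r ^ 2 * Df 0 * (kap * (1 - psi))).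
  - apply Rmult_le_compat_l; [lra|]. apply Rmin_l.
  - replace (r ^ 2 * Df 0 * (kap * (1 - psi))) with ((r ^ 2 * Df 0 * kap) * (1 - psi)) by ring.
    apply Rmult_lt_compat_r; lra. }
destruct (Q (11/20 * s)) as [Q3 Q4]; [unfold s; lra| |].
{ apply Rle_lt_trans with (r ^ 2 * Df 0 * K0).
  - apply Rmult_le_compat_l; [lra|]. apply Rmin_r.
  - exact k4. }
repeat split; auto. unfold l. repeat apply Rmult_le_pos; lra.
Qed.

End Slopes.

(** The Lyapunov function is
    [(x - us - th * q * (v - vs)) ^ 2 / 2 + G v] with [G] the antiderivative of
    [gf] vanishing at [vs].  The three constants are those for which the terms in
    [E ^ 2 * gf v] match the quadratic form of [quad_pos].  Composing
    with [pf] extends [gf] from the nonnegative half-line to the line. *)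
Let kappa := q ^ 2 * (q ^ 2 + th) * del.
Let c2 := th * q * (q - 1).
Let c3 := rho * q ^ 2.
Let pf x := Rmax 0 x.
Let gf x := kappa * (x - vs) + c2 * (Ds - Df (pf x)) + c3 * Ds * (ps (pf x) - pss).

Lemma th_pos : 0 < th.
Proof. pose proof th_range as [T _]. assert (0 < K * r ^ 3) by (apply Rmult_lt_0_compat; [apply K_pos'|apply pow_lt; lra]). lra. Qed.
Lemma rho_pos' : 0 < rho.
Proof. unfold rho, s. pose proof th_pos. nra. Qed.
Lemma consts_pos : 0 < kappa /\ 0 <= c2 /\ 0 <= c3 * Ds.
Proof.
pose proof th_pos. pose proof q_gt1. pose proof rho_pos'. pose proof del_pos'. pose proof Ds_D0.
assert (0 < q ^ 2) by nra.
repeat split.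
- unfold kappa. apply Rmult_lt_0_compat; [apply Rmult_lt_0_compat|]; lra.
- unfold c2. apply Rmult_le_pos; [apply Rmult_le_pos|]; lra.
- unfold c3. apply Rmult_le_pos; [apply Rmult_le_pos|]; lra.
Qed.

Lemma pf_pos x : 0 <= pf x. Proof. apply Rmax_l. Qed.
Lemma pf_id x : 0 <= x -> pf x = x. Proof. apply Rmax_right. Qed.
Lemma pf_lip x y : Rabs (pf x - pf y) <= Rabs (x - y).
Proof. unfold pf, Rmax. repeat destruct Rle_dec; unfold Rabs; repeat destruct Rcase_abs; lra. Qed.
Lemma Df_lip x y : 0 <= x -> 0 <= y -> Rabs (Df x - Df y) <= q * Rabs (x - y).
Proof.
intros Hx Hy. destruct (Rle_dec x y) as [e|e].
- pose proof (HD x y ltac:(lra)). rewrite (Rabs_pos_eq (Df x - Df y)), (Rabs_left1 (x - y)); lra.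
- pose proof (HD y x ltac:(lra)). rewrite (Rabs_left1 (Df x - Df y)), (Rabs_pos_eq (x - y)); lra.
Qed.

Lemma gf_antiderivative : exists G : R -> R, G vs = 0 /\ forall x, is_derive G x (gf x).
Proof.
pose proof consts_pos as (C1 & C2 & C3). pose proof q_gt1. destruct HK01 as [k1 _].
apply lipschitz_antiderivative with (kappa + c2 * q + c3 * Ds * K0).
- assert (0 <= c2 * q) by (apply Rmult_le_pos; lra).
  assert (0 <= c3 * Ds * K0) by (apply Rmult_le_pos; lra). lra.
- intros x y.
  replace (gf x - gf y) with (kappa * (x - y) + c2 * (Df (pf y) - Df (pf x)) + c3 * Ds * (ps (pf x) - ps (pf y)))
    by (unfold gf; ring).
  eapply Rle_trans; [apply Rabs_triang|].
  eapply Rle_trans; [apply Rplus_le_compat_r, Rabs_triang|].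
  rewrite !Rabs_mult, (Rabs_pos_eq kappa), (Rabs_pos_eq c2), (Rabs_pos_eq c3), (Rabs_pos_eq Ds);
    [|pose proof Ds_D0; lra|unfold c3; apply Rmult_le_pos; [pose proof rho_pos'; lra|apply pow2_ge_0]|lra|lra].
  pose proof (pf_lip x y) as L.
  assert (A : Rabs (Df (pf y) - Df (pf x)) <= q * Rabs (x - y)).
  { rewrite Rabs_minus_sym. eapply Rle_trans; [apply Df_lip; apply pf_pos|]. apply Rmult_le_compat_l; lra. }
  assert (B : Rabs (ps (pf x) - ps (pf y)) <= K0 * Rabs (x - y)).
  { eapply Rle_trans; [apply HK0; apply pf_pos|]. apply Rmult_le_compat_l; lra. }
  assert (c2 * Rabs (Df (pf y) - Df (pf x)) <= c2 * (q * Rabs (x - y))) by (apply Rmult_le_compat_l; lra).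
  assert (c3 * Ds * Rabs (ps (pf x) - ps (pf y)) <= c3 * Ds * (K0 * Rabs (x - y))) by (apply Rmult_le_compat_l; lra).
  lra.
Qed.

Section Decrease.
Variable G : R -> R.
Hypothesis HG : forall x, is_derive G x (gf x).
Hypothesis HG0 : G vs = 0.

Lemma is_derive_parab c0 c1 c2' a' x : is_derive (fun x => c0 + c1 * (x - a') + c2' * (x - a') ^ 2) x (c1 + 2 * c2' * (x - a')).
Proof. auto_derive; [exact I|ring]. Qed.

Lemma G_lower v : 0 <= v -> kappa / 2 * (v - vs) ^ 2 <= G v.
Proof.
intros Hv. pose proof consts_pos as (C1 & C2 & C3).
pose (F := fun x => G x - (0 + 0 * (x - vs) + kappa / 2 * (x - vs) ^ 2)).
assert (F vs <= F v); [|unfold F in *; rewrite HG0 in *; lra].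
apply min_by_sign with (g := fun x => gf x - (0 + 2 * (kappa / 2) * (x - vs))).
- intros y. apply (is_derive_minus G); [apply HG|apply is_derive_parab].
- intros y Hy.
  assert (Hy0 : 0 <= y). { destruct Hy as [Hy _]. apply Rle_trans with (2 := Hy). apply Rmin_glb; lra. }
  unfold gf. rewrite (pf_id y Hy0).
  replace ((kappa * (y - vs) + c2 * (Ds - Df y) + c3 * Ds * (ps y - pss) - (0 + 2 * (kappa / 2) * (y - vs))) * (y - vs))
    with (c2 * ((Ds - Df y) * (y - vs)) + c3 * Ds * ((ps y - pss) * (y - vs))) by field.
  unfold Ds at 1, pss.
  assert (0 <= (Df vs - Df y) * (y - vs)).
  { destruct (Rle_dec y vs); [pose proof (HD y vs ltac:(lra))|pose proof (HD vs y ltac:(lra))]; nra. }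
  assert (0 <= (ps y - ps vs) * (y - vs)).
  { destruct (Rle_dec y vs); [pose proof (Hpsmon y vs ltac:(lra))|pose proof (Hpsmon vs y ltac:(lra))]; nra. }
  apply Rplus_le_le_0_compat; apply Rmult_le_pos; assumption.
Qed.

(** The derivative of [G] grows at most linearly along the segment, with the chord
    slopes of [Df] and [ps]; the bound holds for [v'] on either side of [v]. *)
Lemma G_upper v v' : 0 <= v -> 0 <= v' ->
  G v' - G v <= gf v * (v' - v)
   + (kappa + c2 * q + c3 * Ds * Rmin (kap * (1 - ps v)) K0) / 2 * (v' - v) ^ 2.
Proof.
intros Hv Hv'. pose proof consts_pos as (C1 & C2 & C3).
set (kh := Rmin (kap * (1 - ps v)) K0).
set (B := kappa + c2 * q + c3 * Ds * kh).
pose (F := fun x => (0 + gf v * (x - v) + B / 2 * (x - v) ^ 2) - G x).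
assert (F v <= F v'); [|unfold F in *; lra].
apply min_by_sign with (g := fun x => (gf v + 2 * (B / 2) * (x - v)) - gf x).
- intros y. apply (is_derive_minus _ G); [apply is_derive_parab|apply HG].
- intros y Hy.
  assert (Hy0 : 0 <= y). { destruct Hy as [Hy _]. apply Rle_trans with (2 := Hy). apply Rmin_glb; lra. }
  unfold gf. rewrite (pf_id y Hy0), (pf_id v Hv).
  match goal with |- 0 <= ?e => replace e with
   (c2 * ((q * (y - v) - (Df v - Df y)) * (y - v)) + c3 * Ds * (kh * (y - v) ^ 2 - (ps y - ps v) * (y - v)))
   by (unfold B; field) end.
  assert (0 <= (q * (y - v) - (Df v - Df y)) * (y - v)).
  { destruct (Rle_dec y v); [pose proof (HD y v ltac:(lra))|pose proof (HD v y ltac:(lra))]; nra. }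
  assert (A : Rabs (ps y - ps v) <= kh * Rabs (y - v)).
  { unfold kh, Rmin. destruct Rle_dec; [apply Hkap|apply HK0]; assumption. }
  assert (0 <= kh * (y - v) ^ 2 - (ps y - ps v) * (y - v)).
  { assert ((ps y - ps v) * (y - v) <= Rabs (ps y - ps v) * Rabs (y - v)) by (rewrite <- Rabs_mult; apply Rle_abs).
    assert (Rabs (ps y - ps v) * Rabs (y - v) <= kh * Rabs (y - v) * Rabs (y - v)) by (apply Rmult_le_compat_r; [apply Rabs_pos|exact A]).
    assert (kh * Rabs (y - v) * Rabs (y - v) = kh * (y - v) ^ 2) by (rewrite <- (pow2_abs (y - v)); ring). lra. }
  apply Rplus_le_le_0_compat; apply Rmult_le_pos; assumption.
Qed.

Let Lf x v := (x - us - th * q * (v - vs)) ^ 2 / 2 + G v.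

(** Write [P] and [Q] for the quantity squared in the Lyapunov function before and
    after the step, [z = v' - v] and [E = r ^ 2 * ps v].  The recursion gives
    [E * (P - Q) = - (M v + (1 - t) * z)], and [M v] is a multiple of [v - vs].
    Bounding the increment of [G] by its second order expansion makes
    [2 * E ^ 2] times the decrease at least a quadratic form in [v - vs] and [z],
    which is positive by [quad_pos]; when [v = vs] only its coefficient of
    [z ^ 2] matters. *)
Lemma decrease x v v' : 0 <= v -> 0 <= v' ->
  v' + r ^ 2 * ps v * x = H * (uf v + r ^ 2 * ps v * v) ->
  (x <> us \/ v <> vs) -> Lf (uf v) v' < Lf x v.
Proof.
intros Hv Hv' Hrec Hne.
set (psi := ps v). set (E := r ^ 2 * psi). fold psi in Hrec. fold E in Hrec.
pose proof (Hps v Hv) as Hpsi. fold psi in Hpsi.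
assert (Hr2 : 0 < r ^ 2) by nra.
assert (HE : 0 < E) by (apply Rmult_lt_0_compat; lra).
set (z := v' - v). set (t := psi * th * r).
set (P := x - us - th * q * (v - vs)). set (Q := uf v - us - th * q * (v' - vs)).
assert (EPQ : E * (P - Q) = - (M v + (1 - t) * z)).
{ transitivity (H * (uf v + E * v) - v' - E * uf v + E * th * q * z).
  - unfold P, Q, z. replace (H * (uf v + E * v)) with (v' + E * x) by exact Hrec. ring.
  - unfold M. fold psi. fold E. unfold z, t. unfold E at 3. unfold q. field. lra. }
set (l := r ^ 2 * Ds * Rmin (kap * (1 - psi)) K0).
set (B := kappa + c2 * q + c3 * Ds * Rmin (kap * (1 - psi)) K0).
assert (EB : E ^ 2 * B = psi ^ 2 * ((1 + th * r ^ 2) * del + th * r * s + rho * l)).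
{ unfold B, kappa, c2, c3, l, E, q, s. field. lra. }
pose proof (G_upper v v' Hv Hv') as GU. fold psi in GU. fold B in GU. fold z in GU.
apply Rlt_0_minus. apply Rmult_lt_reg_l with (E ^ 2 * 2); [nra|]. rewrite Rmult_0_r.
unfold Lf. fold P Q.
apply Rlt_le_trans with ((E * (P - Q)) * (E * (P + Q)) - 2 * E ^ 2 * (gf v * z) - (E ^ 2 * B) * z ^ 2).
2: { assert (E ^ 2 * 2 * (G v' - G v) <= E ^ 2 * 2 * (gf v * z + B / 2 * z ^ 2)) by (apply Rmult_le_compat_l; [nra|lra]). lra. }
replace (E * (P + Q)) with (E * (P - Q) + 2 * (E * Q)) by ring.
rewrite EPQ, EB.
destruct (Req_dec v vs) as [e|e].
- assert (Hz : z <> 0).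
  { intros e0. destruct Hne as [Hne|Hne]; [|contradiction].
    apply Hne. rewrite e, M_vs, e0 in EPQ.
    assert (H1 : P - Q = 0) by (apply Rmult_eq_reg_l with E; [rewrite EPQ; ring|lra]).
    unfold P, Q in H1. fold z in H1. replace v' with v in H1 by (unfold z in e0; lra).
    rewrite e in H1. fold us in H1. lra. }
  assert (EQ : E * Q = - t * z).
  { unfold Q, z. rewrite e. fold us. unfold t, E, q. field. lra. }
  assert (G0 : gf v = 0).
  { unfold gf. rewrite e, (pf_id vs Hvs). fold Ds pss. ring. }
  rewrite EQ, G0, e, M_vs.
  destruct (l_bounds v Hv 0) as (L1 & L2 & L3 & L4 & L5); [lra| |].
  { pose proof Ds_D0. lra. }
  pose proof del_pos' as Hd.
  destruct (quad_disc r th psi 0 l (psi * del) 0 Hr th_range Hpsi ltac:(lra) ltac:(lra) L1 L2 L3 L4 L5) as [N _].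
  { fold del. assert (0 <= (1 - psi) * r * del) by (apply Rmult_le_pos; [apply Rmult_le_pos|]; lra).
    assert (psi * del <= 1 * del) by (apply Rmult_le_compat_r; lra). lra. }
  match goal with |- 0 < ?e => replace e with ((1 - (1 - th * (1 - r)) * psi ^ 2 * (1 + l)) * z ^ 2)
    by (unfold rho, t, del, s; ring) end.
  apply Rmult_lt_0_compat; [exact N|nra].
- set (vt := v - vs). assert (Hvt : vt <> 0) by (unfold vt; lra).
  pose proof (M_slope v e) as MS.
  pose proof (l_bounds v Hv ((Ds - Df v) / (q * (v - vs))) (a_range v Hv e) (a_vs v Hv e)) as (L1 & L2 & L3 & L4 & L5).
  pose proof (W_range v Hv e) as HW.
  pose proof (quad_pos r th psi _ l _ _ Hr th_range Hpsi (a_range v Hv e) (Tc_pos v Hv e) L1 L2 L3 L4 L5 HW vt z Hvt) as Hq.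
  rewrite MS. fold psi vt in Hq |- *.
  set (a := (Ds - Df v) / (q * vt)) in *.
  set (Tc := (psi - pss) / vt * Ds * r ^ 2) in *.
  match type of Hq with context [?W + Tc - _] => set (W0 := W) in * end.
  assert (Ea : Df v = Ds - q * a * vt) by (unfold a; field; split; [lra|pose proof q_gt1; lra]).
  assert (EQ : E * Q = - psi * (r * (a - del)) * vt - t * z).
  { unfold Q, uf, us. unfold uf. fold Ds. rewrite Ea. replace v' with (v + z) by (unfold z; ring).
    replace (v + z - vs) with (vt + z) by (unfold vt; ring). replace v with (vs + vt) by (unfold vt; ring).
    unfold t, E, q, del. field. lra. }
  assert (EG : E ^ 2 * gf v = vt * psi ^ 2 * ((1 + th * r ^ 2) * del + th * r * s * a + rho * Tc)).
  { unfold gf. rewrite (pf_id v Hv), Ea. fold psi vt. unfold Tc, kappa, c2, c3, E, q, s. field. lra. }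
  replace (2 * E ^ 2 * (gf v * z)) with (2 * (E ^ 2 * gf v) * z) by ring.
  rewrite EQ, EG.
  fold W0.
  match goal with |- 0 < ?e => match type of Hq with 0 < ?e' => replace e with e'; [exact Hq|] end end.
  unfold rho, t, del, s. ring.
Qed.

Lemma uf_lip x y : 0 <= x -> 0 <= y -> Rabs (uf x - uf y) <= (2 * q) * Rabs (x - y).
Proof.
intros Hx Hy. pose proof q_gt1. replace (uf x - uf y) with ((Df x - Df y) + q * (x - y)) by (unfold uf; ring).
eapply Rle_trans; [apply Rabs_triang|]. rewrite (Rabs_mult q), (Rabs_pos_eq q) by lra.
pose proof (Df_lip x y Hx Hy). lra.
Qed.

Section Chain.
Variables (xn vn : nat -> R).
Hypothesis Hvn : forall n, 0 <= vn n.
Hypothesis Hxn : forall n, xn (S n) = uf (vn n).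
Hypothesis Hrecn : forall n,
  vn (S n) + r ^ 2 * ps (vn n) * xn n = H * (uf (vn n) + r ^ 2 * ps (vn n) * vn n).
Let Ln n := Lf (xn n) (vn n).

Lemma Lf_lower x v : 0 <= v -> 0 <= (x - us - th * q * (v - vs)) ^ 2 / 2 /\ 0 <= kappa / 2 * (v - vs) ^ 2
  /\ (x - us - th * q * (v - vs)) ^ 2 / 2 + kappa / 2 * (v - vs) ^ 2 <= Lf x v.
Proof.
intros Hv. pose proof (G_lower v Hv). pose proof consts_pos as (C1 & _).
pose proof (pow2_ge_0 (x - us - th * q * (v - vs))). pose proof (pow2_ge_0 (v - vs)).
repeat split; [lra|apply Rmult_le_pos; lra|unfold Lf; lra].
Qed.

Lemma Ln_decr n : Ln (S n) <= Ln n.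
Proof.
unfold Ln. destruct (Req_dec (xn n) us) as [e1|e1]; [destruct (Req_dec (vn n) vs) as [e2|e2]|].
- assert (E : vn (S n) = vs).
  { pose proof (Hrecn n) as R. rewrite e1, e2 in R. fold us pss in R. lra. }
  rewrite (Hxn n), E, e1, e2. fold us. lra.
- rewrite Hxn. left. apply decrease; auto.
- rewrite Hxn. left. apply decrease; auto.
Qed.

Lemma Ln_pos n : 0 <= Ln n.
Proof. unfold Ln. pose proof (Lf_lower (xn n) (vn n) (Hvn n)). lra. Qed.

Lemma Ln_le n m : (n <= m)%nat -> Ln m <= Ln n.
Proof. induction 1 as [|m _ IH]; [lra|]. pose proof (Ln_decr m). lra. Qed.

Lemma Ln_small eps : 0 < eps -> exists d, 0 < d /\ forall x v, 0 <= v ->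
   Lf x v < d -> Rabs (v - vs) < eps /\ Rabs (x - us) < eps.
Proof.
intros He. pose proof consts_pos as (C1 & _). pose proof th_pos as T. pose proof q_gt1 as Q.
assert (TQ : 0 < th * q) by (apply Rmult_lt_0_compat; lra).
set (e1 := eps / (2 * (1 + th * q))).
assert (He1 : 0 < e1) by (unfold e1; apply Rdiv_lt_0_compat; lra).
assert (E1 : e1 + th * q * e1 = eps / 2) by (unfold e1; field; lra).
assert (A1 : 0 < e1 ^ 2) by nra.
assert (TQe : 0 < th * q * e1) by (apply Rmult_lt_0_compat; lra).
exists (Rmin (kappa / 2 * e1 ^ 2) (e1 ^ 2 / 2)). split.
{ apply Rmin_glb_lt; [apply Rmult_lt_0_compat|]; lra. }
intros x v Hv HL. destruct (Lf_lower x v Hv) as (L1 & L2 & L3).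
pose proof (Rmin_l (kappa / 2 * e1 ^ 2) (e1 ^ 2 / 2)). pose proof (Rmin_r (kappa / 2 * e1 ^ 2) (e1 ^ 2 / 2)).
assert (V : Rabs (v - vs) < e1).
{ rewrite <- (Rabs_pos_eq e1) by lra. apply Rsqr_lt_abs_0. unfold Rsqr.
  apply Rmult_lt_reg_l with (kappa / 2); lra. }
assert (X : Rabs (x - us - th * q * (v - vs)) < e1).
{ rewrite <- (Rabs_pos_eq e1) by lra. apply Rsqr_lt_abs_0. unfold Rsqr. lra. }
split; [lra|].
replace (x - us) with ((x - us - th * q * (v - vs)) + th * q * (v - vs)) by ring.
eapply Rle_lt_trans; [apply Rabs_triang|].
rewrite Rabs_mult, (Rabs_pos_eq (th * q)) by lra.
assert (th * q * Rabs (v - vs) <= th * q * e1) by (apply Rmult_le_compat_l; lra). lra.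
Qed.

Lemma chain_bounded : exists A, forall n, Rabs (vn n) <= A /\ Rabs (xn n) <= A.
Proof.
pose proof consts_pos as (C1 & _). pose proof th_pos as T. pose proof q_gt1 as Q.
assert (TQ : 0 < th * q) by (apply Rmult_lt_0_compat; lra).
set (L0 := Ln 0%nat). pose proof (Ln_pos 0) as HL0. fold L0 in HL0.
set (a1 := 1 + 2 * L0 / kappa). set (a2 := 1 + 2 * L0).
assert (0 <= 2 * L0 / kappa) by (apply Rle_mult_inv_pos; lra).
exists (Rabs vs + a1 + (Rabs us + a2 + th * q * a1)). intros n.
pose proof (Ln_le 0 n ltac:(lia)) as HL. fold L0 in HL. unfold Ln in HL.
destruct (Lf_lower (xn n) (vn n) (Hvn n)) as (L1 & L2 & L3).
assert (TQ1 : 0 <= th * q * a1) by (apply Rmult_le_pos; unfold a1; lra).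
assert (V : Rabs (vn n - vs) <= a1).
{ assert (S : (vn n - vs) ^ 2 <= 2 * L0 / kappa).
  { apply Rmult_le_reg_l with (kappa / 2); [lra|]. replace (kappa / 2 * (2 * L0 / kappa)) with L0 by (field; lra). lra. }
  rewrite <- (pow2_abs (vn n - vs)) in S. pose proof (Rabs_pos (vn n - vs)). unfold a1. nra. }
assert (X : Rabs (xn n - us - th * q * (vn n - vs)) <= a2).
{ assert (S : (xn n - us - th * q * (vn n - vs)) ^ 2 <= 2 * L0) by lra.
  rewrite <- pow2_abs in S. pose proof (Rabs_pos (xn n - us - th * q * (vn n - vs))). unfold a2. nra. }
pose proof (Rabs_pos vs). pose proof (Rabs_pos us).
assert (0 <= a1) by (unfold a1; lra). assert (0 <= a2) by (unfold a2; lra).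
split.
- replace (vn n) with (vs + (vn n - vs)) by ring. eapply Rle_trans; [apply Rabs_triang|]. lra.
- replace (xn n) with (us + ((xn n - us - th * q * (vn n - vs)) + th * q * (vn n - vs))) by ring.
  eapply Rle_trans; [apply Rabs_triang|].
  eapply Rle_trans; [apply Rplus_le_compat_l, Rabs_triang|].
  rewrite Rabs_mult, (Rabs_pos_eq (th * q)) by lra.
  assert (th * q * Rabs (vn n - vs) <= th * q * a1) by (apply Rmult_le_compat_l; lra). lra.
Qed.

Lemma lip_lim (f : R -> R) c (u : nat -> R) l :
  (forall x y, 0 <= x -> 0 <= y -> Rabs (f x - f y) <= c * Rabs (x - y)) ->
  (forall n, 0 <= u n) -> 0 <= l -> is_lim_seq u l -> is_lim_seq (fun n => f (u n)) (f l).
Proof.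
intros Hf Hu Hl Hlim.
apply is_lim_seq_ext with (fun n => f l + (f (u n) - f l)); [intros; ring|].
evar_last; [apply is_lim_seq_plus'; [apply is_lim_seq_const|]|f_equal; apply Rplus_0_r].
apply is_lim_seq_abs_0.
apply is_lim_seq_le_le with (fun _ => 0) (fun n => c * Rabs (u n - l)).
- intros n. split; [apply Rabs_pos|auto].
- apply is_lim_seq_const.
- evar_last; [apply is_lim_seq_mult'; [apply is_lim_seq_const|]|f_equal; apply (Rmult_0_r c)].
  apply -> is_lim_seq_abs_0.
  evar_last; [apply is_lim_seq_minus'; [exact Hlim|apply is_lim_seq_const]|f_equal; ring].
Qed.

(** The sublevel sets of the Lyapunov function are bounded, so a subsequence of the
    chain converges.  The function has the same value at its limit and at the image
    of the limit, so the limit is the fixed point, the values tend to 0, and the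
    whole chain follows. *)
Theorem chain_converges : is_lim_seq xn us /\ is_lim_seq vn vs.
Proof.
assert (Key : forall d, 0 < d -> exists n, Ln n < d).
{ destruct chain_bounded as [A HA].
  destruct (bounded_subsequence vn A (fun n => proj1 (HA n))) as (phi1 & vb & Hphi1 & Hvb).
  destruct (bounded_subsequence (fun n => xn (phi1 n)) A (fun n => proj2 (HA (phi1 n)))) as (phi2 & xb & Hphi2 & Hxb).
  set (phi n := phi1 (phi2 n)).
  assert (Hphi : forall n, (n <= phi n)%nat) by (intros n; unfold phi; specialize (Hphi1 (phi2 n)); specialize (Hphi2 n); lia).
  assert (Hv : is_lim_seq (fun n => vn (phi n)) vb) by (apply (is_lim_seq_subseq' (fun n => vn (phi1 n))); assumption).
  change (is_lim_seq (fun n => xn (phi n)) xb) in Hxb.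
  assert (Hvb0 : 0 <= vb).
  { apply (is_lim_seq_le (fun _ => 0) (fun n => vn (phi n)) 0 vb); auto. apply is_lim_seq_const. }
  assert (HD1 : is_lim_seq (fun n => uf (vn (phi n))) (uf vb)).
  { apply lip_lim with (2 * q); auto. apply uf_lip. }
  assert (HP1 : is_lim_seq (fun n => ps (vn (phi n))) (ps vb)).
  { apply lip_lim with K0; auto. }
  set (v1 := H * (uf vb + r ^ 2 * ps vb * vb) - r ^ 2 * ps vb * xb).
  assert (Hv1 : is_lim_seq (fun n => vn (S (phi n))) v1).
  { apply is_lim_seq_ext with (fun n => H * (uf (vn (phi n)) + r ^ 2 * ps (vn (phi n)) * vn (phi n)) - r ^ 2 * ps (vn (phi n)) * xn (phi n)).
    - intros n. rewrite <- Hrecn. ring.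
    - unfold v1. apply is_lim_seq_minus'; [apply is_lim_seq_mult'; [apply is_lim_seq_const|apply is_lim_seq_plus'; [exact HD1|]]|];
      (apply is_lim_seq_mult'; [apply is_lim_seq_mult'; [apply is_lim_seq_const|]|]); assumption. }
  assert (Hv10 : 0 <= v1).
  { apply (is_lim_seq_le (fun _ => 0) (fun n => vn (S (phi n))) 0 v1); auto. apply is_lim_seq_const. }
  assert (Hx1 : is_lim_seq (fun n => xn (S (phi n))) (uf vb)).
  { apply is_lim_seq_ext with (fun n => uf (vn (phi n))); [intros; rewrite Hxn; reflexivity|exact HD1]. }
  assert (LL : forall (xx vv : nat -> R) (a b : R), is_lim_seq xx a -> is_lim_seq vv b -> is_lim_seq (fun n => Lf (xx n) (vv n)) (Lf a b)).
  { intros xx vv a b Ha Hb. unfold Lf.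
    apply is_lim_seq_plus'.
    - apply (is_lim_seq_continuous (fun y => y ^ 2 / 2) (fun n => xx n - us - th * q * (vv n - vs))).
      + apply derivable_continuous_pt. reg.
      + apply is_lim_seq_minus'; [apply is_lim_seq_minus'; [exact Ha|apply is_lim_seq_const]|].
        apply is_lim_seq_mult'; [apply is_lim_seq_const|]. apply is_lim_seq_minus'; [exact Hb|apply is_lim_seq_const].
    - apply is_lim_seq_continuous; [|exact Hb]. apply continuity_pt_filterlim.
      apply (ex_derive_continuous G). eexists; apply HG. }
  pose proof (LL _ _ _ _ Hxb Hv) as M1. pose proof (LL _ _ _ _ Hx1 Hv1) as M2.
  destruct (ex_finite_lim_seq_decr Ln 0 Ln_decr Ln_pos) as [Li HLi].
  assert (M1' : is_lim_seq (fun n => Lf (xn (phi n)) (vn (phi n))) Li) by (apply (is_lim_seq_subseq' Ln); assumption).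
  assert (M2' : is_lim_seq (fun n => Lf (xn (S (phi n))) (vn (S (phi n)))) Li).
  { apply (is_lim_seq_subseq' Ln (fun n => S (phi n))); [|exact HLi]. intros n; specialize (Hphi n); lia. }
  assert (E : Lf (uf vb) v1 = Lf xb vb).
  { apply is_lim_seq_unique in M1, M2, M1', M2'. congruence. }
  assert (EE : xb = us /\ vb = vs).
  { destruct (Req_dec xb us); [destruct (Req_dec vb vs); [auto|]|];
    pose proof (decrease xb vb v1 Hvb0 Hv10 ltac:(unfold v1; ring) ltac:(auto)); lra. }
  destruct EE as [-> ->].
  intros d Hd. assert (L0 : Lf us vs = 0) by (unfold Lf; rewrite HG0; field).
  rewrite L0 in M1. apply is_lim_seq_spec in M1. destruct (M1 (mkposreal d Hd)) as [N HN].
  exists (phi N). specialize (HN N (le_n N)). simpl in HN. unfold Ln. apply Rabs_def2 in HN. lra. }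
assert (Fin : forall eps, 0 < eps -> exists N, forall n, (N <= n)%nat -> Rabs (vn n - vs) < eps /\ Rabs (xn n - us) < eps).
{ intros eps He. destruct (Ln_small eps He) as (d & Hd & HL). destruct (Key d Hd) as [N HN].
  exists N. intros n Hn. apply HL; auto. pose proof (Ln_le N n Hn). unfold Ln in *. lra. }
split; apply is_lim_seq_spec; intros eps; destruct (Fin eps (cond_pos eps)) as [N HN]; exists N; intros n Hn; apply HN; exact Hn.
Qed.
End Chain.
End Decrease.

Theorem chain_limit (xn vn : nat -> R) :
  (forall n, 0 <= vn n) -> (forall n, xn (S n) = uf (vn n)) ->
  (forall n, vn (S n) + r ^ 2 * ps (vn n) * xn n = H * (uf (vn n) + r ^ 2 * ps (vn n) * vn n)) ->
  is_lim_seq xn us /\ is_lim_seq vn vs.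
Proof.
intros H1 H2 H3. destruct gf_antiderivative as (G & G0 & HG).
exact (chain_converges G HG G0 xn vn H1 H2 H3).
Qed.
End Lyapunov.

(** * The landing curve *)

(** A flight launched with ordinate [y] lands after a time [PI + s], where
    [Vc s = (1 + mu ^ 2) * y]; it lands at abscissa [Uc s / (1 + mu ^ 2)].  So
    [s] parametrizes the set of landings, and [Dc] is the function [Df] of the
    recursion, with [ps = Yc s ^ 2] for its second function. *)
Section Curve.
Variable mu : R.
Hypothesis Hmu : 0 < mu.
Definition rc := exp (- (mu * PI)).
Definition qc := / rc.
Definition Yc s := exp (- (mu * s)).
Definition Xc s := / Yc s.
Definition Vc s := (cos s + rc * Yc s) / sin s - mu.
Definition Uc s := (cos s + qc * Xc s) / sin s + mu.
Definition Dc s := Uc s - qc * Vc s.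
Let r := rc. Let q := qc. Let Y := Yc. Let X := Xc. Let V := Vc. Let U := Uc. Let D := Dc.
Let c := 1 + mu ^ 2.

Lemma r_range : 0 < r < 1.
Proof.
unfold r, rc. split; [apply exp_pos|]. rewrite <- exp_0. apply exp_increasing.
pose proof PI_RGT_0. assert (0 < mu * PI) by (apply Rmult_lt_0_compat; lra). lra.
Qed.
Lemma q_range : 1 < q.
Proof. unfold q, qc. fold r. pose proof r_range. rewrite <- Rinv_1. apply Rinv_lt_contravar; lra. Qed.
Lemma qr_1 : q * r = 1.
Proof. unfold q, qc. fold r. pose proof r_range. field. lra. Qed.
Lemma Y_pos s : 0 < Y s. Proof. apply exp_pos. Qed.
Lemma X_pos s : 0 < X s. Proof. apply Rinv_0_lt_compat, Y_pos. Qed.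
Lemma XY_1 s : X s * Y s = 1.
Proof. unfold X, Xc. fold (Y s). pose proof (Y_pos s). field. lra. Qed.
Lemma Y_le s t : s <= t -> Y t <= Y s.
Proof.
intros H. unfold Y, Yc. destruct (Req_dec s t) as [->|]; [lra|]. left. apply exp_increasing.
assert (mu * s < mu * t) by (apply Rmult_lt_compat_l; lra). lra.
Qed.
Lemma Y_lt s t : s < t -> Y t < Y s.
Proof.
intros H. unfold Y, Yc. apply exp_increasing.
assert (mu * s < mu * t) by (apply Rmult_lt_compat_l; lra). lra.
Qed.
Lemma Y_0 : Y 0 = 1. Proof. unfold Y, Yc. rewrite Rmult_0_r, Ropp_0. apply exp_0. Qed.
Lemma Y_PI : Y PI = r. Proof. reflexivity. Qed.
Lemma Y_range s : 0 < s < PI -> r < Y s < 1.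
Proof. intros Hs. rewrite <- Y_PI, <- Y_0. split; apply Y_lt; lra. Qed.
Lemma X_ge1 s : 0 <= s -> 1 <= X s.
Proof.
intros Hs. pose proof (Y_pos s). pose proof (Y_le 0 s Hs). rewrite Y_0 in *.
unfold X, Xc. fold (Y s). rewrite <- Rinv_1. apply Rinv_le_contravar; lra.
Qed.
Lemma is_derive_Y s : is_derive Y s (- mu * Y s).
Proof. unfold Y, Yc. auto_derive; [exact I|ring]. Qed.
Lemma is_derive_X s : is_derive X s (mu * X s).
Proof.
unfold X, Xc. pose proof (Y_pos s).
evar_last; [apply is_derive_inv; [apply is_derive_Y|apply Rgt_not_eq; assumption]|].
fold (Y s). field. apply Rgt_not_eq; assumption.
Qed.
Lemma sin_sq s : sin s ^ 2 = 1 - cos s ^ 2.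
Proof. pose proof (sin2_cos2 s) as E. unfold Rsqr in E. lra. Qed.
Lemma sin_pos s : 0 < s < PI -> 0 < sin s.
Proof. intros [H1 H2]. apply sin_gt_0; assumption. Qed.

(** Up to sign, the numerators of the derivatives of [Vc] and [Dc] over
    [sin s ^ 2]. *)
Definition Pvc s := 1 + r * Y s * (cos s + mu * sin s).
Definition Pdc s := (q - 1) - cos s * (q * X s - Y s) + mu * sin s * (q * X s + Y s).

Lemma Pv_U s : sin s <> 0 -> Pvc s = r * Y s * U s * sin s.
Proof. intros Hs. unfold Pvc, U, Uc, X, Xc. fold (Y s). fold q. unfold q, qc. fold r.
pose proof (Y_pos s). pose proof r_range. field. lra. Qed.
Lemma Pd_eq s : sin s <> 0 -> Pdc s = sin s * (Y s * U s - q * X s * V s).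
Proof.
intros Hs. unfold Pdc, U, Uc, V, Vc. fold (X s) (Y s) q r.
pose proof (XY_1 s) as E1. pose proof qr_1 as E2.
replace (sin s * (Y s * ((cos s + q * X s) / sin s + mu) - q * X s * ((cos s + r * Y s) / sin s - mu)))
 with (Y s * cos s + q * (X s * Y s) + mu * Y s * sin s - q * X s * cos s - (q * r) * (X s * Y s) + mu * q * X s * sin s)
 by (field; exact Hs).
rewrite E1, E2. ring.
Qed.
Lemma V_num s : sin s <> 0 -> V s * sin s = cos s + r * Y s - mu * sin s.
Proof. intros Hs. unfold V, Vc. fold (Y s) r. field. exact Hs. Qed.
Lemma U_num s : sin s <> 0 -> U s * sin s = cos s + q * X s + mu * sin s.
Proof. intros Hs. unfold U, Uc. fold (X s) q. field. exact Hs. Qed.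

Lemma is_derive_V s : sin s <> 0 -> is_derive V s (- Pvc s / sin s ^ 2).
Proof.
intros Hs. unfold V, Vc, Yc. auto_derive; [exact Hs|].
change (exp (- (mu * s))) with (Y s). fold r. unfold Pvc.
apply Rmult_eq_reg_r with (sin s ^ 2); [|apply pow_nonzero; exact Hs].
field_simplify; [|exact Hs..]. rewrite sin_sq. ring.
Qed.
Lemma is_derive_U s : sin s <> 0 -> is_derive U s (- (q * X s * V s) / sin s).
Proof.
intros Hs. unfold U, Uc. fold X q.
evar_last.
- apply (is_derive_plus (fun s => (cos s + q * X s) / sin s)); [|apply is_derive_const].
  apply is_derive_div; [|apply is_derive_sin|exact Hs].
  apply (is_derive_plus cos); [apply is_derive_cos|]. apply is_derive_scal. apply is_derive_X.
- unfold plus, zero, scal; simpl. unfold mult; simpl.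
  apply Rmult_eq_reg_r with (sin s ^ 2); [|apply pow_nonzero; exact Hs].
  replace (- (q * X s * V s) / sin s * sin s ^ 2) with (- (q * X s) * (V s * sin s)) by (field; exact Hs).
  rewrite (V_num s Hs). pose proof (XY_1 s) as E1. pose proof qr_1 as E2.
  replace (- (q * X s) * (cos s + r * Y s - mu * sin s)) with (- q * X s * cos s - (q * r) * (X s * Y s) + q * X s * mu * sin s) by ring.
  rewrite E1, E2. field_simplify; [|exact Hs]. rewrite sin_sq. ring.
Qed.
Lemma is_derive_D s : sin s <> 0 -> is_derive D s (Pdc s / sin s ^ 2).
Proof.
intros Hs. unfold D, Dc. fold U V q.
evar_last; [apply (is_derive_minus U); [apply is_derive_U; exact Hs|apply is_derive_scal, is_derive_V; exact Hs]|].
unfold minus, plus, opp, scal; simpl. unfold mult; simpl. rewrite (Pd_eq s Hs), (Pv_U s Hs).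
transitivity (- (q * X s * V s) / sin s + (q * r) * Y s * U s / sin s); [field; exact Hs|].
rewrite qr_1. field. exact Hs.
Qed.

Lemma U_pos s : 0 < s < PI -> 0 < U s.
Proof.
intros Hs. pose proof (sin_pos s Hs) as S. apply Rmult_lt_reg_r with (sin s); [exact S|].
rewrite Rmult_0_l, U_num by lra. pose proof (X_ge1 s ltac:(lra)). pose proof q_range.
pose proof (COS_bound s). assert (0 < mu * sin s) by (apply Rmult_lt_0_compat; lra). nra.
Qed.
Lemma Pv_pos s : 0 < s < PI -> 0 < Pvc s.
Proof.
intros Hs. pose proof (sin_pos s Hs). rewrite Pv_U by lra.
pose proof (U_pos s Hs). pose proof (Y_pos s). pose proof r_range.
repeat apply Rmult_lt_0_compat; lra.
Qed.
Lemma is_derive_Pv s : is_derive Pvc s (- c * (r * Y s) * sin s).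
Proof. unfold Pvc, Y, Yc. auto_derive; [exact I|]. unfold c. ring. Qed.
Lemma is_derive_Pd s : is_derive Pdc s (c * sin s * (q * X s - Y s)).
Proof.
unfold Pdc.
evar_last.
- apply (is_derive_plus (fun s => (q - 1) - cos s * (q * X s - Y s)) (fun s => mu * sin s * (q * X s + Y s))).
  + apply (is_derive_minus (fun _ => q - 1) (fun s => cos s * (q * X s - Y s))); [apply is_derive_const|].
    apply (is_derive_mult cos (fun s => q * X s - Y s)); [apply is_derive_cos| |intros; apply Rmult_comm].
    apply (is_derive_minus (fun s => q * X s) Y); [apply is_derive_scal, is_derive_X|apply is_derive_Y].
  + apply (is_derive_mult (fun s => mu * sin s) (fun s => q * X s + Y s)); [apply is_derive_scal, is_derive_sin| |intros; apply Rmult_comm].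
    apply (is_derive_plus (fun s => q * X s) Y); [apply is_derive_scal, is_derive_X|apply is_derive_Y].
- unfold minus, plus, opp, zero, mult; simpl. unfold c. ring.
Qed.
(** [Pdc] vanishes at 0 and increases, as [q * X >= 1 >= Y]. *)
Lemma Pd_pos s : 0 <= s <= PI -> 0 <= Pdc s.
Proof.
intros Hs. assert (E : Pdc 0 = 0).
{ unfold Pdc, X, Xc. fold (Y 0). rewrite Y_0, sin_0, cos_0. field. }
rewrite <- E. apply increasing_between with (fun s => c * sin s * (q * X s - Y s)); [lra|intros; apply is_derive_Pd|].
intros x Hx. pose proof (X_ge1 x ltac:(lra)). pose proof (Y_le 0 x ltac:(lra)) as Y1. rewrite Y_0 in Y1.
pose proof q_range. pose proof (sin_pos x ltac:(lra)).
apply Rmult_le_pos; [apply Rmult_le_pos; [unfold c; nra|lra]|nra].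
Qed.

Lemma V_decr s t : 0 < s -> s < t -> t < PI -> V t < V s.
Proof.
intros H1 H2 H3. apply strictly_decreasing_between with (fun s => - Pvc s / sin s ^ 2); [lra| |].
- intros x Hx. apply is_derive_V. pose proof (sin_pos x ltac:(lra)); lra.
- intros x Hx. pose proof (sin_pos x ltac:(lra)). pose proof (Pv_pos x ltac:(lra)).
  unfold Rdiv. rewrite Ropp_mult_distr_l_reverse. apply Ropp_lt_gt_0_contravar.
  apply Rdiv_lt_0_compat; [lra|]. apply pow_lt; lra.
Qed.
Lemma D_incr s t : 0 < s -> s <= t -> t < PI -> D s <= D t.
Proof.
intros H1 H2 H3. apply increasing_between with (fun s => Pdc s / sin s ^ 2); [lra| |].
- intros x Hx. apply is_derive_D. pose proof (sin_pos x ltac:(lra)); lra.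
- intros x Hx. pose proof (sin_pos x ltac:(lra)). apply Rle_mult_inv_pos; [apply Pd_pos; lra|apply pow_lt; lra].
Qed.
Lemma D_pos s : 0 < s < PI -> 0 < D s.
Proof.
intros Hs. assert (S : 0 < sin s) by (apply sin_pos; lra).
apply Rmult_lt_reg_r with (sin s); [exact S|]. rewrite Rmult_0_l.
unfold D, Dc. fold U V q. rewrite Rmult_minus_distr_r, Rmult_assoc, (U_num s), (V_num s) by lra.
pose proof (XY_1 s). pose proof (X_ge1 s ltac:(lra)). pose proof (Y_le 0 s ltac:(lra)) as Y1. rewrite Y_0 in Y1.
pose proof q_range. pose proof qr_1. pose proof (COS_bound s).
replace (cos s + q * X s + mu * sin s - q * (cos s + r * Y s - mu * sin s)) with
  (q * X s - (q * r) * Y s - (q - 1) * cos s + mu * (1 + q) * sin s) by ring.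
rewrite H2.
assert (0 < mu * (1 + q) * sin s) by (repeat apply Rmult_lt_0_compat; lra).
assert (q * 1 <= q * X s) by (apply Rmult_le_compat_l; lra).
assert ((q - 1) * cos s <= (q - 1) * 1) by (apply Rmult_le_compat_l; lra). lra.
Qed.
End Curve.

Section Curve2.
Variable mu : R.
Hypothesis Hmu : 0 < mu.
Let r := rc mu. Let q := qc mu. Let Y := Yc mu. Let X := Xc mu. Let V := Vc mu. Let U := Uc mu. Let D := Dc mu.
Let c := 1 + mu ^ 2.
Let Pv := Pvc mu. Let Pd := Pdc mu.
Let Xp s : 0 < X s := X_pos mu s.
Let Yp s : 0 < Y s := Y_pos mu s.
Let X1 s : 0 <= s -> 1 <= X s := X_ge1 mu Hmu s.
Let Y1 s (h : 0 <= s) : Y s <= 1 := eq_ind _ (fun z => Y s <= z) (Y_le mu Hmu 0 s h) _ (Y_0 mu).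
Let rp : 0 < r < 1 := r_range mu Hmu.
Let qp : 1 < q := q_range mu Hmu.

(** Convexity of [D] as a function of [V]: the slope [Pd / Pv] of [- D] against [V]
    increases with [s], so for [k] its value at [s2] the function [D + k * V] is
    minimal at [s2]. *)
Lemma D_convex s1 s2 s3 : 0 < s3 -> s3 <= s2 -> s2 <= s1 -> s1 < PI ->
  (D s2 - D s3) * (V s2 - V s1) <= (D s1 - D s2) * (V s3 - V s2).
Proof.
intros H3 H2 H1 HP.
set (k := Pd s2 / Pv s2).
assert (Pd_mon : forall x y, 0 < x -> x <= y -> y < PI -> Pd x <= Pd y).
{ intros x y Hx Hxy Hy. apply increasing_between with (fun s => c * sin s * (q * X s - Y s)); [lra|intros; apply is_derive_Pd; exact Hmu|].
  intros z Hz. pose proof (X1 z ltac:(lra)). pose proof (Y1 z ltac:(lra)). pose proof qp. pose proof (sin_pos z ltac:(lra)).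
  apply Rmult_le_pos; [apply Rmult_le_pos; [unfold c; nra|lra]|nra]. }
assert (Pv_mon : forall x y, 0 < x -> x <= y -> y < PI -> Pv y <= Pv x).
{ intros x y Hx Hxy Hy. apply decreasing_between with (fun s => - c * (r * Y s) * sin s); [lra|intros; apply is_derive_Pv|].
  intros z Hz. pose proof (Yp z). pose proof rp. pose proof (sin_pos z ltac:(lra)).
  assert (0 <= c * (r * Y z) * sin z).
  { apply Rmult_le_pos; [apply Rmult_le_pos; [unfold c; nra|apply Rmult_le_pos; lra]|lra]. } lra. }
assert (P2 : 0 < Pv s2) by (apply Pv_pos; [exact Hmu|lra]).
assert (Q2 : 0 <= Pd s2) by (apply Pd_pos; [exact Hmu|lra]).
assert (Hk : 0 <= k) by (apply Rle_mult_inv_pos; assumption).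
assert (Ek : k * Pv s2 = Pd s2) by (unfold k; field; lra).
assert (Hd : forall x, 0 < x < PI -> is_derive (fun s => D s + k * V s) x ((Pd x - k * Pv x) / sin x ^ 2)).
{ intros x Hx. pose proof (sin_pos x Hx).
  replace ((Pd x - k * Pv x) / sin x ^ 2) with (Pd x / sin x ^ 2 + k * (- Pv x / sin x ^ 2)) by (field; lra).
  apply (is_derive_plus D (fun s => k * V s)); [apply is_derive_D; [exact Hmu|lra]|].
  apply is_derive_scal. apply is_derive_V; lra. }
assert (A : D s2 + k * V s2 <= D s3 + k * V s3).
{ apply decreasing_between with (f := fun s => D s + k * V s) (f' := fun x => (Pd x - k * Pv x) / sin x ^ 2); [lra|intros; apply Hd; lra|].
  intros x Hx. pose proof (sin_pos x ltac:(lra)). pose proof (Pd_mon x s2 ltac:(lra) ltac:(lra) ltac:(lra)).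
  pose proof (Pv_mon x s2 ltac:(lra) ltac:(lra) ltac:(lra)).
  assert (0 <= (k * Pv x - Pd x) / sin x ^ 2) by (apply Rle_mult_inv_pos; [nra|apply pow_lt; lra]).
  unfold Rdiv in *. lra. }
assert (B : D s2 + k * V s2 <= D s1 + k * V s1).
{ apply increasing_between with (f := fun s => D s + k * V s) (f' := fun x => (Pd x - k * Pv x) / sin x ^ 2); [lra|intros; apply Hd; lra|].
  intros x Hx. pose proof (sin_pos x ltac:(lra)). pose proof (Pd_mon s2 x ltac:(lra) ltac:(lra) ltac:(lra)).
  pose proof (Pv_mon s2 x ltac:(lra) ltac:(lra) ltac:(lra)).
  apply Rle_mult_inv_pos; [nra|apply pow_lt; lra]. }
assert (V12 : V s1 <= V s2).
{ destruct (Req_dec s1 s2) as [->|]; [lra|]. left. apply V_decr; lra. }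
assert (V23 : V s2 <= V s3).
{ destruct (Req_dec s2 s3) as [->|]; [lra|]. left. apply V_decr; lra. }
assert ((D s2 - D s3) * (V s2 - V s1) <= k * (V s3 - V s2) * (V s2 - V s1)) by (apply Rmult_le_compat_r; lra).
assert (k * (V s2 - V s1) * (V s3 - V s2) <= (D s1 - D s2) * (V s3 - V s2)) by (apply Rmult_le_compat_r; lra).
lra.
Qed.

Let ps s := Y s ^ 2.
Lemma is_derive_ps s : is_derive ps s (- 2 * mu * ps s).
Proof.
unfold ps. evar_last; [apply (is_derive_pow Y 2), is_derive_Y|]. simpl. fold Y. ring.
Qed.
Lemma ps_exp s : ps s = exp (- (2 * mu * s)).
Proof. unfold ps, Y, Yc. rewrite <- Rsqr_pow2. unfold Rsqr. rewrite <- exp_plus. f_equal. ring. Qed.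
Lemma ps_lt1 s : 0 < s -> ps s < 1.
Proof. intros H. unfold ps. pose proof (Y_lt mu Hmu 0 s H). rewrite (Y_0 mu) in H0. pose proof (Yp s). fold Y in H0. nra. Qed.
Lemma ps_conv s : 0 <= s -> 2 * mu * s * ps s <= 1 - ps s.
Proof.
intros H. rewrite ps_exp. pose proof (exp_ineq1_le (2 * mu * s)) as E. pose proof (exp_pos (- (2 * mu * s))).
assert (exp (2 * mu * s) * exp (- (2 * mu * s)) = 1) by (rewrite <- exp_plus, Rplus_opp_r; apply exp_0).
nra.
Qed.

(** This says that [s * V s] is decreasing.  With [z = r * Y s] the inequality is
    affine in [z], hence enough to check at [z = 0] and [z = 1]. *)
Lemma sV_key s : 0 < s < PI -> V s * sin s ^ 2 <= s * Pv s.
Proof.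
intros Hs. pose proof (sin_pos s Hs) as S. pose proof (Yp s) as HY. pose proof (Y1 s ltac:(lra)) as HY1. pose proof rp.
replace (V s * sin s ^ 2) with ((V s * sin s) * sin s) by ring. unfold V. rewrite (V_num mu) by lra. fold r Y.
unfold Pv, Pvc. fold r Y.
set (z := r * Y s). assert (Hz : 0 <= z <= 1) by (unfold z; nra).
pose proof (sin_le s ltac:(lra)) as Ss. pose proof (COS_bound s) as Cs.
assert (A0 : 0 <= s - sin s * cos s + mu * sin s ^ 2).
{ assert (sin s * cos s <= sin s * 1) by (apply Rmult_le_compat_l; lra).
  assert (0 <= mu * sin s ^ 2) by (apply Rmult_le_pos; [lra|apply pow2_ge_0]). lra. }
assert (A1 : 0 <= (s - sin s) * (1 + cos s) + mu * sin s * (s + sin s)).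
{ apply Rplus_le_le_0_compat; [apply Rmult_le_pos; lra|]. apply Rmult_le_pos; [apply Rmult_le_pos|]; lra. }
assert (0 <= (1 - z) * (s - sin s * cos s + mu * sin s ^ 2)) by (apply Rmult_le_pos; lra).
assert (0 <= z * ((s - sin s) * (1 + cos s) + mu * sin s * (s + sin s))) by (apply Rmult_le_pos; lra).
lra.
Qed.

Let om s := V s * (1 - ps s).
Lemma exp_minus_cos_nonneg t : 0 <= t <= PI -> 0 <= exp (- (mu * t)) - cos t + mu * sin t.
Proof.
intros Ht.
assert (A : exp (mu * t) * (cos t - mu * sin t) <= exp (mu * 0) * (cos 0 - mu * sin 0)).
{ apply decreasing_between with (f' := fun t => - c * exp (mu * t) * sin t) (f := fun t => exp (mu * t) * (cos t - mu * sin t)); [lra| |].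
  - intros x _. auto_derive; [exact I|]. unfold c. ring.
  - intros x Hx. pose proof (sin_pos x ltac:(lra)). pose proof (exp_pos (mu * x)).
    assert (0 <= c * exp (mu * x) * sin x) by (apply Rmult_le_pos; [apply Rmult_le_pos; [unfold c; nra|]|]; lra). lra. }
rewrite Rmult_0_r, exp_0, cos_0, sin_0 in A.
rewrite exp_Ropp. pose proof (exp_pos (mu * t)).
apply Rmult_le_reg_l with (exp (mu * t)); [assumption|]. rewrite Rmult_0_r.
replace (exp (mu * t) * (/ exp (mu * t) - cos t + mu * sin t)) with (1 - exp (mu * t) * (cos t - mu * sin t)) by (field; lra).
lra.
Qed.

Lemma exp_quadratic_nonneg m : 0 <= m -> 0 <= (1 - 2 * m + 2 * m ^ 2) * exp (4 * m) - m * exp (2 * m) - (1 + m).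
Proof.
intros Hm.
assert (G : forall m, 0 <= m -> 0 <= (2 - 4 * m + 8 * m ^ 2) * exp (4 * m) - (1 + 2 * m) * exp (2 * m) - 1).
{ intros x Hx.
  replace 0 with ((2 - 4 * 0 + 8 * 0 ^ 2) * exp (4 * 0) - (1 + 2 * 0) * exp (2 * 0) - 1) by (rewrite !Rmult_0_r, exp_0; ring).
  apply increasing_between with (f' := fun m => (4 + 32 * m ^ 2) * exp (4 * m) - (4 + 4 * m) * exp (2 * m))
    (f := fun m => (2 - 4 * m + 8 * m ^ 2) * exp (4 * m) - (1 + 2 * m) * exp (2 * m) - 1); [exact Hx| |].
  - intros y _. auto_derive; [exact I|]. ring.
  - intros y Hy. replace (4 * y) with (2 * y + 2 * y) by ring. rewrite exp_plus.
    pose proof (exp_ineq1_le (2 * y)) as E. set (e := exp (2 * y)) in *.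
    replace ((4 + 32 * y ^ 2) * (e * e) - (4 + (2 * y + 2 * y)) * e) with (e * ((4 + 32 * y ^ 2) * e - (4 + 4 * y))) by ring.
    apply Rmult_le_pos; [lra|]. nra. }
replace 0 with ((1 - 2 * 0 + 2 * 0 ^ 2) * exp (4 * 0) - 0 * exp (2 * 0) - (1 + 0)) by (rewrite !Rmult_0_r, exp_0; ring).
apply increasing_between with (f' := fun m => (2 - 4 * m + 8 * m ^ 2) * exp (4 * m) - (1 + 2 * m) * exp (2 * m) - 1)
  (f := fun m => (1 - 2 * m + 2 * m ^ 2) * exp (4 * m) - m * exp (2 * m) - (1 + m)); [exact Hm| |].
- intros y _. auto_derive; [exact I|]. ring.
- intros y Hy. apply G. lra.
Qed.

Lemma numerator_at_ps_nonneg m C p : 0 <= m -> -1 <= C <= 1 -> 0 <= p -> p <= exp (- (2 * m)) ->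
  0 <= (1 - p) * (1 + p * C) - 2 * m * C + 2 * m ^ 2 - m * p * (1 + p).
Proof.
intros Hm HC Hp Hp1. set (e := exp (- (2 * m))) in *.
assert (He : 0 < e <= 1).
{ unfold e. split; [apply exp_pos|]. rewrite <- exp_0. apply exp_mono. lra. }
assert (A : (1 - e) * (1 + e * C) - 2 * m * C + 2 * m ^ 2 - m * e * (1 + e) <=
   (1 - p) * (1 + p * C) - 2 * m * C + 2 * m ^ 2 - m * p * (1 + p)).
{ assert (0 <= (e - p) * (1 - C * (1 - e - p) + m * (1 + e + p))); [|lra].
  apply Rmult_le_pos; [lra|]. assert (0 <= m * (1 + e + p)) by (apply Rmult_le_pos; lra).
  assert (C * (1 - e - p) <= 1); [|lra].
  destruct (Rle_dec 0 (1 - e - p)); nra. }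
eapply Rle_trans; [|exact A].
assert (A1 : 0 <= 1 - e ^ 2 - 2 * m + 2 * m ^ 2 - m * e - m * e ^ 2).
{ pose proof (exp_quadratic_nonneg m Hm) as F.
  assert (E1 : exp (2 * m) * e = 1) by (unfold e; rewrite <- exp_plus, Rplus_opp_r; apply exp_0).
  assert (E2 : exp (4 * m) * (e * e) = 1).
  { replace (4 * m) with (2 * m + 2 * m) by ring. rewrite exp_plus.
    replace (exp (2 * m) * exp (2 * m) * (e * e)) with ((exp (2 * m) * e) * (exp (2 * m) * e)) by ring. rewrite E1. ring. }
  assert (0 <= (e * e) * ((1 - 2 * m + 2 * m ^ 2) * exp (4 * m) - m * exp (2 * m) - (1 + m))) by (apply Rmult_le_pos; nra).
  replace ((e * e) * ((1 - 2 * m + 2 * m ^ 2) * exp (4 * m) - m * exp (2 * m) - (1 + m))) with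
    ((1 - 2 * m + 2 * m ^ 2) * (exp (4 * m) * (e * e)) - m * e * (exp (2 * m) * e) - (1 + m) * e ^ 2) in H by ring.
  rewrite E1, E2 in H. lra. }
assert (A2 : 0 <= (1 - e) ^ 2 + 2 * m + 2 * m ^ 2 - m * e - m * e ^ 2).
{ assert (0 <= m * (2 - e - e ^ 2)) by (apply Rmult_le_pos; nra). pose proof (pow2_ge_0 (1 - e)). pose proof (pow2_ge_0 m). lra. }
nra.
Qed.

(** This is the sign of the derivative of [V * (X ^ 2 - 1)].  Again it is affine in
    [z = r * Y s], and now checked at the ends [z = 0] and [z = ps s] of its range. *)
Lemma Pi_slope_sign s : 0 < s < PI -> 2 * mu * sin s * (cos s + r * Y s - mu * sin s) <= Pv s * (1 - ps s).
Proof.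
intros Hs. pose proof (sin_pos s Hs) as S. pose proof (COS_bound s) as Cs. pose proof (Y_range mu Hmu s Hs) as HY.
fold r Y in HY. pose proof (r_range mu Hmu) as Hr. fold r in Hr.
set (z := r * Y s). assert (Hz : 0 <= z <= ps s) by (unfold z, ps; nra).
assert (Hps : 0 < ps s < 1) by (split; [unfold ps; nra|apply ps_lt1; lra]).
assert (Z0 : 0 <= (1 - ps s) - 2 * mu * sin s * (cos s - mu * sin s)).
{ destruct (Rle_dec s (PI / 2)) as [h|h].
  - assert (A : forall t, 0 <= t <= PI / 2 -> 0 <= (1 - ps t) - 2 * mu * sin t * (cos t - mu * sin t)).
    { intros t Ht. replace 0 with ((1 - ps 0) - 2 * mu * sin 0 * (cos 0 - mu * sin 0)).
      2: { rewrite sin_0, ps_exp, Rmult_0_r, Ropp_0, exp_0. ring. }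
      apply increasing_between with (f' := fun t => 2 * mu * (exp (- (mu * (2 * t))) - cos (2 * t) + mu * sin (2 * t)))
        (f := fun t => (1 - ps t) - 2 * mu * sin t * (cos t - mu * sin t)); [lra| |].
      - intros x _. apply (is_derive_ext (fun t => (1 - exp (- (2 * mu * t))) - 2 * mu * sin t * (cos t - mu * sin t))).
        + intros y. rewrite ps_exp. reflexivity.
        + auto_derive; [exact I|]. rewrite cos_2a, sin_2a. replace (mu * (2 * x)) with (2 * mu * x) by ring. ring.
      - intros x Hx. pose proof (exp_minus_cos_nonneg (2 * x) ltac:(lra)). apply Rmult_le_pos; lra. }
    apply A. lra.
  - assert (cos s <= 0). { apply cos_le_0; lra. }
    assert (0 <= mu * sin s * (mu * sin s - cos s)). { apply Rmult_le_pos; [apply Rmult_le_pos; lra|]. assert (0 <= mu * sin s) by (apply Rmult_le_pos; lra). lra. }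
    lra. }
assert (Z1 : 0 <= (1 - ps s) * (1 + ps s * (cos s + mu * sin s)) - 2 * mu * sin s * (cos s + ps s - mu * sin s)).
{ pose proof (numerator_at_ps_nonneg (mu * sin s) (cos s) (ps s)) as F.
  replace ((1 - ps s) * (1 + ps s * (cos s + mu * sin s)) - 2 * mu * sin s * (cos s + ps s - mu * sin s)) with
   ((1 - ps s) * (1 + ps s * cos s) - 2 * (mu * sin s) * cos s + 2 * (mu * sin s) ^ 2 - mu * sin s * ps s * (1 + ps s)) by ring.
  apply F; [apply Rmult_le_pos; lra|lra|lra|].
  rewrite ps_exp. apply exp_mono. pose proof (sin_le s ltac:(lra)). nra. }
unfold Pv, Pvc. fold r Y. fold z.
set (p := ps s) in *.
assert (E : p * ((1 + z * (cos s + mu * sin s)) * (1 - p) - 2 * mu * sin s * (cos s + z - mu * sin s)) =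
  (p - z) * ((1 - p) - 2 * mu * sin s * (cos s - mu * sin s)) +
  z * ((1 - p) * (1 + p * (cos s + mu * sin s)) - 2 * mu * sin s * (cos s + p - mu * sin s))) by ring.
assert (0 <= (p - z) * ((1 - p) - 2 * mu * sin s * (cos s - mu * sin s))) by (apply Rmult_le_pos; lra).
assert (0 <= z * ((1 - p) * (1 + p * (cos s + mu * sin s)) - 2 * mu * sin s * (cos s + p - mu * sin s))) by (apply Rmult_le_pos; lra).
assert (0 <= (1 + z * (cos s + mu * sin s)) * (1 - p) - 2 * mu * sin s * (cos s + z - mu * sin s)); [|lra].
apply Rmult_le_reg_l with p; lra.
Qed.

Variable s0 : R.
Hypothesis Hs0 : 0 < s0 < PI.
Hypothesis HV0 : V s0 = 0.

Lemma V_nonneg s : 0 < s <= s0 -> 0 <= V s.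
Proof.
intros Hs. destruct (Req_dec s s0) as [->|]; [fold V; lra|].
pose proof (V_decr mu Hmu s s0 ltac:(lra) ltac:(lra) ltac:(lra)) as E. fold V in E. lra.
Qed.

Lemma U_decr s t : 0 < s -> s <= t -> t <= s0 -> U t <= U s.
Proof.
intros H1 H2 H3. apply decreasing_between with (fun s => - (q * X s * V s) / sin s); [lra| |].
- intros x Hx. apply is_derive_U; [exact Hmu|]. pose proof (sin_pos x ltac:(lra)); lra.
- intros x Hx. pose proof (sin_pos x ltac:(lra)). pose proof (V_nonneg x ltac:(lra)).
  pose proof (Xp x). pose proof qp.
  assert (0 <= q * X x * V x / sin x).
  { apply Rle_mult_inv_pos; [|lra]. apply Rmult_le_pos; [apply Rmult_le_pos|]; lra. }
  unfold Rdiv in *. lra.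
Qed.

(** [om] is the product of [s * V s] and [(1 - ps s) / s], which both decrease. *)
Lemma om_decr s t : 0 < s -> s <= t -> t <= s0 -> om t <= om s.
Proof.
intros H1 H2 H3.
apply decreasing_between with (fun s => - Pv s / sin s ^ 2 * (1 - ps s) + V s * (2 * mu * ps s)); [lra| |].
- intros x Hx. pose proof (sin_pos x ltac:(lra)). unfold om.
  evar_last; [apply (is_derive_mult V (fun s => 1 - ps s)); [apply is_derive_V; lra| |intros; apply Rmult_comm]|].
  + apply (is_derive_minus (fun _ => 1) ps); [apply is_derive_const|apply is_derive_ps].
  + unfold minus, plus, opp, zero, mult; simpl. fold Pv. ring.
- intros x Hx. pose proof (sin_pos x ltac:(lra)) as S. pose proof (sV_key x ltac:(lra)) as K.
  pose proof (V_nonneg x ltac:(lra)) as HV. pose proof (ps_conv x ltac:(lra)) as C. pose proof (ps_lt1 x ltac:(lra)).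
  assert (S2 : 0 < sin x ^ 2) by (apply pow_lt; lra).
  apply Rmult_le_reg_l with (x * sin x ^ 2); [apply Rmult_lt_0_compat; lra|]. rewrite Rmult_0_r.
  replace (x * sin x ^ 2 * (- Pv x / sin x ^ 2 * (1 - ps x) + V x * (2 * mu * ps x)))
    with (- (x * Pv x) * (1 - ps x) + V x * sin x ^ 2 * (2 * mu * x * ps x)) by (field; lra).
  assert (0 <= V x * sin x ^ 2) by (apply Rmult_le_pos; lra).
  assert (V x * sin x ^ 2 * (2 * mu * x * ps x) <= V x * sin x ^ 2 * (1 - ps x)) by (apply Rmult_le_compat_l; lra).
  assert (V x * sin x ^ 2 * (1 - ps x) <= x * Pv x * (1 - ps x)) by (apply Rmult_le_compat_r; lra).
  lra.
Qed.

End Curve2.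

Lemma exp_ge_taylor2 (x : R) : 0 <= x -> 1 + x + x ^ 2 / 2 <= exp x.
Proof. intros Hx. pose proof (exp_taylor_le 2 x Hx) as H. simpl in H. lra. Qed.

Section Curve3.
Variable mu : R.
Hypothesis Hmu : 0 < mu.
Let r := rc mu. Let q := qc mu. Let Y := Yc mu. Let X := Xc mu. Let V := Vc mu. Let D := Dc mu.
Let c := 1 + mu ^ 2.
Let Pv := Pvc mu. Let Pd := Pdc mu.
Variable s0 : R.
Hypothesis Hs0 : 0 < s0 < PI.
Hypothesis HV0 : V s0 = 0.
Let Xp s : 0 < X s := X_pos mu s.
Let Yp s : 0 < Y s := Y_pos mu s.
Let Y1 s (h : 0 <= s) : Y s <= 1 := eq_ind _ (fun z => Y s <= z) (Y_le mu Hmu 0 s h) _ (Y_0 mu).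
Let rp : 0 < r < 1 := r_range mu Hmu.
Let qp : 1 < q := q_range mu Hmu.
Let qr1 : q * r = 1 := qr_1 mu Hmu.
Let XY1 s : X s * Y s = 1 := XY_1 mu s.
Let ps s := Y s ^ 2.
Let Pi s := V s * (X s ^ 2 - 1).
Let N s := cos s + r * Y s - mu * sin s.

Lemma X2ps s : X s ^ 2 * ps s = 1.
Proof. unfold ps. replace (X s ^ 2 * Y s ^ 2) with ((X s * Y s) ^ 2) by ring. rewrite XY1. ring. Qed.

Lemma is_derive_Pi s : 0 < s < PI -> is_derive Pi s (- (Pv s * (X s ^ 2 - 1) - 2 * mu * X s ^ 2 * (sin s * N s)) / sin s ^ 2).
Proof.
intros Hs. pose proof (sin_pos s Hs) as S.
replace (- (Pv s * (X s ^ 2 - 1) - 2 * mu * X s ^ 2 * (sin s * N s)) / sin s ^ 2) with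
  (- Pv s / sin s ^ 2 * (X s ^ 2 - 1) + V s * (2 * mu * X s ^ 2 - 0)).
2: { replace (sin s * N s) with (V s * sin s ^ 2); [field; lra|].
  replace (V s * sin s ^ 2) with (sin s * (V s * sin s)) by ring. unfold V. rewrite (V_num mu) by lra. reflexivity. }
apply (is_derive_mult V (fun s => X s ^ 2 - 1)); [apply is_derive_V; lra| |intros; apply Rmult_comm].
apply (is_derive_minus (fun s => X s ^ 2) (fun _ => 1)); [|apply is_derive_cst].
evar_last; [apply (is_derive_pow X 2), is_derive_X|]. simpl. fold X. ring.
Qed.

Lemma Pi_decr s t : 0 < s -> s <= t -> t < PI -> Pi t <= Pi s.
Proof.
intros H1 H2 H3.
apply decreasing_between with (f' := fun s => - (Pv s * (X s ^ 2 - 1) - 2 * mu * X s ^ 2 * (sin s * N s)) / sin s ^ 2);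
 [lra|intros; apply is_derive_Pi; lra|].
intros x Hx. pose proof (sin_pos x ltac:(lra)) as S. pose proof (Pi_slope_sign mu Hmu x ltac:(lra)) as F.
cbv beta in F. change (Pvc mu x) with (Pv x) in F. change (rc mu) with r in F. change (Yc mu x) with (Y x) in F. pose proof (X2ps x) as E. pose proof (Xp x) as HX.
change (Y x ^ 2) with (ps x) in F.
assert (0 <= (Pv x * (X x ^ 2 - 1) - 2 * mu * X x ^ 2 * (sin x * N x)) / sin x ^ 2).
{ apply Rle_mult_inv_pos; [|apply pow_lt; lra].
  replace (Pv x * (X x ^ 2 - 1) - 2 * mu * X x ^ 2 * (sin x * N x)) with
   (X x ^ 2 * (Pv x * (1 - ps x) - 2 * mu * sin x * N x) + Pv x * (X x ^ 2 * ps x - 1)) by ring.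
  rewrite E. assert (0 <= X x ^ 2 * (Pv x * (1 - ps x) - 2 * mu * sin x * N x)) by (apply Rmult_le_pos; [apply pow2_ge_0|unfold N; lra]). lra. }
unfold Rdiv in *. lra.
Qed.

(** [Phi] is the numerator of the derivative of [Pi + D].  It vanishes at 0 and its
    own derivative is a positive multiple of the bracket [Hb], which is studied
    further on. *)
Section Bracket.
Hypothesis Hb : forall x, 0 < x <= s0 -> 0 <= q + r - (1 + r) * ps x - 4 * mu * X x * sin x.
Let Phi s := Pd s - (Pv s * (X s ^ 2 - 1) - 2 * mu * X s ^ 2 * (sin s * N s)).
Lemma is_derive_Phi s : is_derive Phi s (c * sin s * X s * (q + r - (1 + r) * ps s - 4 * mu * X s * sin s)).
Proof.
replace (c * sin s * X s * (q + r - (1 + r) * ps s - 4 * mu * X s * sin s)) with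
 (c * sin s * (q * X s - Y s) - ((- c * (r * Y s) * sin s * (X s ^ 2 - 1) + Pv s * (2 * mu * X s ^ 2 - 0))
   - (2 * mu * (2 * mu * X s ^ 2) * (sin s * N s) + 2 * mu * X s ^ 2 * (cos s * N s + sin s * (- sin s + r * (- mu * Y s) - mu * cos s))))).
- assert (HX2 : is_derive (fun s => X s ^ 2) s (2 * mu * X s ^ 2)).
  { evar_last; [apply (is_derive_pow X 2), is_derive_X|]. simpl. fold X. ring. }
  apply (is_derive_minus Pd (fun s => Pv s * (X s ^ 2 - 1) - 2 * mu * X s ^ 2 * (sin s * N s))); [apply is_derive_Pd; exact Hmu|].
  apply (is_derive_minus (fun s => Pv s * (X s ^ 2 - 1)) (fun s => 2 * mu * X s ^ 2 * (sin s * N s))).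
  + apply (is_derive_mult Pv (fun s => X s ^ 2 - 1)); [apply is_derive_Pv| |intros; apply Rmult_comm].
    apply (is_derive_minus (fun s => X s ^ 2) (fun _ => 1)); [exact HX2|apply is_derive_cst].
  + apply (is_derive_mult (fun s => 2 * mu * X s ^ 2) (fun s => sin s * N s)); [apply is_derive_scal; exact HX2| |intros; apply Rmult_comm].
    apply (is_derive_mult sin N); [apply is_derive_sin| |intros; apply Rmult_comm].
    apply (is_derive_minus (fun s => cos s + r * Y s) (fun s => mu * sin s)); [|apply is_derive_scal, is_derive_sin].
    apply (is_derive_plus cos (fun s => r * Y s)); [apply is_derive_cos|apply is_derive_scal, is_derive_Y].
- unfold Pv, Pvc, N, ps. fold r Y.
  pose proof (XY1 s) as E. assert (EY : Y s = / X s). { pose proof (Xp s). field_simplify_eq; lra. }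
  rewrite EY. pose proof (Xp s). apply Rminus_diag_uniq.
  match goal with |- ?e = 0 => transitivity (2 * mu * X s ^ 2 * ((sin s ^ 2 + cos s ^ 2) - 1)) end.
  + unfold c. field. lra.
  + rewrite (sin_sq s). ring.
Qed.

Lemma PiD_incr s t : 0 < s -> s <= t -> t <= s0 -> Pi s + D s <= Pi t + D t.
Proof.
intros H1 H2 H3.
assert (HPhi : forall x, 0 <= x <= s0 -> 0 <= Phi x).
{ intros x Hx. assert (E0 : Phi 0 = 0).
  { unfold Phi, Pd, Pdc. change (Xc mu 0) with (X 0). change (Yc mu 0) with (Y 0).
    assert (EX : X 0 = 1) by (pose proof (XY1 0) as E; unfold Y in E; rewrite (Y_0 mu) in E; lra).
    rewrite EX, sin_0, cos_0. unfold Y. rewrite (Y_0 mu). ring. }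
  rewrite <- E0. apply increasing_between with (f' := fun s => c * sin s * X s * (q + r - (1 + r) * ps s - 4 * mu * X s * sin s));
   [lra|intros; apply is_derive_Phi|].
  intros y Hy. pose proof (sin_pos y ltac:(lra)). pose proof (Xp y). specialize (Hb y ltac:(lra)).
  apply Rmult_le_pos; [|exact Hb]. apply Rmult_le_pos; [apply Rmult_le_pos|]; try lra. unfold c; nra. }
apply increasing_between with (f := fun s => Pi s + D s) (f' := fun s => Phi s / sin s ^ 2); [lra| |].
- intros x Hx. pose proof (sin_pos x ltac:(lra)).
  replace (Phi x / sin x ^ 2) with (- (Pv x * (X x ^ 2 - 1) - 2 * mu * X x ^ 2 * (sin x * N x)) / sin x ^ 2 + Pd x / sin x ^ 2)
    by (unfold Phi; field; lra).
  apply (is_derive_plus Pi D); [apply is_derive_Pi; lra|apply is_derive_D; [exact Hmu|lra]].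
- intros x Hx. pose proof (sin_pos x ltac:(lra)). apply Rle_mult_inv_pos; [apply HPhi; lra|apply pow_lt; lra].
Qed.
End Bracket.

Lemma rc_half : r * c <= (1 + r) / 2.
Proof.
assert (E : 1 + 2 * mu ^ 2 <= q).
{ unfold q, qc, rc. rewrite exp_Ropp, Rinv_inv. pose proof PI_bounds.
  pose proof (exp_ge_taylor2 (mu * PI) ltac:(nra)) as E. assert (0 <= mu * PI) by nra.
  assert (mu ^ 2 * 4 <= mu ^ 2 * PI ^ 2) by (apply Rmult_le_compat_l; [apply pow2_ge_0|nra]). nra. }
pose proof rp. pose proof qr1.
assert (r * (1 + 2 * mu ^ 2) <= r * q) by (apply Rmult_le_compat_l; lra). unfold c. lra.
Qed.

(** The derivative of [V] is at most that of [(1 + r) / s].  Since [Y <= 1], [Pv]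
    decreases more slowly than [c * r * cos s]; as [r * c <= (1 + r) / 2], this
    leaves [(1 + r) * cos (s / 2) ^ 2], and the claim is [sin h <= h] at
    [h = s / 2]. *)
Lemma Pv_steep s : 0 < s < PI -> (1 + r) * sin s ^ 2 <= s ^ 2 * Pv s.
Proof.
intros Hs.
assert (A : (1 + r) - c * r * (1 - cos s) <= Pv s).
{ assert (Pv 0 - (1 + r - c * r * (1 - cos 0)) <= Pv s - (1 + r - c * r * (1 - cos s))).
  2: { unfold Pv in H at 1. unfold Pvc in H. change (rc mu) with r in H. rewrite (Y_0 mu), cos_0, sin_0 in H. lra. }
  apply increasing_between with (f := fun s => Pv s - (1 + r - c * r * (1 - cos s)))
    (f' := fun s => - c * (r * Y s) * sin s - (0 - c * r * sin s)); [lra| |].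
  - intros x _. apply (is_derive_minus Pv); [apply is_derive_Pv|]. auto_derive; [exact I|]. ring.
  - intros x Hx. pose proof (sin_pos x ltac:(lra)). pose proof (Y1 x ltac:(lra)). pose proof rp.
    replace (- c * (r * Y x) * sin x - (0 - c * r * sin x)) with (c * r * sin x * (1 - Y x)) by ring.
    apply Rmult_le_pos; [|lra]. apply Rmult_le_pos; [|lra]. apply Rmult_le_pos; [unfold c; nra|lra]. }
set (h := s / 2). assert (Es : s = 2 * h) by (unfold h; field).
pose proof rc_half as RC. pose proof (sin_pos h ltac:(unfold h; lra)) as Sh. pose proof (sin_le h ltac:(unfold h; lra)) as Lh.
assert (B : (1 + r) * cos h ^ 2 <= Pv s).
{ assert (E1 : 1 - cos s = 2 * (1 - cos h ^ 2)) by (rewrite Es, cos_2a_cos; ring).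
  assert (0 <= 1 - cos h ^ 2) by (rewrite <- sin_sq; apply pow2_ge_0).
  assert (c * r * (1 - cos s) <= (1 + r) * (1 - cos h ^ 2)) by nra. lra. }
replace (sin s) with (2 * sin h * cos h) by (rewrite Es; symmetry; apply sin_2a).
assert (C : (1 + r) * cos h ^ 2 * s ^ 2 <= Pv s * s ^ 2) by (apply Rmult_le_compat_r; [apply pow2_ge_0|exact B]).
assert ((2 * sin h) ^ 2 <= s ^ 2) by (rewrite Es; nra).
assert (0 <= (1 + r) * cos h ^ 2) by (apply Rmult_le_pos; [pose proof rp; lra|apply pow2_ge_0]). nra.
Qed.

Lemma V_slope s t : 0 < s -> s <= t -> t < PI -> (1 + r) * (t - s) <= (V s - V t) * (s * t).
Proof.
intros H1 H2 H3.
assert (A : V t - (1 + r) / t <= V s - (1 + r) / s).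
{ apply decreasing_between with (f := fun s => V s - (1 + r) / s) (f' := fun s => - Pv s / sin s ^ 2 - (- (1 + r) / s ^ 2)); [lra| |].
  - intros x Hx. pose proof (sin_pos x ltac:(lra)). apply (is_derive_minus V); [apply is_derive_V; lra|].
    auto_derive; [lra|]. field. lra.
  - intros x Hx. pose proof (sin_pos x ltac:(lra)) as S. pose proof (Pv_steep x ltac:(lra)).
    apply Rmult_le_reg_r with (x ^ 2 * sin x ^ 2); [apply Rmult_lt_0_compat; apply pow_lt; lra|].
    rewrite Rmult_0_l. replace ((- Pv x / sin x ^ 2 - - (1 + r) / x ^ 2) * (x ^ 2 * sin x ^ 2)) with ((1 + r) * sin x ^ 2 - x ^ 2 * Pv x) by (field; lra). lra. }
replace ((1 + r) * (t - s)) with (((1 + r) / s - (1 + r) / t) * (s * t)) by (field; lra).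
apply Rmult_le_compat_r; [apply Rmult_le_pos; lra|lra].
Qed.

(** The function [ps] is convex in [s], so its chords from [s] are at most
    [(1 - ps s) / s] steep on either side; those of [V] are at least
    [(1 + r) / (s * t)] steep. *)
Lemma ps_lip_w s t : 0 < s <= s0 -> 0 < t <= s0 ->
  Rabs (ps t - ps s) <= s0 / (1 + r) * (1 - ps s) * Rabs (V t - V s).
Proof.
assert (Main : forall s t a, 0 < s -> s <= t -> t <= s0 -> (a = s \/ a = t) ->
   ps s - ps t <= s0 / (1 + r) * (1 - ps a) * (V s - V t)).
{ intros x y a H1 H2 H3 Ha. pose proof rp.
  pose proof (V_slope x y H1 H2 ltac:(lra)) as VS.
  assert (E : (ps x - ps y) * a <= (1 - ps a) * (y - x)).
  { assert (Hc : forall p p', ps p' - ps p <= 2 * mu * (p - p') * ps p').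
    { intros p p'. unfold ps, Y. fold (Yc mu p' ^ 2). change (Yc mu p ^ 2) with (Yc mu p ^ 2).
      rewrite (ps_exp mu p), (ps_exp mu p').
      replace (- (2 * mu * p)) with (- (2 * mu * p') + - (2 * mu * (p - p'))) by ring. rewrite exp_plus.
      pose proof (exp_ineq1_le (- (2 * mu * (p - p')))). pose proof (exp_pos (- (2 * mu * p'))). nra. }
    destruct Ha as [-> | ->].
    - pose proof (Hc y x) as C1. pose proof (ps_conv mu x ltac:(lra)) as C2. cbv beta in C2. change (Yc mu x ^ 2) with (ps x) in C2.
      assert ((ps x - ps y) * x <= 2 * mu * (y - x) * ps x * x) by (apply Rmult_le_compat_r; lra).
      assert (2 * mu * x * ps x * (y - x) <= (1 - ps x) * (y - x)) by (apply Rmult_le_compat_r; lra). lra.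
    - pose proof (Hc y x) as C1. pose proof (Hc x 0) as C2.
      assert (P0 : ps 0 = 1) by (unfold ps, Y; rewrite (Y_0 mu); ring). rewrite P0 in C2.
      assert (C3 : 1 - ps x >= 2 * mu * x * ps x) by (pose proof (ps_conv mu x ltac:(lra)) as C3; cbv beta in C3; change (Yc mu x ^ 2) with (ps x) in C3; lra).
      assert ((ps x - ps y) * x <= 2 * mu * (y - x) * ps x * x) by (apply Rmult_le_compat_r; lra).
      assert (2 * mu * x * ps x * (y - x) <= (1 - ps x) * (y - x)) by (apply Rmult_le_compat_r; lra). lra. }
  assert (0 <= V x - V y).
  { destruct (Req_dec x y) as [->|]; [lra|]. pose proof (V_decr mu Hmu x y ltac:(lra) ltac:(lra) ltac:(lra) : V y < V x). lra. }
  assert (HW : 0 <= 1 - ps a).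
  { assert (0 < a) by (destruct Ha as [-> | ->]; lra). pose proof (ps_lt1 mu Hmu a H4) as P. cbv beta in P. change (Yc mu a ^ 2) with (ps a) in P. lra. }
  assert (Hm : (1 + r) * ((ps x - ps y) * a) <= (1 - ps a) * ((V x - V y) * (x * y))).
  { apply Rle_trans with ((1 - ps a) * ((1 + r) * (y - x))); [|apply Rmult_le_compat_l; lra].
    replace ((1 - ps a) * ((1 + r) * (y - x))) with ((1 + r) * ((1 - ps a) * (y - x))) by ring. apply Rmult_le_compat_l; lra. }
  apply Rmult_le_reg_l with ((1 + r) * a); [apply Rmult_lt_0_compat; [lra|destruct Ha as [-> | ->]; lra]|].
  replace ((1 + r) * a * (s0 / (1 + r) * (1 - ps a) * (V x - V y))) with ((1 - ps a) * ((V x - V y) * (a * s0))) by (field; lra).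
  rewrite Rmult_assoc, (Rmult_comm a). apply Rle_trans with (1 := Hm).
  apply Rmult_le_compat_l; [lra|]. apply Rmult_le_compat_l; [lra|]. destruct Ha as [-> | ->]; nra. }
intros Hs Ht.
assert (mono : forall x y, 0 < x -> x <= y -> y <= s0 -> V y <= V x /\ ps y <= ps x).
{ intros x y h1 h2 h3. destruct (Req_dec x y) as [->|]; [lra|]. split.
  - left. apply V_decr; [exact Hmu|lra..].
  - unfold ps. pose proof (Y_le mu Hmu x y h2 : Y y <= Y x). pose proof (Yp y). pose proof (Yp x). nra. }
destruct (Rle_dec s t) as [h|h].
- destruct (mono s t ltac:(lra) h ltac:(lra)). rewrite (Rabs_left1 (ps t - ps s)), (Rabs_left1 (V t - V s)) by lra.
  pose proof (Main s t s ltac:(lra) h ltac:(lra) (or_introl eq_refl)). lra.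
- destruct (mono t s ltac:(lra) ltac:(lra) ltac:(lra)). rewrite (Rabs_pos_eq (ps t - ps s)), (Rabs_pos_eq (V t - V s)) by lra.
  pose proof (Main t s s ltac:(lra) ltac:(lra) ltac:(lra) (or_intror eq_refl)). lra.
Qed.
End Curve3.

(** * Numerical bounds along the landing curve *)

Lemma exp_ge_taylor45 (x : R) : 0 <= x ->
  1 + x + x ^ 2 / 2 + x ^ 3 / 6 + x ^ 4 / 24 <= exp x /\
  1 + x + x ^ 2 / 2 + x ^ 3 / 6 + x ^ 4 / 24 + x ^ 5 / 120 <= exp x.
Proof.
intros Hx. pose proof (exp_taylor_le 4 x Hx) as H4. pose proof (exp_taylor_le 5 x Hx) as H5.
simpl in H4, H5. split; lra.
Qed.

(** [(P - 4 * m) * Q - 1] with its denominators cleared, where [P] and [Q] are the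
    Taylor polynomials of degrees 5 and 4 of the exponential at [1.57 * m] and
    [3.57 * m]. *)
Definition exp_gap_poly m :=
  (12 * 10 ^ 10 * 10 + 12 * 157 * 10 ^ 8 * 10 * m + 6 * 157 ^ 2 * 10 ^ 6 * 10 * m ^ 2 + 2 * 157 ^ 3 * 10 ^ 4 * 10 * m ^ 3
     + 5 * 157 ^ 4 * 10 ^ 2 * m ^ 4 + 157 ^ 5 * m ^ 5 - 4 * m * (120 * 10 ^ 10)) *
  (24 * 10 ^ 8 + 24 * 357 * 10 ^ 6 * m + 12 * 357 ^ 2 * 10 ^ 4 * m ^ 2 + 4 * 357 ^ 3 * 10 ^ 2 * m ^ 3 + 357 ^ 4 * m ^ 4)
  - 120 * 10 ^ 10 * 24 * 10 ^ 8.

Lemma exp_gap_poly_pos m : 0 <= m -> 0 <= exp_gap_poly m.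
Proof.
intros Hm. destruct (Rle_dec m 1) as [h|h].
- (* The polynomial comes close to 0 inside the interval, so that its Bernstein
     coefficients are nonnegative only after a degree elevation. *)
  assert (E : 0 <= (m + (1 - m)) ^ 30 * exp_gap_poly m).
  { unfold exp_gap_poly. assert (H1 : 0 <= m <= 1) by lra. Bernstein.prove_nonneg m m m m. }
  replace (m + (1 - m)) with 1 in E by ring. rewrite pow1 in E. lra.
- (* All the coefficients at 1 are nonnegative. *)
  set (t := m - 1). assert (Ht : 0 <= t) by (unfold t; lra).
  replace m with (1 + t) by (unfold t; ring). clearbody t. clear h Hm.
  unfold exp_gap_poly.
  assert (H2 : 0 <= t ^ 2) by (apply pow_le; lra). assert (H3 : 0 <= t ^ 3) by (apply pow_le; lra).
  assert (H4 : 0 <= t ^ 4) by (apply pow_le; lra). assert (H5 : 0 <= t ^ 5) by (apply pow_le; lra).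
  assert (H6 : 0 <= t ^ 6) by (apply pow_le; lra). assert (H7 : 0 <= t ^ 7) by (apply pow_le; lra).
  assert (H8 : 0 <= t ^ 8) by (apply pow_le; lra). assert (H9 : 0 <= t ^ 9) by (apply pow_le; lra).
  lra.
Qed.

(** The constants are lower approximations of [PI / 2] and [PI / 2 + 2]. *)
Lemma linear_le_exp_gap m : 0 <= m -> 4 * m <= exp (157/100 * m) - exp (- (357/100 * m)).
Proof.
intros Hm. pose proof (exp_gap_poly_pos m Hm) as S.
pose proof (proj2 (exp_ge_taylor45 (157/100 * m) ltac:(lra))) as E1.
pose proof (proj1 (exp_ge_taylor45 (357/100 * m) ltac:(lra))) as E2.
set (Q := 1 + 357 / 100 * m + (357 / 100 * m) ^ 2 / 2 + (357 / 100 * m) ^ 3 / 6 + (357 / 100 * m) ^ 4 / 24) in *.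
assert (HQ : 1 <= Q).
{ unfold Q. assert (0 <= 357/100 * m) by lra.
  assert (0 <= (357/100 * m) ^ 2) by (apply pow_le; lra). assert (0 <= (357/100 * m) ^ 3) by (apply pow_le; lra).
  assert (0 <= (357/100 * m) ^ 4) by (apply pow_le; lra). lra. }
pose proof (exp_le_inv (357/100 * m) Q ltac:(lra) E2) as E3.
set (P := 1 + 157 / 100 * m + (157 / 100 * m) ^ 2 / 2 + (157 / 100 * m) ^ 3 / 6 + (157 / 100 * m) ^ 4 / 24 + (157 / 100 * m) ^ 5 / 120) in *.
assert (1 <= (P - 4 * m) * Q).
{ replace (exp_gap_poly m) with (120 * 10 ^ 10 * 24 * 10 ^ 8 * ((P - 4 * m) * Q - 1)) in S by (unfold exp_gap_poly, P, Q; field). lra. }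
assert (/ Q <= P - 4 * m).
{ apply Rmult_le_reg_r with Q; [lra|]. rewrite Rinv_l; lra. }
lra.
Qed.

(** The sine is below its tangent at [2 * PI / 3], of slope [- 1 / 2], which is close
    to the maximum of [s * sin s]; the product with [s] is then a parabola. *)
Lemma mul_sin_le s : 0 <= s <= PI -> s * sin s <= 184/100.
Proof.
intros Hs. pose proof PI_bounds as HP.
assert (S3 : sin (2 * (PI / 3)) <= 8661/10000).
{ rewrite sin_2PI3.
  assert (sqrt 3 <= 17322/10000). { apply Rsqr_incr_0_var; [|lra]. rewrite Rsqr_sqrt by lra. unfold Rsqr. lra. } lra. }
assert (C3 : cos (2 * (PI / 3)) = - 1 / 2) by apply cos_2PI3.
set (a := 2 * (PI / 3)) in *.
assert (T : sin s <= sin a - (s - a) / 2).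
{ assert (0 <= sin a - (s - a) / 2 - sin s); [|lra].
  replace 0 with (sin a - (a - a) / 2 - sin a) by field.
  assert (Hd : forall x, is_derive (fun s => sin a - (s - a) / 2 - sin s) x (- 1 / 2 - cos x)).
  { intros x. auto_derive; [exact I|]. field. }
  destruct (Rle_dec s a) as [h|h].
  - apply decreasing_between with (f := fun s => sin a - (s - a) / 2 - sin s) (f' := fun x => - 1 / 2 - cos x); [lra|intros; apply Hd|].
    intros x Hx. assert (cos a <= cos x); [|lra]. left. apply cos_decreasing_1; unfold a in *; lra.
  - apply increasing_between with (f := fun s => sin a - (s - a) / 2 - sin s) (f' := fun x => - 1 / 2 - cos x); [lra|intros; apply Hd|].
    intros x Hx. assert (cos x <= cos a); [|lra]. left. apply cos_decreasing_1; unfold a in *; lra. }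
assert (Ha : a <= 21/10) by (unfold a; lra).
assert (sin s <= 19161/10000 - s / 2) by lra.
assert (s * sin s <= s * (19161/10000 - s / 2)) by (apply Rmult_le_compat_l; lra).
pose proof (pow2_ge_0 (s - 19161/10000)). nra.
Qed.

Section Curve4.
Variable mu : R.
Hypothesis Hmu : 0 < mu.
Let r := rc mu. Let q := qc mu. Let Y := Yc mu. Let X := Xc mu. Let V := Vc mu. Let U := Uc mu.
Let c := 1 + mu ^ 2.
Variable s0 : R.
Hypothesis Hs0 : 0 < s0 < PI.
Hypothesis HV0 : V s0 = 0.
Let Xp s : 0 < X s := X_pos mu s.
Let Yp s : 0 < Y s := Y_pos mu s.
Let X1 s : 0 <= s -> 1 <= X s := X_ge1 mu Hmu s.
Let Y1 s (h : 0 <= s) : Y s <= 1 := eq_ind _ (fun z => Y s <= z) (Y_le mu Hmu 0 s h) _ (Y_0 mu).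
Let rp : 0 < r < 1 := r_range mu Hmu.
Let qp : 1 < q := q_range mu Hmu.
Let qr1 : q * r = 1 := qr_1 mu Hmu.
Let XY1 s : X s * Y s = 1 := XY_1 mu s.
Let ps s := Y s ^ 2.

Lemma s0_le s : 0 < s < PI -> cos s + r * Y s <= mu * sin s -> s0 <= s.
Proof.
intros Hs H. apply Rnot_lt_le. intros h.
pose proof (V_decr mu Hmu s s0 ltac:(lra) h ltac:(lra) : V s0 < V s) as E.
pose proof (sin_pos s Hs). pose proof (V_num mu s ltac:(lra)) as N. fold V r in N. change (Yc mu s) with (Y s) in N.
assert (0 < V s * sin s) by (apply Rmult_lt_0_compat; lra). lra.
Qed.

Lemma q_exp : q = exp (mu * PI).
Proof. unfold q, qc, rc. rewrite exp_Ropp, Rinv_inv. reflexivity. Qed.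
Lemma X_exp s : X s = exp (mu * s).
Proof. unfold X, Xc, Yc. rewrite exp_Ropp, Rinv_inv. reflexivity. Qed.
Lemma rY_exp s : r * Y s = exp (- (mu * (PI + s))).
Proof. unfold r, rc, Y, Yc. rewrite <- exp_plus. f_equal. ring. Qed.

(** The zero [s0] of [V] tends to [PI] when [mu] tends to 0.  The two thresholds
    [0.15] and [0.28] locate it for the numerical bounds. *)
Lemma s0_half : 28/100 <= mu -> s0 <= PI / 2.
Proof.
intros H. pose proof PI_bounds as HP. apply s0_le; [lra|]. rewrite cos_PI2, sin_PI2, rY_exp.
set (x := mu * (PI + PI / 2)). assert (Hx : 13188/10000 <= x) by (unfold x; nra).
pose proof (proj1 (exp_ge_taylor45 x ltac:(lra))) as E.
assert (Ex : 36/10 <= exp x).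
{ eapply Rle_trans; [|exact E]. clearbody x. clear E.
  assert (17392/10000 <= x ^ 2) by nra. assert (22936/10000 <= x ^ 3) by nra. assert (30246/10000 <= x ^ 4) by nra. lra. }
pose proof (exp_le_inv x (36/10) ltac:(lra) Ex). lra.
Qed.
Lemma s0_two_thirds : 15/100 <= mu -> s0 <= 2 * (PI / 3).
Proof.
intros H. pose proof PI_bounds as HP. apply s0_le; [lra|]. rewrite cos_2PI3, rY_exp.
assert (S : 8/10 <= sin (2 * (PI / 3))).
{ rewrite sin_2PI3. assert (16/10 <= sqrt 3); [|lra]. apply Rsqr_incr_0_var; [|apply sqrt_pos]. rewrite Rsqr_sqrt by lra. unfold Rsqr. lra. }
set (x := mu * (PI + 2 * (PI / 3))). assert (Hx : 78/100 <= x) by (unfold x; nra).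
pose proof (exp_ineq1_le x) as E.
pose proof (exp_le_inv x (178/100) ltac:(lra) ltac:(lra)). nra.
Qed.

(** At [s0] one has [mu * sin s0 = cos s0 + r * Y s0], which eliminates the
    cosine. *)
Lemma U0_formula : r ^ 2 * U s0 = c * (r * X s0) * sin s0.
Proof.
pose proof (sin_pos s0 Hs0) as S. pose proof (U_num mu s0 ltac:(lra)) as EU. pose proof (V_num mu s0 ltac:(lra)) as EV.
fold V in EV. rewrite HV0 in EV. fold U q in EU. fold r in EV. change (Yc mu s0) with (Y s0) in EV. change (Xc mu s0) with (X s0) in EU.
apply Rmult_eq_reg_r with (sin s0); [|lra].
transitivity (r ^ 2 * (U s0 * sin s0)); [ring|]. rewrite EU.
assert (M : mu * sin s0 = cos s0 + r * Y s0) by lra.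
replace (c * (r * X s0) * sin s0 * sin s0) with (r * X s0 * (sin s0 ^ 2 + (mu * sin s0) ^ 2)) by (unfold c; ring).
rewrite M, sin_sq.
replace (r * X s0 * (1 - cos s0 ^ 2 + (cos s0 + r * Y s0) ^ 2)) with
 (r * X s0 + 2 * r ^ 2 * cos s0 * (X s0 * Y s0) + r ^ 3 * Y s0 * (X s0 * Y s0)) by ring.
rewrite XY1.
replace (r ^ 2 * (cos s0 + q * X s0 + (cos s0 + r * Y s0))) with (2 * r ^ 2 * cos s0 + r * (q * r) * X s0 + r ^ 3 * Y s0) by ring.
rewrite qr1. ring.
Qed.
Lemma rX0_exp : r * X s0 = exp (- (mu * (PI - s0))).
Proof. rewrite X_exp. unfold r, rc. rewrite <- exp_plus. f_equal. ring. Qed.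

(** By [U0_formula] the claim is
    [s0 * sin s0 * c * exp (- mu * (PI - s0)) < 13 / 10 * (1 + r)].  For [mu] below
    0.15 the exponential is bounded by 1; between 0.15 and 0.28 [s0] is at most
    [2 * PI / 3], beyond that at most [PI / 2], and the exponential compensates for
    the growth of [c]. *)
Lemma weighted_slope_bound : r ^ 2 * U s0 * (s0 / (1 + r)) < 13/10.
Proof.
pose proof PI_bounds as HP. pose proof rp as Hr.
assert (A : s0 * sin s0 * (c * (r * X s0)) < 13/10 * (1 + r)).
{ rewrite rX0_exp. pose proof (mul_sin_le s0 ltac:(lra)) as S. pose proof (sin_pos s0 Hs0) as S'.
  assert (S0 : 0 < s0 * sin s0) by (apply Rmult_lt_0_compat; lra).
  pose proof (exp_pos (- (mu * (PI - s0)))) as Ep.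
  assert (Hc : 0 < c) by (unfold c; nra).
  destruct (Rle_dec mu (15/100)) as [h1|h1]; [|destruct (Rle_dec mu (28/100)) as [h2|h2]].
  - assert (c <= 10225/10000) by (unfold c; nra).
    assert (exp (- (mu * (PI - s0))) <= 1).
    { rewrite <- exp_0. apply exp_mono. assert (0 <= mu * (PI - s0)) by (apply Rmult_le_pos; lra). lra. }
    assert (5275/10000 <= r).
    { unfold r, rc. pose proof (proj1 (exp_neg_bounds (mu * PI) ltac:(nra))). nra. }
    assert (c * exp (- (mu * (PI - s0))) <= c * 1) by (apply Rmult_le_compat_l; lra).
    assert (s0 * sin s0 * (c * exp (- (mu * (PI - s0)))) <= 184/100 * (10225/10000)).
    { apply Rmult_le_compat; try lra. apply Rmult_le_pos; lra. }
    lra.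
  - pose proof (s0_two_thirds ltac:(lra)) as S2.
    assert (c <= 109/100) by (unfold c; nra).
    assert (exp (- (mu * (PI - s0))) <= / (1157/1000)).
    { apply exp_le_inv; [lra|]. pose proof (exp_ineq1_le (mu * (PI - s0))). nra. }
    assert (36/100 <= r).
    { apply Rle_trans with (exp (- (945/1000))).
      - pose proof (proj2 (proj2 (exp_neg_bounds (945/1000) ltac:(lra)))). lra.
      - unfold r, rc. apply exp_mono. nra. }
    assert (c * exp (- (mu * (PI - s0))) <= 109/100 * / (1157/1000)) by (apply Rmult_le_compat; lra).
    assert (s0 * sin s0 * (c * exp (- (mu * (PI - s0)))) <= 184/100 * (109/100 * / (1157/1000))).
    { apply Rmult_le_compat; try lra. apply Rmult_le_pos; lra. }
    lra.
  - pose proof (s0_half ltac:(lra)) as S2.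
    set (p := 1 + 157/100 * mu + (157/100 * mu) ^ 2 / 2).
    assert (Hp : 0 < p) by (unfold p; nra).
    assert (exp (- (mu * (PI - s0))) <= / p).
    { apply exp_le_inv; [exact Hp|]. eapply Rle_trans; [apply exp_ge_taylor2; lra|]. apply exp_mono. nra. }
    assert (s0 * sin s0 <= 1575/1000).
    { pose proof (SIN_bound s0). nra. }
    assert (s0 * sin s0 * (c * exp (- (mu * (PI - s0)))) <= 1575/1000 * (c * / p)).
    { apply Rmult_le_compat; try lra. apply Rmult_le_pos; lra. apply Rmult_le_compat_l; lra. }
    assert (1575/1000 * (c * / p) < 13/10); [|lra].
    apply Rmult_lt_reg_r with p; [exact Hp|].
    replace (1575 / 1000 * (c * / p) * p) with (1575/1000 * c) by (field; lra).
    unfold c, p. nra. }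
rewrite U0_formula. apply Rmult_lt_reg_r with (1 + r); [lra|].
replace (c * (r * X s0) * sin s0 * (s0 / (1 + r)) * (1 + r)) with (s0 * sin s0 * (c * (r * X s0))) by (field; lra).
exact A.
Qed.

(** The bracket at [s = 1] with [X s * sin s] replaced by its upper bound
    [exp (mu * PI / 2)]. *)
Lemma bracket_majorant : 4 * mu * exp (mu * (PI / 2)) <= q + r - (1 + r) * exp (- (2 * mu)).
Proof.
pose proof PI_bounds as HP. pose proof (linear_le_exp_gap mu ltac:(lra)) as S.
set (p := exp (mu * (PI / 2))). assert (Eq : q = p * p) by (unfold p; rewrite q_exp, <- exp_plus; f_equal; field).
assert (Hp0 : exp (157/100 * mu) <= p) by (unfold p; apply exp_mono; nra).
pose proof (exp_pos (157/100 * mu)) as P0.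
assert (He : 0 < exp (- (2 * mu)) < 1).
{ split; [apply exp_pos|]. rewrite <- exp_0. apply exp_increasing. lra. }
set (e := exp (- (2 * mu))) in *. set (p0 := exp (157/100 * mu)) in *.
assert (E3 : exp (- (357/100 * mu)) = e / p0).
{ unfold e, p0, Rdiv. rewrite <- exp_Ropp, <- exp_plus. f_equal. field. }
rewrite E3 in S.
assert (e / p <= e / p0). { apply Rmult_le_compat_l; [lra|]. apply Rinv_le_contravar; lra. }
assert (p * (4 * mu) <= p * (p - e / p)) by (apply Rmult_le_compat_l; lra).
replace (p * (p - e / p)) with (q - e) in H0 by (rewrite Eq; field; lra).
pose proof rp. assert (0 <= r * (1 - e)) by (apply Rmult_le_pos; lra). lra.
Qed.

(** For [s <= PI / 2] one has [X s * sin s <= exp (mu * PI / 2) * min (s, 1)].  For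
    [s >= 1] the inequality is [bracket_majorant]; below, convexity of [ps] makes it a
    combination of [bracket_majorant] and of the value [q - 1] at [s = 0].  The range
    [s > PI / 2] occurs only for [mu < 0.28], where [ps s <= r] and
    [X s * sin s <= 1.2 * exp (mu * PI / 2)]. *)
Lemma bracket_nonneg s : 0 < s <= s0 -> 0 <= q + r - (1 + r) * ps s - 4 * mu * X s * sin s.
Proof.
intros Hs. pose proof PI_bounds as HP. pose proof rp as Hr. pose proof qp as Hq.
pose proof (sin_pos s ltac:(lra)) as S. pose proof (SIN_bound s) as S1. pose proof (sin_le s ltac:(lra)) as S2.
pose proof (Xp s) as HX.
assert (EP : ps s = exp (- (2 * mu * s))) by apply (ps_exp mu s).
destruct (Rle_dec s (PI / 2)) as [h|h].
- pose proof bracket_majorant as ST. set (p := exp (mu * (PI / 2))) in *.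
  assert (Hp : X s <= p) by (unfold p; rewrite X_exp; apply exp_mono; nra).
  destruct (Rle_dec 1 s) as [h1|h1].
  + assert (ps s <= exp (- (2 * mu))) by (rewrite EP; apply exp_mono; nra).
    assert (X s * sin s <= p * 1) by (apply Rmult_le_compat; lra).
    assert (4 * mu * (X s * sin s) <= 4 * mu * (p * 1)) by (apply Rmult_le_compat_l; lra).
    assert ((1 + r) * ps s <= (1 + r) * exp (- (2 * mu))) by (apply Rmult_le_compat_l; lra). lra.
  + assert (CV : ps s <= (1 - s) + s * exp (- (2 * mu))).
    { rewrite EP. set (a := - (2 * mu)). replace (- (2 * mu * s)) with (a * s) by (unfold a; ring).
      pose proof (exp_ineq1_le (- (a * s))) as E1. pose proof (exp_ineq1_le (a - a * s)) as E2.
      pose proof (exp_pos (a * s)) as E0.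
      assert (exp (a * s) * (1 + - (a * s)) <= 1).
      { replace 1 with (exp (a * s) * exp (- (a * s))) at 2 by (rewrite <- exp_plus, Rplus_opp_r; apply exp_0). apply Rmult_le_compat_l; lra. }
      assert (exp (a * s) * (1 + (a - a * s)) <= exp a).
      { replace (exp a) with (exp (a * s) * exp (a - a * s)) by (rewrite <- exp_plus; f_equal; ring). apply Rmult_le_compat_l; lra. }
      nra. }
    assert (X s * sin s <= p * s) by (apply Rmult_le_compat; lra).
    assert (4 * mu * (X s * sin s) <= 4 * mu * (p * s)) by (apply Rmult_le_compat_l; lra).
    assert ((1 + r) * ps s <= (1 + r) * ((1 - s) + s * exp (- (2 * mu)))) by (apply Rmult_le_compat_l; lra).
    assert (s * (4 * mu * p) <= s * (q + r - (1 + r) * exp (- (2 * mu)))) by (apply Rmult_le_compat_l; lra).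
    assert (0 <= (1 - s) * (q - 1)) by (apply Rmult_le_pos; lra). lra.
- assert (Hm : mu < 28/100). { apply Rnot_le_lt. intros h2. pose proof (s0_half h2). lra. }
  set (u := s - PI / 2). assert (Hu : 0 <= u <= PI / 2) by (unfold u; lra).
  set (p := exp (mu * (PI / 2))).
  assert (E1 : X s * sin s <= 12/10 * p).
  { rewrite X_exp. replace (mu * s) with (mu * (PI / 2) + mu * u) by (unfold u; ring). rewrite exp_plus. fold p.
    replace (sin s) with (cos u) by (unfold u; rewrite cos_minus, cos_PI2, sin_PI2; ring).
    assert (0 < p) by apply exp_pos.
    assert (exp (mu * u) * cos u <= 12/10); [|nra].
    assert (cos u <= 12/10 * exp (- (mu * u))).
    { pose proof (proj1 (exp_neg_bounds (mu * u) ltac:(nra))). pose proof (cos_le_quartic u ltac:(lra)).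
      assert (mu * u <= 28/100 * u) by (apply Rmult_le_compat_r; lra).
      assert (u <= 1575/1000) by lra.
      assert (u ^ 4 <= (1575/1000) ^ 2 * u ^ 2). { replace (u ^ 4) with (u ^ 2 * u ^ 2) by ring. apply Rmult_le_compat_r; [apply pow2_ge_0|]. nra. }
      nra. }
    assert (exp (mu * u) * cos u <= exp (mu * u) * (12/10 * exp (- (mu * u)))) by (apply Rmult_le_compat_l; [left; apply exp_pos|lra]).
    assert (exp (mu * u) * exp (- (mu * u)) = 1) by (rewrite <- exp_plus, Rplus_opp_r; apply exp_0). lra. }
  assert (E2 : ps s <= r).
  { rewrite EP. unfold r, rc. apply exp_mono. nra. }
  assert (E3 : 48/10 * mu * p <= q - r ^ 2).
  { assert (Eq : q = p * p) by (unfold p; rewrite q_exp, <- exp_plus; f_equal; field).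
    pose proof (exp_ge_taylor2 (157/100 * mu) ltac:(lra)) as P1.
    assert (P2 : exp (157/100 * mu) <= p) by (unfold p; apply exp_mono; nra).
    pose proof (exp_ge_taylor2 (785/100 * mu) ltac:(lra)) as P3.
    assert (P0 : 0 < p) by apply exp_pos.
    assert (R2 : r ^ 2 = p * exp (- (mu * (5 * (PI / 2))))).
    { unfold r, rc, p. rewrite <- exp_plus, <- Rsqr_pow2. unfold Rsqr. rewrite <- exp_plus. f_equal. field. }
    set (Q := 1 + 785 / 100 * mu + (785 / 100 * mu) ^ 2 / 2) in *.
    assert (HQ : 0 < Q) by (unfold Q; nra).
    assert (R3 : exp (- (mu * (5 * (PI / 2)))) <= / Q).
    { apply exp_le_inv; [exact HQ|]. eapply Rle_trans; [exact P3|]. apply exp_mono.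
      replace (mu * (5 * (PI / 2))) with (5 / 2 * PI * mu) by field. apply Rmult_le_compat_r; lra. }
    assert (R4 : / Q <= 1 + 157/100 * mu + (157/100 * mu) ^ 2 / 2 - 48/10 * mu).
    { apply Rmult_le_reg_r with Q; [exact HQ|]. rewrite Rinv_l by lra.
      assert (C : 0 <= 46/10 + 66/10 * mu - 90 * mu ^ 2 + 37 * mu ^ 3).
      { set (m := mu / (28/100)). assert (Em : mu = 28/100 * m) by (unfold m; field).
        assert (Hm1 : 0 <= m <= 1) by lra.
        assert (B : 0 <= 4600 + 1848 * m - 7056 * m ^ 2 + 812 * m ^ 3) by Bernstein.prove_nonneg m m m m.
        assert (0 <= m ^ 3) by (apply pow_le; lra). rewrite Em. lra. }
      assert (0 <= mu * (46/10 + 66/10 * mu - 90 * mu ^ 2 + 37 * mu ^ 3)) by (apply Rmult_le_pos; lra).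
      assert (0 <= mu ^ 2) by (apply pow_le; lra). assert (0 <= mu ^ 3) by (apply pow_le; lra). assert (0 <= mu ^ 4) by (apply pow_le; lra).
      unfold Q. lra. }
    rewrite Eq, R2.
    assert (0 <= p * (p - exp (- (mu * (5 * (PI / 2)))) - 48/10 * mu)) by (apply Rmult_le_pos; lra). lra. }
  assert (4 * mu * (X s * sin s) <= 4 * mu * (12/10 * p)) by (apply Rmult_le_compat_l; lra).
  assert ((1 + r) * ps s <= (1 + r) * r) by (apply Rmult_le_compat_l; lra). lra.
Qed.

(** The derivative of [ps] with respect to [V] is
    [2 * mu * Y s * sin s / (r * U s)]. *)
Lemma ps_lip_K J : 0 < J -> (forall s, 0 < s <= s0 -> 2 * mu * Y s * sin s * (r * U s0) <= J * U s) ->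
  forall s t, 0 < s <= s0 -> 0 < t <= s0 -> Rabs (ps t - ps s) <= J / (r ^ 2 * U s0) * Rabs (V t - V s).
Proof.
intros HJ H. pose proof rp as Hr. pose proof (U_pos mu Hmu s0 Hs0 : 0 < U s0) as HU0.
assert (R2 : 0 < r ^ 2 * U s0) by (apply Rmult_lt_0_compat; [apply pow_lt|]; lra).
set (K := J / (r ^ 2 * U s0)). assert (HK : 0 < K) by (apply Rdiv_lt_0_compat; lra).
assert (Main : forall s t, 0 < s -> s <= t -> t <= s0 -> 0 <= ps s - ps t <= K * (V s - V t)).
{ intros s t H1 H2 H3. split.
  - unfold ps. pose proof (Y_le mu Hmu s t H2 : Y t <= Y s). pose proof (Yp t). nra.
  - assert (ps s - K * V s <= ps t - K * V t); [|lra].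
    apply increasing_between with (f := fun s => ps s - K * V s) (f' := fun s => - 2 * mu * ps s - K * (- Pvc mu s / sin s ^ 2)); [lra| |].
    + intros x Hx. pose proof (sin_pos x ltac:(lra)).
      apply (is_derive_minus ps (fun s => K * V s)); [apply is_derive_ps|apply is_derive_scal, is_derive_V; lra].
    + intros x Hx. pose proof (sin_pos x ltac:(lra)) as S. rewrite (Pv_U mu Hmu x) by lra. fold U r. change (Yc mu x) with (Y x).
      replace (- 2 * mu * ps x - K * (- (r * Y x * U x * sin x) / sin x ^ 2)) with
       (Y x / sin x * (K * (r * U x) - 2 * mu * Y x * sin x)) by (unfold ps; field; lra).
      apply Rmult_le_pos; [apply Rle_mult_inv_pos; [left; apply Yp|exact S]|].
      specialize (H x ltac:(lra)).
      assert (2 * mu * Y x * sin x <= K * (r * U x)); [|lra].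
      apply Rmult_le_reg_r with (r * U s0); [apply Rmult_lt_0_compat; lra|].
      replace (K * (r * U x) * (r * U s0)) with (J * U x) by (unfold K; field; lra). exact H. }
intros s t Hs Ht. destruct (Rle_dec s t) as [h|h].
- pose proof (Main s t ltac:(lra) h ltac:(lra)).
  rewrite (Rabs_left1 (ps t - ps s)) by lra.
  assert (0 <= V s - V t) by (apply Rmult_le_reg_l with K; lra). rewrite Rabs_left1 by lra. lra.
- pose proof (Main t s ltac:(lra) ltac:(lra) ltac:(lra)).
  rewrite (Rabs_pos_eq (ps t - ps s)) by lra.
  assert (0 <= V t - V s) by (apply Rmult_le_reg_l with K; lra). rewrite Rabs_pos_eq by lra. lra.
Qed.

(** [U ^ 2 - q ^ 2 * V ^ 2] decreases because [X >= Y]. *)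
Lemma energy s : 0 < s <= s0 -> U s0 ^ 2 + q ^ 2 * V s ^ 2 <= U s ^ 2.
Proof.
intros Hs.
assert (U s0 ^ 2 - q ^ 2 * V s0 ^ 2 <= U s ^ 2 - q ^ 2 * V s ^ 2).
{ apply decreasing_between with (f := fun s => U s ^ 2 - q ^ 2 * V s ^ 2)
   (f' := fun s => 2 * (- (q * X s * V s) / sin s) * U s - q ^ 2 * (2 * (- Pvc mu s / sin s ^ 2) * V s)); [lra| |].
  - intros x Hx. pose proof (sin_pos x ltac:(lra)).
    apply (is_derive_minus (fun s => U s ^ 2) (fun s => q ^ 2 * V s ^ 2)); [|apply is_derive_scal].
    + evar_last; [apply (is_derive_pow U 2), is_derive_U; [exact Hmu|lra]|]. simpl. fold q X V. ring.
    + evar_last; [apply (is_derive_pow V 2), is_derive_V; lra|]. simpl. ring.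
  - intros x Hx. pose proof (sin_pos x ltac:(lra)) as S. rewrite (Pv_U mu Hmu x) by lra. fold U r. change (Yc mu x) with (Y x).
    replace (2 * (- (q * X x * V x) / sin x) * U x - q ^ 2 * (2 * (- (r * Y x * U x * sin x) / sin x ^ 2) * V x)) with
     (- (2 * q * U x * V x / sin x * (X x - (q * r) * Y x))) by (field; lra).
    rewrite qr1. pose proof (X1 x ltac:(lra)). pose proof (Y1 x ltac:(lra)). pose proof qp.
    pose proof (U_pos mu Hmu x ltac:(lra) : 0 < U x). pose proof (V_nonneg mu Hmu s0 Hs0 HV0 x ltac:(lra) : 0 <= V x).
    assert (0 <= 2 * q * U x * V x / sin x * (X x - 1 * Y x)); [|lra].
    apply Rmult_le_pos; [|lra]. apply Rle_mult_inv_pos; [|lra]. repeat apply Rmult_le_pos; lra. }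
rewrite HV0 in H. lra.
Qed.

(** For [mu >= 1 / 8] the monotonicity of [U] suffices, with [J = 2 * mu * r].  For
    smaller [mu] this is too large, as [11 / 20 * (1 - r)] is close to
    [1.73 * mu].  Then [sin s] is expressed by [U] and [V] through
    [sin s * ((U s - mu) ^ 2 + 1) = q * X s * (U s + V s)]; the inequality of
    arithmetic and geometric means bounds the left factor by [U s] from below, and
    [energy] with the Cauchy-Schwarz inequality bounds [(U s + V s) * U s0]. *)
Lemma slope_bound : exists J : R, 0 < J < 11/20 * (1 - r) /\
  (forall s, 0 < s <= s0 -> 2 * mu * Y s * sin s * (r * U s0) <= J * U s).
Proof.
pose proof PI_bounds as HP. pose proof rp as Hr. pose proof (U_pos mu Hmu s0 Hs0 : 0 < U s0) as HU0.
destruct (Rle_dec (1/8) mu) as [h|h].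
- exists (2 * mu * r). split.
  + split; [repeat apply Rmult_lt_0_compat; lra|].
    assert (E : 1 + 314/100 * mu + (314/100 * mu) ^ 2 / 2 <= q).
    { eapply Rle_trans; [apply exp_ge_taylor2; lra|]. rewrite q_exp. apply exp_mono. nra. }
    assert ((2 * mu + 11/20) * r < 11/20 * (q * r)); [|rewrite qr1 in H; lra].
    rewrite <- Rmult_assoc. apply Rmult_lt_compat_r; [lra|]. nra.
  + intros s Hs. pose proof (U_decr mu Hmu s0 Hs0 HV0 s s0 ltac:(lra) ltac:(lra) ltac:(lra) : U s0 <= U s) as UD.
    pose proof (Y1 s ltac:(lra)). pose proof (Yp s). pose proof (SIN_bound s). pose proof (sin_pos s ltac:(lra)).
    assert (Y s * sin s <= 1 * 1) by (apply Rmult_le_compat; lra).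
    replace (2 * mu * Y s * sin s * (r * U s0)) with (2 * mu * r * (Y s * sin s * U s0)) by ring.
    replace (2 * mu * r * U s) with (2 * mu * r * (1 * U s)) by ring.
    apply Rmult_le_compat_l; [apply Rmult_le_pos; lra|]. apply Rmult_le_compat; try lra. apply Rmult_le_pos; lra.
- set (k := sqrt c). assert (Hc : 1 < c) by (unfold c; nra).
  assert (Hk : k * k = c) by (apply sqrt_sqrt; lra). assert (Hk0 : 0 <= k) by apply sqrt_pos.
  assert (Hk1 : 1 < k) by nra.
  assert (Hk2 : k <= 1 + mu ^ 2 / 2).
  { apply Rsqr_incr_0_var; [|nra]. unfold Rsqr. rewrite Hk. unfold c. assert (0 <= mu ^ 4) by (apply pow_le; lra). nra. }
  set (w := sqrt (1 + r ^ 2)). assert (Hw : w * w = 1 + r ^ 2) by (apply sqrt_sqrt; nra). assert (Hw0 : 0 <= w) by apply sqrt_pos.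
  assert (Hw1 : 1 < w) by nra.
  exists (mu * (k + mu) * w). split.
  + split; [repeat apply Rmult_lt_0_compat; lra|].
    set (rb := 1 - 314/100 * mu + (314/100 * mu) ^ 2 / 2).
    assert (Rb : r <= rb).
    { eapply Rle_trans; [|apply (proj1 (proj2 (exp_neg_bounds (314/100 * mu) ltac:(lra))))].
      unfold r, rc. apply exp_mono. nra. }
    assert (G : (k + mu) * w < 11/20 * (314/100 - 49298/10000 * mu)).
    { assert (P : 0 < 314/100 - 49298/10000 * mu) by lra.
      apply Rsqr_incrst_0; [|apply Rmult_le_pos; lra|lra]. unfold Rsqr.
      replace ((k + mu) * w * ((k + mu) * w)) with ((k + mu) ^ 2 * (1 + r ^ 2)) by (rewrite <- Hw; ring).
      apply Rle_lt_trans with ((1 + mu + mu ^ 2 / 2) ^ 2 * (1 + rb ^ 2)).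
      - apply Rmult_le_compat; [apply pow2_ge_0|nra|apply pow_incr; lra|]. assert (r ^ 2 <= rb ^ 2) by (apply pow_incr; lra). lra.
      - set (x := 8 * mu). assert (Hx : 0 <= x <= 1) by (unfold x; lra).
        assert (Em : mu = x / 8) by (unfold x; field).
        assert (B : 0 <= (11 * (125600 - 24649 * x) * 256) ^ 2
          - (128 + 16 * x + x ^ 2) ^ 2 * (1600000 ^ 2 + (5 * (320000 - 125600 * x + 24649 * x ^ 2)) ^ 2) - 20480000 ^ 2).
        { Bernstein.prove_nonneg x x x x. }
        assert (0 <= 204800000 ^ 2 * (11 / 20 * (314 / 100 - 49298 / 10000 * mu) * (11 / 20 * (314 / 100 - 49298 / 10000 * mu))
           - (1 + mu + mu ^ 2 / 2) ^ 2 * (1 + rb ^ 2) - 1/100)); [|lra].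
        eapply Rle_trans; [exact B|]. right. unfold rb. rewrite Em. field. }
    assert (mu * ((k + mu) * w) < mu * (11/20 * (314/100 - 49298/10000 * mu))) by (apply Rmult_lt_compat_l; lra).
    unfold rb in Rb. nra.
  + intros s Hs. pose proof (energy s Hs) as En. pose proof (U_pos mu Hmu s ltac:(lra) : 0 < U s) as HU.
    pose proof (V_nonneg mu Hmu s0 Hs0 HV0 s ltac:(lra) : 0 <= V s) as HV. pose proof (sin_pos s ltac:(lra)) as S.
    pose proof (U_num mu s ltac:(lra)) as NU. fold U q in NU. change (Xc mu s) with (X s) in NU.
    pose proof (V_num mu s ltac:(lra)) as NV. fold V r in NV. change (Yc mu s) with (Y s) in NV.
    set (Q := (U s - mu) ^ 2 + 1). assert (HQ : 0 < Q) by (unfold Q; pose proof (pow2_ge_0 (U s - mu)); lra).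
    assert (ES : sin s * Q = q * X s * (U s + V s)).
    { apply Rmult_eq_reg_r with (sin s); [|lra].
      replace (sin s * Q * sin s) with ((U s * sin s - mu * sin s) ^ 2 + sin s ^ 2) by (unfold Q; ring).
      replace (q * X s * (U s + V s) * sin s) with (q * X s * (U s * sin s + V s * sin s)) by ring.
      rewrite NU, NV, sin_sq.
      replace (q * X s * (cos s + q * X s + mu * sin s + (cos s + r * Y s - mu * sin s))) with
       (q * X s * (2 * cos s + q * X s) + (q * r) * (X s * Y s)) by ring. rewrite qr1, XY1. ring. }
    assert (QL : 2 * U s * (k - mu) <= Q).
    { unfold Q. pose proof (pow2_ge_0 (U s - k)). unfold c in Hk. nra. }
    assert (CS : (U s + V s) * U s0 <= U s ^ 2 * w).
    { apply Rsqr_incr_0_var; [|apply Rmult_le_pos; [apply pow2_ge_0|lra]]. unfold Rsqr.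
      set (W := q * V s). assert (EV : V s = r * W) by (unfold W; rewrite <- Rmult_assoc, (Rmult_comm r), qr1; ring).
      replace (U s ^ 2 * w * (U s ^ 2 * w)) with (U s ^ 4 * (1 + r ^ 2)) by (rewrite <- Hw; ring).
      replace ((U s + V s) * U s0 * ((U s + V s) * U s0)) with ((U s + V s) ^ 2 * U s0 ^ 2) by ring.
      assert (A1 : (U s + V s) ^ 2 <= (1 + r ^ 2) * (U s ^ 2 + W ^ 2)) by (rewrite EV; pose proof (pow2_ge_0 (r * U s - W)); nra).
      assert (A2 : U s0 ^ 2 <= U s ^ 2 - W ^ 2) by (unfold W; rewrite Rpow_mult_distr; lra).
      assert (A3 : 0 <= U s ^ 2 - W ^ 2) by (pose proof (pow2_ge_0 (U s0)); lra).
      apply Rle_trans with ((1 + r ^ 2) * (U s ^ 2 + W ^ 2) * (U s ^ 2 - W ^ 2)).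
      - apply Rmult_le_compat; try apply pow2_ge_0; lra.
      - assert (0 <= (1 + r ^ 2) * (W ^ 2 * W ^ 2)) by (repeat apply Rmult_le_pos; try apply pow2_ge_0; nra). nra. }
    apply Rmult_le_reg_r with Q; [exact HQ|].
    replace (2 * mu * Y s * sin s * (r * U s0) * Q) with (2 * mu * Y s * (r * U s0) * (sin s * Q)) by ring. rewrite ES.
    replace (2 * mu * Y s * (r * U s0) * (q * X s * (U s + V s))) with (2 * mu * (q * r) * (X s * Y s) * ((U s + V s) * U s0)) by ring.
    rewrite qr1, XY1.
    apply Rle_trans with (2 * mu * (U s ^ 2 * w)); [nra|].
    apply Rle_trans with (mu * (k + mu) * w * U s * (2 * U s * (k - mu))).
    * right. replace (mu * (k + mu) * w * U s * (2 * U s * (k - mu))) with (2 * mu * (U s ^ 2 * w) * (k * k - mu ^ 2)) by ring.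
      rewrite Hk. unfold c. ring.
    * apply Rmult_le_compat_l; [|exact QL]. repeat apply Rmult_le_pos; lra.
Qed.
End Curve4.

(** * Convergence of chains of landings *)

Section Vspace.
Variable mu : R.
Hypothesis Hmu : 0 < mu.
Let r := rc mu. Let q := qc mu. Let Y := Yc mu. Let V := Vc mu. Let U := Uc mu. Let D := Dc mu.
Variable s0 : R.
Hypothesis Hs0 : 0 < s0 < PI.
Hypothesis HV0 : V s0 = 0.
Let rp : 0 < r < 1 := r_range mu Hmu.
Let qp : 1 < q := q_range mu Hmu.

Lemma V_onto v : 0 <= v -> exists s, 0 < s <= s0 /\ V s = v.
Proof.
intros Hv.
set (s1 := Rmin s0 (Rmin 1 (/ (2 * (v + mu + 1))))).
assert (Hi : 0 < / (2 * (v + mu + 1))) by (apply Rinv_0_lt_compat; lra).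
assert (H1 : 0 < s1) by (unfold s1; repeat apply Rmin_glb_lt; lra).
assert (H2 : s1 <= s0) by apply Rmin_l.
assert (H3 : s1 <= 1) by (eapply Rle_trans; [apply Rmin_r|apply Rmin_l]).
assert (H4 : s1 <= / (2 * (v + mu + 1))) by (eapply Rle_trans; [apply Rmin_r|apply Rmin_r]).
pose proof PI_bounds as HP.
assert (Hbig : v < V s1).
{ pose proof (sin_pos s1 ltac:(lra)) as S. pose proof (sin_le s1 ltac:(lra)) as Sl.
  assert (C : 1 / 2 <= cos s1). { rewrite <- cos_PI3. left. apply cos_decreasing_1; lra. }
  pose proof (Y_pos mu s1). pose proof rp.
  assert (0 < r * Yc mu s1) by (apply Rmult_lt_0_compat; lra).
  assert ((v + mu + 1) * sin s1 <= 1 / 2).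
  { apply Rle_trans with ((v + mu + 1) * / (2 * (v + mu + 1))); [apply Rmult_le_compat_l; lra|]. right. field. lra. }
  apply Rmult_lt_reg_r with (sin s1); [exact S|]. unfold V. rewrite (V_num mu) by lra. fold r. lra. }
destruct (Req_dec v 0) as [->|Hv0]; [exists s0; split; [lra|exact HV0]|].
assert (s1 < s0). { destruct (Req_dec s1 s0) as [E|]; [rewrite E, HV0 in Hbig; lra|lra]. }
destruct (Ranalysis5.IVT_interv (fun s => v - V s) s1 s0) as (z & Hz & Ez).
- intros a Ha. apply continuity_pt_filterlim.
  apply (continuous_minus (fun _ => v) V); [apply continuous_const|].
  apply (ex_derive_continuous V). eexists. apply is_derive_V. pose proof (sin_pos a ltac:(lra)). lra.
- lra.
- lra.
- rewrite HV0. lra.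
- exists z. split; [lra|]. lra.
Qed.

(** The inverse of [V] on the nonnegative half-line. *)
Definition phase (v : R) : R := epsilon (inhabits 0) (fun s => 0 < s <= s0 /\ V s = v).
Lemma phase_spec v : 0 <= v -> 0 < phase v <= s0 /\ V (phase v) = v.
Proof. intros Hv. apply (epsilon_spec (inhabits 0) (fun s => 0 < s <= s0 /\ V s = v)). apply V_onto, Hv. Qed.
Lemma V_order s t : 0 < s <= s0 -> 0 < t <= s0 -> V s <= V t -> t <= s.
Proof.
intros Hs Ht H. apply Rnot_lt_le. intros h.
pose proof (V_decr mu Hmu s t ltac:(lra) h ltac:(lra) : V t < V s). lra.
Qed.
Lemma phase_V s : 0 < s <= s0 -> phase (V s) = s.
Proof.
intros Hs. pose proof (V_nonneg mu Hmu s0 Hs0 HV0 s Hs : 0 <= V s) as Hv.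
destruct (phase_spec _ Hv) as [A B]. apply Rle_antisym; apply V_order; auto; lra.
Qed.
Lemma phase_order v1 v2 : 0 <= v1 <= v2 -> phase v2 <= phase v1.
Proof.
intros Hv. destruct (phase_spec v1 ltac:(lra)) as [A1 B1]. destruct (phase_spec v2 ltac:(lra)) as [A2 B2].
apply V_order; auto. lra.
Qed.

(** Instance of the abstract recursion with [Df] and [ps] read along the landing
    curve as functions of [v = V s]; [s] decreases when [v] increases. *)
Theorem landing_chain_converges (H : R) (ss : R) (xn vn sn : nat -> R) :
  0 < ss <= s0 ->
  H * ((1 - r + r ^ 2) / r) < 1 ->
  H * (U ss + r ^ 2 * Y ss ^ 2 * V ss) = V ss + r ^ 2 * Y ss ^ 2 * U ss ->
  (forall n, 0 < sn n <= s0) -> (forall n, vn n = V (sn n)) ->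
  (forall n, xn (S n) = U (sn n)) ->
  (forall n, vn (S n) + r ^ 2 * Y (sn n) ^ 2 * xn n = H * (U (sn n) + r ^ 2 * Y (sn n) ^ 2 * vn n)) ->
  is_lim_seq xn (U ss) /\ is_lim_seq vn (V ss).
Proof.
intros Hss Hth Hfix Hsn Hvn Hxn Hrec.
set (Df v := D (phase v)). set (pv v := Y (phase v) ^ 2).
assert (HU : forall s, 0 < s <= s0 -> Df (V s) + / r * V s = U s).
{ intros s Hs. unfold Df. rewrite (phase_V s Hs). unfold D, Dc. fold U V. unfold qc. fold r. ring. }
assert (HP : forall s, 0 < s <= s0 -> pv (V s) = Y s ^ 2) by (intros s Hs; unfold pv; rewrite (phase_V s Hs); reflexivity).
assert (Hsg : forall v, 0 <= v -> 0 < phase v < PI) by (intros v Hv; destruct (phase_spec v Hv); lra).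
assert (EqU : forall v, 0 <= v -> Df v + q * v = U (phase v)).
{ intros v Hv. destruct (phase_spec v Hv) as [A B]. rewrite <- (HU _ A), B. reflexivity. }
assert (h1 : forall v, 0 <= v -> r ^ 2 <= pv v < 1).
{ intros v Hv. pose proof (Y_range mu Hmu _ (Hsg v Hv)) as HY. unfold pv. fold Y in HY.
  change (rc mu) with r in HY. pose proof rp. split; nra. }
assert (h2 : forall v, 0 <= v -> 0 < Df v) by (intros v Hv; apply D_pos; [exact Hmu|apply Hsg, Hv]).
assert (h3 : forall v1 v2, 0 <= v1 <= v2 -> 0 <= Df v1 - Df v2 <= / r * (v2 - v1)).
{ intros v1 v2 Hv. pose proof (phase_order v1 v2 Hv) as O.
  destruct (phase_spec v1 ltac:(lra)) as [A1 B1]. destruct (phase_spec v2 ltac:(lra)) as [A2 B2]. split.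
  - unfold Df. pose proof (D_incr mu Hmu (phase v2) (phase v1) ltac:(lra) O ltac:(lra) : D (phase v2) <= D (phase v1)). lra.
  - pose proof (U_decr mu Hmu s0 Hs0 HV0 (phase v2) (phase v1) ltac:(lra) O ltac:(lra) : U (phase v1) <= U (phase v2)) as HH.
    rewrite <- !EqU in HH by lra. change (/ r) with q. lra. }
assert (h4 : forall v1 v2 v3, 0 <= v1 <= v2 -> v2 <= v3 -> (Df v2 - Df v3) * (v2 - v1) <= (Df v1 - Df v2) * (v3 - v2)).
{ intros v1 v2 v3 H12 H23. pose proof (phase_order v1 v2 ltac:(lra)). pose proof (phase_order v2 v3 ltac:(lra)).
  destruct (phase_spec v1 ltac:(lra)) as [A1 B1]. destruct (phase_spec v2 ltac:(lra)) as [A2 B2]. destruct (phase_spec v3 ltac:(lra)) as [A3 B3].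
  pose proof (D_convex mu Hmu (phase v1) (phase v2) (phase v3) ltac:(lra) ltac:(lra) ltac:(lra) ltac:(lra)) as C.
  fold V D in C. rewrite B1, B2, B3 in C. exact C. }
assert (h5 : forall v1 v2, 0 <= v1 <= v2 -> v1 * (1 - pv v1) <= v2 * (1 - pv v2)).
{ intros v1 v2 Hv. pose proof (phase_order v1 v2 Hv).
  destruct (phase_spec v1 ltac:(lra)) as [A1 B1]. destruct (phase_spec v2 ltac:(lra)) as [A2 B2].
  pose proof (om_decr mu Hmu s0 Hs0 HV0 (phase v2) (phase v1) ltac:(lra) ltac:(lra) ltac:(lra)) as C. cbv beta in C. fold V Y in C.
  rewrite B1, B2 in C. exact C. }
assert (h6 : forall v1 v2, 0 <= v1 <= v2 ->
  0 <= v2 * (1 - pv v2) / pv v2 - v1 * (1 - pv v1) / pv v1 <= Df v1 - Df v2).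
{ intros v1 v2 Hv. pose proof (phase_order v1 v2 Hv).
  destruct (phase_spec v1 ltac:(lra)) as [A1 B1]. destruct (phase_spec v2 ltac:(lra)) as [A2 B2].
  pose proof (Pi_decr mu Hmu (phase v2) (phase v1) ltac:(lra) ltac:(lra) ltac:(lra)) as C1.
  pose proof (PiD_incr mu Hmu s0 Hs0 (bracket_nonneg mu Hmu s0 Hs0 HV0) (phase v2) (phase v1) ltac:(lra) ltac:(lra) ltac:(lra)) as C2.
  cbv beta in C1, C2. fold V D in C1, C2. rewrite B1, B2 in C1, C2. fold (Df v1) (Df v2) in C2.
  assert (E : forall v, v * (1 - pv v) / pv v = v * (Xc mu (phase v) ^ 2 - 1)).
  { intros v. unfold pv, Xc. fold Y. pose proof (Y_pos mu (phase v)) as HY. fold Y in HY. field. lra. }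
  rewrite !E. lra. }
assert (h7 : forall v1 v2, 0 <= v1 -> 0 <= v2 -> Rabs (pv v2 - pv v1) <= s0 / (1 + r) * (1 - pv v1) * Rabs (v2 - v1)).
{ intros v1 v2 Hv1 Hv2. destruct (phase_spec v1 Hv1) as [A1 B1]. destruct (phase_spec v2 Hv2) as [A2 B2].
  pose proof (ps_lip_w mu Hmu s0 Hs0 (phase v1) (phase v2) A1 A2) as C. cbv beta in C. fold V Y in C. rewrite B1, B2 in C. exact C. }
destruct (slope_bound mu Hmu s0 Hs0 HV0) as (J & HJ & HJs).
change (rc mu) with r in HJ, HJs.
pose proof (U_pos mu Hmu s0 Hs0 : 0 < U s0) as HU0.
assert (R2 : 0 < r ^ 2 * U s0) by (apply Rmult_lt_0_compat; [apply pow_lt|]; pose proof rp; lra).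
assert (h8 : forall v1 v2, 0 <= v1 -> 0 <= v2 -> Rabs (pv v2 - pv v1) <= J / (r ^ 2 * U s0) * Rabs (v2 - v1)).
{ intros v1 v2 Hv1 Hv2. destruct (phase_spec v1 Hv1) as [A1 B1]. destruct (phase_spec v2 Hv2) as [A2 B2].
  pose proof (ps_lip_K mu Hmu s0 Hs0 J ltac:(lra) HJs (phase v1) (phase v2) A1 A2) as C. cbv beta in C. fold V Y in C. rewrite B1, B2 in C. exact C. }
assert (h9 : forall v1 v2, 0 <= v1 <= v2 -> pv v1 <= pv v2).
{ intros v1 v2 Hv. pose proof (phase_order v1 v2 Hv) as O. pose proof (Y_le mu Hmu _ _ O). pose proof (Y_pos mu (phase v1)).
  unfold pv. apply pow_incr. unfold Y. lra. }
assert (D00 : Df 0 = U s0).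
{ pose proof (HU s0 ltac:(lra)) as E. rewrite HV0, Rmult_0_r, Rplus_0_r in E. exact E. }
pose proof rp as Hr.
assert (hvs : 0 <= V ss) by (apply (V_nonneg mu Hmu s0 Hs0 HV0); lra).
assert (hvn : forall n, 0 <= vn n) by (intros n; rewrite Hvn; apply (V_nonneg mu Hmu s0 Hs0 HV0); auto).
assert (Ess : U ss = Df (V ss) + / r * V ss) by (symmetry; apply HU, Hss).
rewrite Ess.
apply (chain_limit r H Df pv (s0 / (1 + r)) (J / (r ^ 2 * U s0)) (V ss)); auto.
- rewrite D00. split; [apply Rle_mult_inv_pos; lra|]. apply (weighted_slope_bound mu Hmu s0 Hs0 HV0).
- rewrite D00. split; [apply Rle_mult_inv_pos; lra|].
  replace (r ^ 2 * U s0 * (J / (r ^ 2 * U s0))) with J by (field; lra). lra.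
- rewrite (HP ss Hss), <- Ess. exact Hfix.
- intros n. rewrite Hxn, Hvn. symmetry. apply HU, Hsn.
- intros n. pose proof (Hrec n) as R. rewrite (Hvn n) at 2. rewrite !(Hvn n) in R |- *. rewrite (HP _ (Hsn n)). rewrite (HU _ (Hsn n)). exact R.
Qed.
End Vspace.

(** * The flow above the switching plane *)

Lemma is_derive_pair {V W : NormedModule R_AbsRing} (f : R -> V) (g : R -> W) s lf lg :
  is_derive f s lf -> is_derive g s lg -> is_derive (fun t => (f t, g t)) s (lf, lg).
Proof.
intros Hf Hg.
apply (filterdiff_comp'_2 f g (fun a b => (a, b)) s _ _ (fun a b => (a, b)) Hf Hg).
apply filterdiff_linear.
apply (is_linear_prod (fun t : V * W => fst t) (fun t => snd t)); [apply is_linear_fst|apply is_linear_snd].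
Qed.
Lemma is_derive_fst {V W : NormedModule R_AbsRing} (h : R -> V * W) s l :
  is_derive h s l -> is_derive (fun t => fst (h t)) s (fst l).
Proof.
intros Hh. apply (filterdiff_comp' h (fun t : V * W => fst t) s _ (fun t => fst t) Hh).
apply filterdiff_linear, is_linear_fst.
Qed.
Lemma is_derive_snd {V W : NormedModule R_AbsRing} (h : R -> V * W) s l :
  is_derive h s l -> is_derive (fun t => snd (h t)) s (snd l).
Proof.
intros Hh. apply (filterdiff_comp' h (fun t : V * W => snd t) s _ (fun t => snd t) Hh).
apply filterdiff_linear, is_linear_snd.
Qed.

Lemma R3_eq (p q : R3) : xc p = xc q -> yc p = yc q -> zc p = zc q -> p = q.
Proof. destruct p as [[a b] d], q as [[a' b'] d']. unfold xc, yc, zc; simpl. intros; subst; reflexivity. Qed.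

Lemma const_of_derive_0 (f : R -> R) : (forall t, is_derive f t 0) -> forall a b, f a = f b.
Proof.
intros H. assert (A : forall a b, a <= b -> f a = f b).
{ intros a b Hab. apply Rle_antisym.
  - apply increasing_between with (f' := fun _ => 0); auto; intros; lra.
  - apply decreasing_between with (f' := fun _ => 0); auto; intros; lra. }
intros a b. destruct (Rle_dec a b); [auto|symmetry; apply A; lra].
Qed.

Section Flow.
Variables mu H : R.
Let c := 1 + mu ^ 2.

Lemma integral_curve_components psi : integral_curve (fieldX mu H) psi -> forall s,
  is_derive (fun t => xc (psi t)) s (- 2 * mu * xc (psi s) - H * (9 * mu ^ 2 + 1) * zc (psi s) + H) /\
  is_derive (fun t => yc (psi t)) s (2 * mu * yc (psi s) - c * zc (psi s) + 1) /\
  is_derive (fun t => zc (psi t)) s (yc (psi s)).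
Proof.
intros Hp s. specialize (Hp s). split; [|split].
- exact (is_derive_fst _ _ _ (is_derive_fst _ _ _ Hp)).
- exact (is_derive_snd _ _ _ (is_derive_fst _ _ _ Hp)).
- exact (is_derive_snd _ _ _ Hp).
Qed.

Lemma integral_curve_of_components (x y z : R -> R) :
  (forall s, is_derive x s (- 2 * mu * x s - H * (9 * mu ^ 2 + 1) * z s + H)) ->
  (forall s, is_derive y s (2 * mu * y s - c * z s + 1)) ->
  (forall s, is_derive z s (y s)) -> integral_curve (fieldX mu H) (fun s => (x s, y s, z s)).
Proof.
intros Hx Hy Hz s. unfold fieldX, xc, yc, zc; simpl fst; simpl snd.
apply (is_derive_pair (fun s => (x s, y s)) z s (_, _) _); [|apply Hz].
apply (is_derive_pair x y); [apply Hx|apply Hy].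
Qed.

Lemma integral_curve_shift V psi a : integral_curve V psi -> integral_curve V (fun s => psi (s + a)).
Proof.
intros Hp s.
assert (E : is_derive (fun s : R => s + a) s 1) by (auto_derive; [exact I|reflexivity]).
pose proof (is_derive_comp _ (fun s : R => s + a) s _ (one : R_AbsRing) (Hp (s + a)) E) as C.
exact (eq_ind _ (fun l => is_derive (V := prod_NormedModule R_AbsRing (prod_NormedModule R_AbsRing R_NormedModule R_NormedModule) R_NormedModule)
   (fun s => psi (s + a)) s l) C _ (scal_one (V := prod_NormedModule R_AbsRing (prod_NormedModule R_AbsRing R_NormedModule R_NormedModule) R_NormedModule) _)).
Qed.

(** The pair [(y, z)] obeys a linear system with rotation speed 1 about [z = / c] and
    growth rate [mu], and [x - H * y + 4 * mu * H * z] is an eigenfunction of rate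
    [- 2 * mu].  Undoing these motions gives three quantities constant along
    integral curves, which determine the point: this replaces the general
    uniqueness theorem for differential equations. *)
Let A z y t := exp (- (mu * t)) * ((z - / c) * cos t - (y - mu * (z - / c)) * sin t).
Let B z y t := exp (- (mu * t)) * ((z - / c) * sin t + (y - mu * (z - / c)) * cos t).
Let W x z y t := exp (2 * mu * t) * (x - H * y + 4 * mu * H * z).

Lemma c_pos : 0 < c. Proof. unfold c. nra. Qed.

Lemma first_integrals psi : integral_curve (fieldX mu H) psi -> forall s t,
  A (zc (psi s)) (yc (psi s)) s = A (zc (psi t)) (yc (psi t)) t /\
  B (zc (psi s)) (yc (psi s)) s = B (zc (psi t)) (yc (psi t)) t /\
  W (xc (psi s)) (zc (psi s)) (yc (psi s)) s = W (xc (psi t)) (zc (psi t)) (yc (psi t)) t.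
Proof.
intros Hp s t. pose proof (integral_curve_components psi Hp) as Hc.
set (x := fun t => xc (psi t)). set (y := fun t => yc (psi t)). set (z := fun t => zc (psi t)).
assert (Hx : forall s, is_derive x s (- 2 * mu * x s - H * (9 * mu ^ 2 + 1) * z s + H)) by apply Hc.
assert (Hy : forall s, is_derive y s (2 * mu * y s - c * z s + 1)) by apply Hc.
assert (Hz : forall s, is_derive z s (y s)) by apply Hc.
pose proof c_pos as Cp. clear Hc.
assert (Ex : forall s, ex_derive x s) by (intros; eexists; apply Hx).
assert (Ey : forall s, ex_derive y s) by (intros; eexists; apply Hy).
assert (Ez : forall s, ex_derive z s) by (intros; eexists; apply Hz).
assert (Dx : forall s, Derive (fun t => x t) s = - 2 * mu * x s - H * (9 * mu ^ 2 + 1) * z s + H) by (intros; apply is_derive_unique, Hx).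
assert (Dy : forall s, Derive (fun t => y t) s = 2 * mu * y s - c * z s + 1) by (intros; apply is_derive_unique, Hy).
assert (Dz : forall s, Derive (fun t => z t) s = y s) by (intros; apply is_derive_unique, Hz).
repeat split.
- apply (const_of_derive_0 (fun t => A (z t) (y t) t)). intros a. unfold A. auto_derive; [repeat split; auto|].
  rewrite Dy, Dz. unfold c in *. field. lra.
- apply (const_of_derive_0 (fun t => B (z t) (y t) t)). intros a. unfold B. auto_derive; [repeat split; auto|].
  rewrite Dy, Dz. unfold c in *. field. lra.
- apply (const_of_derive_0 (fun t => W (x t) (z t) (y t) t)). intros a. unfold W. auto_derive; [repeat split; auto|].
  rewrite Dx, Dy, Dz. unfold c in *. ring.
Qed.

Lemma integral_curve_unique psi phi s : integral_curve (fieldX mu H) psi -> integral_curve (fieldX mu H) phi ->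
  psi s = phi s -> forall t, psi t = phi t.
Proof.
intros Hp Hf E t.
destruct (first_integrals psi Hp s t) as (A1 & B1 & W1). destruct (first_integrals phi Hf s t) as (A2 & B2 & W2).
rewrite E in A1, B1, W1. rewrite A1 in A2. rewrite B1 in B2. rewrite W1 in W2. clear A1 B1 W1.
unfold A, B, W in *. pose proof (exp_pos (- (mu * t))) as P. pose proof (exp_pos (2 * mu * t)) as P2.
apply Rmult_eq_reg_l in A2; [|lra]. apply Rmult_eq_reg_l in B2; [|lra]. apply Rmult_eq_reg_l in W2; [|lra].
set (z1 := zc (psi t)) in *. set (z2 := zc (phi t)) in *. set (y1 := yc (psi t)) in *. set (y2 := yc (phi t)) in *.
pose proof (sin2_cos2 t) as SC. unfold Rsqr in SC.
set (Z := z1 - z2). set (Q := (y1 - y2) - mu * Z).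
assert (E1 : Z * cos t - Q * sin t = 0) by (unfold Q, Z; lra).
assert (E2 : Z * sin t + Q * cos t = 0) by (unfold Q, Z; lra).
assert (EZ : Z = 0).
{ replace Z with (Z * (sin t * sin t + cos t * cos t)) by (rewrite SC; ring).
  replace (Z * (sin t * sin t + cos t * cos t)) with ((Z * cos t - Q * sin t) * cos t + (Z * sin t + Q * cos t) * sin t) by ring.
  rewrite E1, E2. ring. }
assert (EQ : Q = 0).
{ replace Q with (Q * (sin t * sin t + cos t * cos t)) by (rewrite SC; ring).
  replace (Q * (sin t * sin t + cos t * cos t)) with ((Z * sin t + Q * cos t) * cos t - (Z * cos t - Q * sin t) * sin t) by ring.
  rewrite E1, E2. ring. }
assert (Ez : z1 = z2) by (unfold Z in EZ; lra).
assert (Ey : y1 = y2) by (unfold Q in EQ; rewrite EZ in EQ; lra).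
apply R3_eq; [|exact Ey|exact Ez].
rewrite Ey, Ez in W2. lra.
Qed.

Definition zfl (y t : R) : R := (1 - exp (mu * t) * (cos t - ((1 + mu ^ 2) * y + mu) * sin t)) / (1 + mu ^ 2).
Definition yfl (y t : R) : R := exp (mu * t) * (y * cos t + (1 + mu * y) * sin t).
Definition xfl (x y t : R) : R := exp (- (2 * mu * t)) * (x - H * y) + H * yfl y t - 4 * mu * H * zfl y t.
Definition flow (p : R * R) (t : R) : R3 := (xfl (fst p) (snd p) t, yfl (snd p) t, zfl (snd p) t).

Lemma is_derive_zfl y t : is_derive (zfl y) t (yfl y t).
Proof. unfold zfl, yfl. pose proof c_pos as Cp. auto_derive; [lra|]. unfold c in Cp. field. lra. Qed.
Lemma is_derive_yfl y t : is_derive (yfl y) t (2 * mu * yfl y t - c * zfl y t + 1).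
Proof. unfold zfl, yfl. pose proof c_pos as Cp. auto_derive; [exact I|]. unfold c in *. field. lra. Qed.
Lemma flow_integral_curve p : integral_curve (fieldX mu H) (flow p).
Proof.
apply integral_curve_of_components.
- intros s. unfold xfl.
  evar_last.
  + apply (is_derive_minus (fun t => exp (- (2 * mu * t)) * (fst p - H * snd p) + H * yfl (snd p) t) (fun t => 4 * mu * H * zfl (snd p) t)).
    * apply (is_derive_plus (fun t => exp (- (2 * mu * t)) * (fst p - H * snd p)) (fun t => H * yfl (snd p) t)).
      -- auto_derive; [exact I|reflexivity].
      -- apply is_derive_scal, is_derive_yfl.
    * apply is_derive_scal, is_derive_zfl.
  + unfold minus, plus, opp, scal; simpl. unfold mult; simpl. unfold c. ring.
- intros s. apply is_derive_yfl.
- intros s. apply is_derive_zfl.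
Qed.
Lemma flow_0 p : flow p 0 = to_Sigma p.
Proof.
unfold flow, xfl, yfl, zfl, to_Sigma. rewrite !Rmult_0_r, Ropp_0, exp_0, cos_0, sin_0. pose proof c_pos as Cp. unfold c in Cp.
f_equal; [f_equal|]; field; lra.
Qed.
Lemma flow_unique psi p : integral_curve (fieldX mu H) psi -> psi 0 = to_Sigma p -> forall t, psi t = flow p t.
Proof.
intros Hp E. apply (integral_curve_unique psi (flow p) 0 Hp (flow_integral_curve p)). rewrite E, flow_0. reflexivity.
Qed.
End Flow.

(** * The first return and the reduced map *)

Section Return.
Variables mu H : R.
Hypothesis Hmu : 0 < mu.
Let c := 1 + mu ^ 2.
Variable s0 : R.
Hypothesis Hs0 : 0 < s0 < PI.
Hypothesis HV0 : Vc mu s0 = 0.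
Let r := rc mu. Let Y := Yc mu. Let V := Vc mu. Let U := Uc mu.
Let cp : 0 < c. Proof. unfold c. nra. Qed.

Definition flight_time (y : R) : R := PI + phase mu s0 ((1 + mu ^ 2) * y).

Lemma flight_time_spec y : 0 <= y -> exists s, flight_time y = PI + s /\ 0 < s <= s0 /\ V s = c * y.
Proof.
intros Hy. exists (phase mu s0 (c * y)). split; [reflexivity|].
apply (phase_spec mu Hmu s0 Hs0 HV0). apply Rmult_le_pos; lra.
Qed.

Lemma zfl_PI y s : 0 < s < PI -> c * zfl mu y (PI + s) = exp (mu * (PI + s)) * sin s * (V s - c * y).
Proof.
intros Hs. pose proof (sin_pos s Hs) as S.
replace (exp (mu * (PI + s)) * sin s * (V s - c * y)) with
  (exp (mu * (PI + s)) * (V s * sin s - c * y * sin s)) by ring.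
unfold V. rewrite (V_num mu s) by lra. fold r Y. unfold Y, r. rewrite (rY_exp mu s).
unfold zfl. fold c.
replace (cos (PI + s)) with (- cos s) by (rewrite Rplus_comm, neg_cos; ring).
replace (sin (PI + s)) with (- sin s) by (rewrite Rplus_comm, neg_sin; ring).
assert (E : exp (mu * (PI + s)) * exp (- (mu * (PI + s))) = 1) by (rewrite <- exp_plus, Rplus_opp_r; apply exp_0).
field_simplify; [|lra]. rewrite E. ring.
Qed.

(** Up to time [PI] the height is increased by a positive launching ordinate, and is
    positive for a zero one; afterwards [zfl_PI] gives the sign of [V s - c * y]. *)
Lemma zfl_pos_before y t : 0 <= y -> 0 < t < flight_time y -> 0 < zfl mu y t.
Proof.
intros Hy Ht. destruct (flight_time_spec y Hy) as (s & Es & Hs & EV). rewrite Es in Ht.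
apply Rmult_lt_reg_l with c; [exact cp|]. rewrite Rmult_0_r.
destruct (Rle_dec t PI) as [h|h].
- pose proof (sin_ge_0 t ltac:(lra) ltac:(lra)) as S. pose proof (exp_pos (mu * t)) as P.
  assert (A : exp (mu * t) * (cos t - mu * sin t) < exp (mu * 0) * (cos 0 - mu * sin 0)).
  { apply strictly_decreasing_between with (f := fun t => exp (mu * t) * (cos t - mu * sin t))
      (f' := fun t => - (c * exp (mu * t) * sin t)); [lra| |].
    - intros x _. auto_derive; [exact I|]. unfold c. ring.
    - intros x Hx. pose proof (sin_pos x ltac:(lra)). pose proof (exp_pos (mu * x)).
      assert (0 < c * exp (mu * x) * sin x) by (repeat apply Rmult_lt_0_compat; auto). lra. }
  rewrite Rmult_0_r, exp_0, cos_0, sin_0 in A.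
  unfold zfl. fold c.
  replace (c * ((1 - exp (mu * t) * (cos t - (c * y + mu) * sin t)) / c)) with
    (1 - exp (mu * t) * (cos t - mu * sin t) + c * y * (exp (mu * t) * sin t)) by (field; lra).
  assert (0 <= c * y * (exp (mu * t) * sin t)) by (apply Rmult_le_pos; apply Rmult_le_pos; lra). lra.
- replace t with (PI + (t - PI)) by ring. rewrite zfl_PI by lra.
  pose proof (V_decr mu Hmu (t - PI) s ltac:(lra) ltac:(lra) ltac:(lra) : V s < V (t - PI)).
  apply Rmult_lt_0_compat; [apply Rmult_lt_0_compat; [apply exp_pos|apply sin_pos; lra]|lra].
Qed.
Lemma zfl_flight_time y : 0 <= y -> zfl mu y (flight_time y) = 0.
Proof.
intros Hy. destruct (flight_time_spec y Hy) as (s & Es & Hs & EV). rewrite Es.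
apply Rmult_eq_reg_l with c; [|lra]. rewrite zfl_PI by lra. rewrite EV. ring.
Qed.
Lemma flight_time_range y : 0 <= y -> PI < flight_time y < 2 * PI.
Proof. intros Hy. destruct (flight_time_spec y Hy) as (s & Es & Hs & EV). lra. Qed.
Lemma yfl_flight_time y s : 0 < s < PI -> V s = c * y -> c * yfl mu y (PI + s) = - U s.
Proof.
intros Hs EV. pose proof (sin_pos s Hs) as S.
apply Rmult_eq_reg_r with (sin s); [|lra].
pose proof (V_num mu s ltac:(lra)) as N. fold V r Y in N. rewrite EV in N.
pose proof (Pv_U mu Hmu s ltac:(lra)) as PU. unfold Pvc in PU. fold r Y U in PU.
assert (E : exp (mu * (PI + s)) * (r * Y s) = 1) by (unfold r, Y; rewrite rY_exp, <- exp_plus, Rplus_opp_r; apply exp_0).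
unfold yfl.
replace (cos (PI + s)) with (- cos s) by (rewrite Rplus_comm, neg_cos; ring).
replace (sin (PI + s)) with (- sin s) by (rewrite Rplus_comm, neg_sin; ring).
transitivity (- (exp (mu * (PI + s)) * (1 + r * Y s * (cos s + mu * sin s)))).
- transitivity (- exp (mu * (PI + s)) * ((c * y * sin s) * (cos s + mu * sin s) + c * sin s ^ 2)); [ring|].
  rewrite N. replace ((cos s + r * Y s - mu * sin s) * (cos s + mu * sin s) + c * sin s ^ 2) with
   (cos s ^ 2 + sin s ^ 2 + r * Y s * (cos s + mu * sin s)) by (unfold c; ring). rewrite sin_sq. ring.
- rewrite PU. transitivity (- (exp (mu * (PI + s)) * (r * Y s)) * U s * sin s); [ring|]. rewrite E. ring.
Qed.

Lemma first_return_flow p : 0 <= snd p -> forall q, first_return mu H (to_Sigma p) q <-> q = flow mu H p (flight_time (snd p)).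
Proof.
intros Hy q. pose proof (flight_time_range _ Hy) as Hr. pose proof PI_RGT_0.
split.
- intros (psi & s & Hpsi & E0 & Hs & Es & Hon & Hno).
  assert (Ef : forall t, psi t = flow mu H p t) by (apply flow_unique; assumption).
  rewrite <- Es, Ef. f_equal.
  destruct (Rtotal_order s (flight_time (snd p))) as [h|[h|h]]; [exfalso|exact h|exfalso].
  + pose proof (zfl_pos_before (snd p) s Hy ltac:(lra)) as P. rewrite <- Es, Ef in Hon. unfold on_Sigma, flow, zc in Hon. simpl in Hon. lra.
  + apply (Hno (flight_time (snd p)) ltac:(lra)). rewrite Ef. unfold on_Sigma, flow, zc. simpl. apply zfl_flight_time, Hy.
- intros ->. exists (flow mu H p), (flight_time (snd p)).
  split; [apply flow_integral_curve|]. split; [apply flow_0|]. split; [lra|]. split; [reflexivity|]. split.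
  + unfold on_Sigma, flow, zc. simpl. apply zfl_flight_time, Hy.
  + intros t Ht Hon. pose proof (zfl_pos_before (snd p) t Hy Ht). unfold on_Sigma, flow, zc in Hon. simpl in Hon. lra.
Qed.

Lemma Pi_X_flow p : 0 <= snd p -> Pi_X mu H (to_Sigma p) = flow mu H p (flight_time (snd p)).
Proof.
intros Hy. apply (first_return_flow p Hy). unfold Pi_X. apply epsilon_spec.
exists (flow mu H p (flight_time (snd p))). apply (first_return_flow p Hy). reflexivity.
Qed.

Lemma F_flow p : 0 <= snd p -> Sym (flow mu H p (flight_time (snd p))) = to_Sigma (F mu H p).
Proof.
intros Hy. unfold F. rewrite (Pi_X_flow p Hy). unfold Sym, to_Sigma, flow, xc, yc, zc; simpl.
rewrite (zfl_flight_time _ Hy). rewrite Ropp_0. reflexivity.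
Qed.

(** The reduced map in the coordinates of the landing curve: the recursion studied
    above for [c * fst p] and [c * snd p]. *)
Lemma F_explicit p s : 0 < s <= s0 -> V s = c * snd p ->
  c * fst (F mu H p) = U s /\
  c * snd (F mu H p) + r ^ 2 * Y s ^ 2 * (c * fst p) = H * (U s + r ^ 2 * Y s ^ 2 * (c * snd p)).
Proof.
intros Hs EV.
assert (Hy : 0 <= snd p).
{ pose proof (V_nonneg mu Hmu s0 Hs0 HV0 s Hs : 0 <= V s) as P. rewrite EV in P. apply Rmult_le_reg_l with c; lra. }
assert (Er : flight_time (snd p) = PI + s).
{ unfold flight_time. fold c. rewrite <- EV. unfold V. rewrite (phase_V mu Hmu s0 Hs0 HV0 s Hs). reflexivity. }
pose proof (yfl_flight_time (snd p) s ltac:(lra) EV) as EY.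
unfold F. rewrite (Pi_X_flow p Hy). unfold Sym, flow, xc, yc, zc; simpl.
pose proof (zfl_flight_time _ Hy) as Z. rewrite Er in *. unfold xfl. rewrite Z.
split; [lra|].
assert (EE : exp (- (2 * mu * (PI + s))) = r ^ 2 * Y s ^ 2).
{ replace (r ^ 2 * Y s ^ 2) with ((r * Y s) * (r * Y s)) by ring. unfold r, Y. rewrite rY_exp, <- exp_plus. f_equal. ring. }
rewrite EE.
transitivity (- (H * (c * yfl mu (snd p) (PI + s))) + H * (r ^ 2 * Y s ^ 2 * (c * snd p))); [ring|]. rewrite EY. ring.
Qed.

Variable ss : R.
Hypothesis Hss : 0 < ss <= s0.
Lemma x0_U : x0 mu (PI + ss) = U ss / c.
Proof.
unfold x0, zeta, U, Uc, qc, rc, Xc, Yc. rewrite !exp_Ropp, !Rinv_inv.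
replace (cos (PI + ss)) with (- cos ss) by (rewrite Rplus_comm, neg_cos; ring).
replace (sin (PI + ss)) with (- sin ss) by (rewrite Rplus_comm, neg_sin; ring).
replace (mu * (PI + ss)) with (mu * PI + mu * ss) by ring. rewrite exp_plus.
pose proof (sin_pos ss ltac:(lra)). fold c. field. lra.
Qed.
Lemma y0_V : y0 mu (PI + ss) = V ss / c.
Proof.
unfold y0, zeta, V, Vc, rc, Yc.
replace (cos (PI + ss)) with (- cos ss) by (rewrite Rplus_comm, neg_cos; ring).
replace (sin (PI + ss)) with (- sin ss) by (rewrite Rplus_comm, neg_sin; ring).
replace (- mu * (PI + ss)) with (- (mu * PI) + - (mu * ss)) by ring. rewrite exp_plus.
pose proof (sin_pos ss ltac:(lra)). fold c. field. lra.
Qed.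
(** In the coordinates [y - mu * (z - / c)] and [z - / c] the flow is a rotation
    combined with a dilation of rate [mu]; this compares the squared radii at
    launching and at landing. *)
Lemma radius_relation : r ^ 2 * Y ss ^ 2 * ((U ss - mu) ^ 2 + 1) = (V ss + mu) ^ 2 + 1.
Proof.
pose proof (sin_pos ss ltac:(lra)) as S.
pose proof (U_num mu ss ltac:(lra)) as NU. fold U in NU. pose proof (V_num mu ss ltac:(lra)) as NV. fold V r Y in NV.
pose proof (XY_1 mu ss) as XY. pose proof (qr_1 mu Hmu) as QR. fold Y in XY. fold r in QR.
apply Rmult_eq_reg_r with (sin ss ^ 2); [|apply pow_nonzero; lra].
transitivity (r ^ 2 * Y ss ^ 2 * ((U ss * sin ss - mu * sin ss) ^ 2 + sin ss ^ 2)); [ring|].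
transitivity ((V ss * sin ss + mu * sin ss) ^ 2 + sin ss ^ 2); [|ring].
rewrite NU, NV, sin_sq.
transitivity (r ^ 2 * Y ss ^ 2 + 2 * r * Y ss * cos ss * ((qc mu * r) * (Xc mu ss * Y ss)) + ((qc mu * r) * (Xc mu ss * Y ss)) ^ 2); [ring|].
rewrite QR, XY. ring.
Qed.
(** By [radius_relation], [r ^ 2 * Y ss ^ 2] is a quotient of quadratic polynomials in
    [U ss] and [V ss]; both sides then become the defining fraction of [eta], after
    a division by [U ss + V ss]. *)
Lemma fixed_point_eq : eta mu (PI + ss) = H ->
  H * (U ss + r ^ 2 * Y ss ^ 2 * V ss) = V ss + r ^ 2 * Y ss ^ 2 * U ss.
Proof.
unfold eta. rewrite x0_U, y0_V. unfold zeta, beta. fold c. intros E.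
pose proof radius_relation as R.
pose proof (U_pos mu Hmu ss ltac:(lra) : 0 < U ss) as HU. pose proof (V_nonneg mu Hmu s0 Hs0 HV0 ss Hss : 0 <= V ss) as HV.
set (Qm := (U ss - mu) ^ 2 + 1) in *. set (Qp := (V ss + mu) ^ 2 + 1) in *. set (EE := r ^ 2 * Y ss ^ 2) in *.
assert (Hm : 0 < Qm) by (unfold Qm; pose proof (pow2_ge_0 (U ss - mu)); lra).
assert (Hp : 0 < Qp) by (unfold Qp; pose proof (pow2_ge_0 (V ss + mu)); lra).
set (den := U ss ^ 2 + V ss ^ 2 - U ss * V ss - 2 * mu * (U ss - V ss) + c).
assert (Ed : (U ss + V ss) * den = U ss * Qm + V ss * Qp) by (unfold den, Qm, Qp, c; ring).
assert (Hd : 0 < den).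
{ assert (0 < U ss * Qm) by (apply Rmult_lt_0_compat; lra). assert (0 <= V ss * Qp) by (apply Rmult_le_pos; lra).
  apply Rmult_lt_reg_l with (U ss + V ss); lra. }
assert (EH : H * den = U ss * V ss + c).
{ rewrite <- E.
  replace (U ss / c * (V ss / c) + 1 / c) with ((U ss * V ss + c) / c ^ 2) by (field; lra).
  replace ((U ss / c) ^ 2 + (V ss / c) ^ 2 - U ss / c * (V ss / c) - 2 * mu / c * (U ss / c - V ss / c) + 1 / c) with (den / c ^ 2)
    by (unfold den; field; lra).
  field. lra. }
apply Rmult_eq_reg_r with Qm; [|lra].
transitivity (H * (U ss * Qm + V ss * (EE * Qm))); [ring|].
transitivity (V ss * Qm + U ss * (EE * Qm)); [|ring].
rewrite R, <- Ed.
transitivity ((U ss + V ss) * (H * den)); [ring|]. rewrite EH. unfold Qm, Qp, c. ring.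
Qed.
Lemma H_crit_lt : H < H_crit mu -> H * ((1 - r + r ^ 2) / r) < 1.
Proof.
unfold H_crit. intros HH. unfold cosh in HH. pose proof (r_range mu Hmu) as Hr. fold r in Hr.
replace (PI * mu) with (mu * PI) in HH by ring.
assert (Eq : exp (mu * PI) = / r) by (unfold r, rc; rewrite exp_Ropp, Rinv_inv; reflexivity).
rewrite Eq in HH. change (exp (- (mu * PI))) with r in HH.
replace (2 * ((/ r + r) / 2) - 1) with ((1 - r + r ^ 2) / r) in HH by (field; lra).
assert (HK : 0 < (1 - r + r ^ 2) / r) by (apply Rdiv_lt_0_compat; nra).
apply Rmult_lt_reg_r with (/ ((1 - r + r ^ 2) / r)); [apply Rinv_0_lt_compat; exact HK|].
rewrite Rmult_assoc, Rinv_r by lra. lra.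
Qed.

Theorem chain_limit_F (u : nat -> R * R) :
  H < H_crit mu -> eta mu (PI + ss) = H ->
  chain_of_flights mu H u -> (forall n, 0 <= snd (u n)) ->
  is_lim_seq (fun n => fst (u n)) (x0 mu (PI + ss)) /\ is_lim_seq (fun n => snd (u n)) (y0 mu (PI + ss)).
Proof.
intros HH He Hu Hpos.
assert (Hvn : forall n, 0 <= c * snd (u n)) by (intros n; apply Rmult_le_pos; [lra|auto]).
destruct (landing_chain_converges mu Hmu s0 Hs0 HV0 H ss (fun n => c * fst (u n)) (fun n => c * snd (u n)) (fun n => phase mu s0 (c * snd (u n))))
  as [L1 L2]; auto.
- apply H_crit_lt, HH.
- apply fixed_point_eq, He.
- intros n. apply (phase_spec mu Hmu s0 Hs0 HV0 _ (Hvn n)).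
- intros n. symmetry. apply (phase_spec mu Hmu s0 Hs0 HV0 _ (Hvn n)).
- intros n. rewrite Hu. destruct (phase_spec mu Hmu s0 Hs0 HV0 _ (Hvn n)) as [A B].
  apply (F_explicit (u n) _ A B).
- intros n. rewrite Hu. destruct (phase_spec mu Hmu s0 Hs0 HV0 _ (Hvn n)) as [A B].
  apply (F_explicit (u n) _ A B).
- rewrite x0_U, y0_V. split.
  + apply is_lim_seq_ext with (fun n => / c * (c * fst (u n))); [intros; field; lra|].
    replace (U ss / c) with (/ c * U ss) by (field; lra). apply is_lim_seq_mult'; [apply is_lim_seq_const|exact L1].
  + apply is_lim_seq_ext with (fun n => / c * (c * snd (u n))); [intros; field; lra|].
    replace (V ss / c) with (/ c * V ss) by (field; lra). apply is_lim_seq_mult'; [apply is_lim_seq_const|exact L2].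
Qed.
End Return.

(** * Trajectories follow flights *)

Lemma Sym_Sym p : Sym (Sym p) = p.
Proof. apply R3_eq; unfold Sym, xc, yc, zc; simpl; ring. Qed.

Lemma Sym_integral_X mu H psi : integral_curve (fieldX mu H) psi -> integral_curve (fieldY mu H) (fun s => Sym (psi s)).
Proof.
intros Hp s. rewrite fieldY_conj, Sym_Sym.
destruct (integral_curve_components mu H psi Hp s) as (Dx & Dy & Dz).
unfold Sym, fieldX at 1 2 3, xc at 3 4, yc at 3 4, zc at 4 5; simpl fst; simpl snd.
apply (is_derive_pair (fun s => (- yc (psi s), - xc (psi s))) (fun s => - zc (psi s)) s (_, _) _).
- apply (is_derive_pair (fun s => - yc (psi s)) (fun s => - xc (psi s))).
  + apply (is_derive_opp (fun s => yc (psi s))). exact Dy.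
  + apply (is_derive_opp (fun s => xc (psi s))). exact Dx.
- apply (is_derive_opp (fun s => zc (psi s))). exact Dz.
Qed.
Lemma Sym_integral_Y mu H psi : integral_curve (fieldY mu H) psi -> integral_curve (fieldX mu H) (fun s => Sym (psi s)).
Proof.
intros Hp s. specialize (Hp s).
assert (Dx : is_derive (fun t => xc (psi t)) s (xc (fieldY mu H (psi s)))) by exact (is_derive_fst _ _ _ (is_derive_fst _ _ _ Hp)).
assert (Dy : is_derive (fun t => yc (psi t)) s (yc (fieldY mu H (psi s)))) by exact (is_derive_snd _ _ _ (is_derive_fst _ _ _ Hp)).
assert (Dz : is_derive (fun t => zc (psi t)) s (zc (fieldY mu H (psi s)))) by exact (is_derive_snd _ _ _ Hp).
replace (fieldX mu H (Sym (psi s))) with (Sym (fieldY mu H (psi s))) by (rewrite fieldY_conj, Sym_Sym; reflexivity).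
apply (is_derive_pair (fun s => (- yc (psi s), - xc (psi s))) (fun s => - zc (psi s)) s (_, _) _).
- apply (is_derive_pair (fun s => - yc (psi s)) (fun s => - xc (psi s))).
  + apply (is_derive_opp (fun s => yc (psi s))). exact Dy.
  + apply (is_derive_opp (fun s => xc (psi s))). exact Dx.
- apply (is_derive_opp (fun s => zc (psi s))). exact Dz.
Qed.

Lemma continuous_xc p : continuous xc p.
Proof. apply (continuous_comp fst fst); apply continuous_fst. Qed.
Lemma continuous_yc p : continuous yc p.
Proof. apply (continuous_comp fst snd); [apply continuous_fst|apply continuous_snd]. Qed.
Lemma continuous_zc p : continuous zc p.
Proof. apply continuous_snd. Qed.

Lemma filterlim_R3 {T} (F : (T -> Prop) -> Prop) {FF : Filter F} (f : T -> R3) (l : R3) :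
  filterlim (fun t => xc (f t)) F (locally (xc l)) -> filterlim (fun t => yc (f t)) F (locally (yc l)) ->
  filterlim (fun t => zc (f t)) F (locally (zc l)) -> filterlim f F (locally l).
Proof.
intros Hx Hy Hz. apply filterlim_locally. intros eps.
pose proof (proj1 (filterlim_locally _ _) Hx eps) as Bx. pose proof (proj1 (filterlim_locally _ _) Hy eps) as By.
pose proof (proj1 (filterlim_locally _ _) Hz eps) as Bz.
generalize (filter_and _ _ Bx (filter_and _ _ By Bz)). apply filter_imp.
intros t (A & B & C). split; [split|]; assumption.
Qed.

Lemma filterlim_Sym {T} (F : (T -> Prop) -> Prop) {FF : Filter F} (f : T -> R3) (l : R3) :
  filterlim f F (locally l) -> filterlim (fun t => Sym (f t)) F (locally (Sym l)).
Proof.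
intros Hf. apply (filterlim_R3 F).
- apply (filterlim_comp _ _ _ f (fun p => - yc p) F (locally l)); [exact Hf|]. apply (continuous_opp yc), continuous_yc.
- apply (filterlim_comp _ _ _ f (fun p => - xc p) F (locally l)); [exact Hf|]. apply (continuous_opp xc), continuous_xc.
- apply (filterlim_comp _ _ _ f (fun p => - zc p) F (locally l)); [exact Hf|]. apply (continuous_opp zc), continuous_zc.
Qed.

Lemma crossing_Sym p : (crossing_up (Sym p) <-> crossing_down p) /\ (crossing_down (Sym p) <-> crossing_up p).
Proof.
unfold crossing_up, crossing_down, in_Sigma_c, on_Sigma, Sym, xc, yc, zc; simpl.
repeat split; intros; nra.
Qed.

Lemma follows_Sym mu H J phi s :
  (follows_after J (fieldX mu H) phi s -> follows_after J (fieldY mu H) (fun t => Sym (phi t)) s) /\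
  (follows_after J (fieldY mu H) phi s -> follows_after J (fieldX mu H) (fun t => Sym (phi t)) s) /\
  (follows_before J (fieldX mu H) phi s -> follows_before J (fieldY mu H) (fun t => Sym (phi t)) s) /\
  (follows_before J (fieldY mu H) phi s -> follows_before J (fieldX mu H) (fun t => Sym (phi t)) s).
Proof.
repeat split; intros (psi & Hp & d & Hd & E); exists (fun t => Sym (psi t));
 (split; [first [apply Sym_integral_X; exact Hp|apply Sym_integral_Y; exact Hp]|]);
 exists d; (split; [exact Hd|]); intros t Jt Ht; rewrite (E t Jt Ht); reflexivity.
Qed.

Definition Z_at mu H (J : R -> Prop) phi s : Prop :=
  filterlim phi (within J (locally s)) (locally (phi s)) /\
  (0 < zc (phi s) \/ crossing_up (phi s) -> follows_after J (fieldX mu H) phi s) /\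
  (zc (phi s) < 0 \/ crossing_down (phi s) -> follows_after J (fieldY mu H) phi s) /\
  (0 < zc (phi s) \/ crossing_down (phi s) -> follows_before J (fieldX mu H) phi s) /\
  (zc (phi s) < 0 \/ crossing_up (phi s) -> follows_before J (fieldY mu H) phi s).

Lemma Z_at_Sym mu H J phi s : Z_at mu H J phi s -> Z_at mu H J (fun t => Sym (phi t)) s.
Proof.
intros (C & A1 & A2 & B1 & B2).
destruct (crossing_Sym (phi s)) as [U D]. destruct (follows_Sym mu H J phi s) as (F1 & F2 & F3 & F4).
assert (Ez : zc (Sym (phi s)) = - zc (phi s)) by reflexivity.
split; [apply (filterlim_Sym (within J (locally s))), C|].
split; [|split; [|split]]; intros [h|h]; rewrite ?Ez in h;
 [apply F2, A2; left; lra|apply F2, A2; right; apply U, h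
 |apply F1, A1; left; lra|apply F1, A1; right; apply D, h
 |apply F4, B2; left; lra|apply F4, B2; right; apply D, h
 |apply F3, B1; left; lra|apply F3, B1; right; apply U, h].
Qed.

Lemma Z_trajectory_Sym mu H J phi : Z_trajectory mu H J phi -> Z_trajectory mu H J (fun t => Sym (phi t)).
Proof. intros Hp s Js. apply (Z_at_Sym mu H J phi s), Hp, Js. Qed.

Lemma Z_trajectory_iter mu H J phi n : Z_trajectory mu H J phi -> Z_trajectory mu H J (fun t => Nat.iter n Sym (phi t)).
Proof. intros Hp. induction n as [|n IH]; [exact Hp|]. apply (Z_trajectory_Sym mu H J _ IH). Qed.

Lemma real_induction (Q : R -> Prop) (T : R) : 0 <= T -> Q 0 ->
  (forall x, 0 <= x < T -> (forall y, 0 <= y <= x -> Q y) -> exists d, 0 < d /\ forall y, x <= y < x + d -> y <= T -> Q y) ->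
  (forall x, 0 < x <= T -> (forall y, 0 <= y < x -> Q y) -> Q x) ->
  forall x, 0 <= x <= T -> Q x.
Proof.
intros HT Q0 Hopen Hclosed.
set (S := fun x => 0 <= x <= T /\ forall y, 0 <= y <= x -> Q y).
assert (S0 : S 0) by (split; [lra|]; intros y Hy; replace y with 0 by lra; exact Q0).
destruct (completeness S) as (m & Hub & Hlub).
{ exists T. intros x [Hx _]. lra. }
{ exists 0. exact S0. }
assert (Hm0 : 0 <= m) by (apply Hub, S0).
assert (HmT : m <= T) by (apply Hlub; intros x [Hx _]; lra).
assert (Hlt : forall y, 0 <= y < m -> Q y).
{ intros y Hy. apply NNPP. intros HQ.
  assert (m <= y); [|lra]. apply Hlub. intros x [Hx Hx']. apply Rnot_lt_le. intros h. apply HQ, Hx'. lra. }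
assert (Hm : forall y, 0 <= y <= m -> Q y).
{ intros y Hy. destruct (Req_dec y m) as [->|]; [|apply Hlt; lra].
  destruct (Req_dec m 0) as [->|]; [exact Q0|]. apply Hclosed; [lra|exact Hlt]. }
destruct (Req_dec m T) as [->|]; [exact Hm|].
destruct (Hopen m ltac:(lra) Hm) as (d & Hd & HQ).
assert (m + Rmin (d / 2) (T - m) <= m).
{ apply Hub. pose proof (Rmin_l (d / 2) (T - m)). pose proof (Rmin_r (d / 2) (T - m)).
  assert (0 < Rmin (d / 2) (T - m)) by (apply Rmin_glb_lt; lra). split; [lra|].
  intros y Hy. destruct (Rle_dec y m); [apply Hm; lra|]. apply HQ; lra. }
assert (0 < Rmin (d / 2) (T - m)) by (apply Rmin_glb_lt; lra). lra.
Qed.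

Lemma left_limit_eq (J : R -> Prop) (f g : R -> R) (a b : R) : b < a -> (forall x, b <= x <= a -> J x) ->
  filterlim f (within J (locally a)) (locally (f a)) -> continuous g a ->
  (forall x, b <= x < a -> f x = g x) -> f a = g a.
Proof.
intros Hba HJ Hf Hg E. apply NNPP. intros Hne.
assert (He : 0 < Rabs (f a - g a) / 2) by (apply Rdiv_lt_0_compat; [apply Rabs_pos_lt; lra|lra]).
set (e := mkposreal _ He).
pose proof (proj1 (filterlim_locally _ _) Hf e) as [d1 H1]. pose proof (proj1 (filterlim_locally _ _) Hg e) as [d2 H2].
set (x := a - Rmin (Rmin d1 d2) (a - b) / 2).
pose proof (cond_pos d1). pose proof (cond_pos d2).
assert (P : 0 < Rmin (Rmin d1 d2) (a - b)) by (repeat apply Rmin_glb_lt; lra).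
pose proof (Rmin_l (Rmin d1 d2) (a - b)). pose proof (Rmin_r (Rmin d1 d2) (a - b)).
pose proof (Rmin_l d1 d2). pose proof (Rmin_r d1 d2).
assert (B1 : ball a d1 x) by (unfold ball; simpl; unfold AbsRing_ball, abs, minus, plus, opp; simpl; unfold x; rewrite Rabs_left1; lra).
assert (B2 : ball a d2 x) by (unfold ball; simpl; unfold AbsRing_ball, abs, minus, plus, opp; simpl; unfold x; rewrite Rabs_left1; lra).
specialize (H1 x B1 (HJ x ltac:(unfold x; lra))). specialize (H2 x B2).
rewrite (E x ltac:(unfold x; lra)) in H1.
unfold ball in H1, H2; simpl in H1, H2; unfold AbsRing_ball, abs, minus, plus, opp in H1, H2; simpl in H1, H2.
assert (Rabs (f a - g a) <= Rabs (g x + - f a) + Rabs (g x + - g a)).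
{ replace (f a - g a) with (- (g x + - f a) + (g x + - g a)) by ring. eapply Rle_trans; [apply Rabs_triang|]. rewrite Rabs_Ropp. lra. }
lra.
Qed.

Section Follow.
Variables mu H : R.
Hypothesis Hmu : 0 < mu.
Variable s0 : R.
Hypothesis Hs0 : 0 < s0 < PI.
Hypothesis HV0 : Vc mu s0 = 0.
Let ret := flight_time mu s0.

Lemma flow_continuous p t : continuous (fun t => xc (flow mu H p t)) t /\ continuous (fun t => yc (flow mu H p t)) t /\
  continuous (fun t => zc (flow mu H p t)) t.
Proof.
destruct (integral_curve_components mu H _ (flow_integral_curve mu H p) t) as (A & B & C).
split; [|split].
- apply (ex_derive_continuous (fun t => xc (flow mu H p t))). eexists. exact A.
- apply (ex_derive_continuous (fun t => yc (flow mu H p t))). eexists. exact B.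
- apply (ex_derive_continuous (fun t => zc (flow mu H p t))). eexists. exact C.
Qed.

(** By real induction: after a time at which the trajectory agrees with the flow it
    is above the plane, or at the initial upward crossing, so it follows an integral
    curve of X for a while, which is the flow; agreement passes to limits from the
    left by continuity. *)
Lemma follow_flight J phi s p : Z_trajectory mu H J phi -> (forall t, s <= t -> J t) ->
  phi s = to_Sigma p -> Defs.D p -> forall t, 0 <= t <= ret (snd p) -> phi (s + t) = flow mu H p t.
Proof.
intros Hphi HJ Es [Dx Dy].
assert (Hy : 0 <= snd p) by lra.
pose proof (flight_time_range mu Hmu s0 Hs0 HV0 _ Hy) as Hr. fold ret in Hr. pose proof PI_RGT_0.
apply real_induction; [lra| | |].
- rewrite Rplus_0_r, flow_0. exact Es.
- intros x Hx HQ.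
  assert (Ex : phi (s + x) = flow mu H p x) by (apply HQ; lra).
  destruct (Hphi (s + x) (HJ (s + x) ltac:(lra))) as (_ & A & _).
  destruct A as (psi & Hpsi & d & Hd & Ed).
  { rewrite Ex. destruct (Req_dec x 0) as [->|Hx0].
    - right. rewrite flow_0. unfold crossing_up, in_Sigma_c, on_Sigma, to_Sigma, xc, yc, zc; simpl.
      repeat split; [|exact Dy]. apply Rmult_lt_0_compat; assumption.
    - left. unfold flow, zc; simpl. apply (zfl_pos_before mu Hmu s0 Hs0 HV0); [exact Hy|]. change (0 < x < ret (snd p)). lra. }
  exists d. split; [exact Hd|]. intros y Hy1 Hy2.
  rewrite (Ed (s + y) (HJ (s + y) ltac:(lra)) ltac:(lra)).
  assert (E2 : forall t, psi (t + s) = flow mu H p t).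
  { apply (integral_curve_unique mu H (fun t => psi (t + s)) (flow mu H p) x).
    - apply integral_curve_shift, Hpsi.
    - apply flow_integral_curve.
    - rewrite (Rplus_comm x s), <- Ex. symmetry. apply Ed; [apply HJ|]; lra. }
  rewrite (Rplus_comm s y). apply E2.
- intros x Hx HQ.
  destruct (Hphi (s + x) (HJ (s + x) ltac:(lra))) as (C & _).
  destruct (flow_continuous p (s + x + - s)) as (Cx & Cy & Cz).
  assert (K : forall k : R3 -> R, (forall q, continuous k q) -> continuous (fun t => k (flow mu H p t)) (s + x + - s) ->
     k (phi (s + x)) = k (flow mu H p x)).
  { intros k Ck Hk. replace (flow mu H p x) with (flow mu H p (s + x + - s)) by (f_equal; ring).
    apply (left_limit_eq J (fun t => k (phi t)) (fun t => k (flow mu H p (t + - s))) (s + x) s).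
    - lra.
    - intros t Ht. apply HJ. lra.
    - apply (filterlim_comp _ _ _ phi k _ (locally (phi (s + x)))); [exact C|apply Ck].
    - apply (continuous_comp (fun t => t + - s) (fun t => k (flow mu H p t))); [|exact Hk].
      apply (ex_derive_continuous (fun t : R => t + - s)). auto_derive. exact I.
    - intros t Ht. rewrite <- (HQ (t + - s) ltac:(lra)). do 2 f_equal. ring. }
  apply R3_eq; [apply (K xc continuous_xc Cx)|apply (K yc continuous_yc Cy)|apply (K zc continuous_zc Cz)].
Qed.

Fixpoint contact_time (p : R * R) (n : nat) : R :=
  match n with O => 0 | S n => contact_time p n + ret (snd (Nat.iter n (F mu H) p)) end.

Lemma iter_F_D p : D_infty mu H p -> forall n, Defs.D (Nat.iter n (F mu H) p).
Proof. intros [_ Hd]. exact Hd. Qed.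

(** Every other flight takes place below the plane; applying [Sym] as many times as
    there were contacts brings each flight above it. *)
Lemma follow_chain J phi s p : Z_trajectory mu H J phi -> (forall t, s <= t -> J t) ->
  phi s = to_Sigma p -> forall n, (forall m, (m <= n)%nat -> Defs.D (Nat.iter m (F mu H) p)) ->
  forall t, 0 <= t <= ret (snd (Nat.iter n (F mu H) p)) ->
  Nat.iter n Sym (phi (s + contact_time p n + t)) = flow mu H (Nat.iter n (F mu H) p) t.
Proof.
intros Hphi HJ Es n. induction n as [|n IH]; intros HD t Ht.
- simpl. rewrite Rplus_0_r. apply (follow_flight J); auto. apply (HD 0%nat). lia.
- set (pn := Nat.iter n (F mu H) p) in *.
  assert (HDn : Defs.D pn) by (apply HD; lia).
  assert (Hret : forall y, 0 <= y -> 0 < ret y).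
  { intros y Hy. pose proof (flight_time_range mu Hmu s0 Hs0 HV0 y Hy). fold ret in H0. pose proof PI_RGT_0. lra. }
  assert (Hc : forall m, (m <= S n)%nat -> 0 <= contact_time p m).
  { induction m as [|m IHm]; intros Hm; simpl; [lra|].
    assert (Dm : Defs.D (Nat.iter m (F mu H) p)) by (apply HD; lia). destruct Dm as [_ Dm].
    specialize (IHm ltac:(lia)). specialize (Hret (snd (Nat.iter m (F mu H) p)) ltac:(lra)). lra. }
  apply (follow_flight J (fun t => Nat.iter (S n) Sym (phi t)) (s + contact_time p (S n)) (Nat.iter (S n) (F mu H) p)).
  + apply Z_trajectory_iter, Hphi.
  + intros u Hu. apply HJ. specialize (Hc (S n) (le_n _)). lra.
  + change (Nat.iter (S n) Sym ?q) with (Sym (Nat.iter n Sym q)).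
    simpl contact_time. fold pn. rewrite <- Rplus_assoc.
    destruct HDn as [_ Dy]. pose proof (Hret (snd pn) ltac:(lra)).
    rewrite IH; [|intros m Hm; apply HD; lia|lra].
    apply (F_flow mu H Hmu s0 Hs0 HV0). lra.
  + apply HD. lia.
  + exact Ht.
Qed.

Lemma contact_next p n : contact_time p (S n) = contact_time p n + ret (snd (Nat.iter n (F mu H) p)).
Proof. reflexivity. Qed.

Lemma contact_grows p : (forall n, 0 <= snd (Nat.iter n (F mu H) p)) -> forall n, INR n * PI <= contact_time p n.
Proof.
intros Hp. induction n as [|n IH]; [simpl; lra|]. rewrite contact_next, S_INR.
pose proof (flight_time_range mu Hmu s0 Hs0 HV0 _ (Hp n)). fold ret in H0. lra.
Qed.

Lemma locate p : (forall n, 0 <= snd (Nat.iter n (F mu H) p)) -> forall N t, contact_time p N <= t ->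
  exists n, (N <= n)%nat /\ contact_time p n <= t < contact_time p (S n).
Proof.
intros Hp N t Ht.
assert (A : exists m, t < contact_time p (N + m)%nat).
{ destruct (INR_unbounded (t / PI)) as [m Hm]. exists m. pose proof PI_RGT_0.
  apply Rlt_le_trans with (INR m * PI).
  - apply Rmult_lt_reg_r with (/ PI); [apply Rinv_0_lt_compat; lra|]. rewrite Rmult_assoc, Rinv_r by lra. lra.
  - apply Rle_trans with (INR (N + m) * PI); [|apply contact_grows, Hp].
    apply Rmult_le_compat_r; [lra|]. apply le_INR. lia. }
destruct A as [m Hm]. induction m as [|m IH].
- rewrite Nat.add_0_r in Hm. lra.
- destruct (Rlt_dec t (contact_time p (N + m)%nat)) as [h|h]; [apply IH, h|].
  exists (N + m)%nat. split; [lia|]. rewrite Nat.add_succ_r in Hm. lra.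
Qed.
End Follow.

(** * The cycle *)

(** The sum of the coordinate distances dominates the Euclidean distance and is
    convenient for estimates coordinate by coordinate. *)
Definition norm1 (p q : R3) : R := Rabs (xc p - xc q) + Rabs (yc p - yc q) + Rabs (zc p - zc q).

Lemma sqrt_sum_le a b : 0 <= a -> 0 <= b -> sqrt (a ^ 2 + b ^ 2) <= a + b.
Proof.
intros Ha Hb. apply Rsqr_incr_0_var; [|lra]. rewrite Rsqr_sqrt by nra. unfold Rsqr. nra.
Qed.

Lemma norm_le_norm1 (p q : R3) : norm (minus p q) <= norm1 p q.
Proof.
destruct p as [[a b] d], q as [[a' b'] d'].
assert (E : norm (minus (a, b, d) (a', b', d')) =
  sqrt (sqrt (Rabs (a - a') ^ 2 + Rabs (b - b') ^ 2) ^ 2 + Rabs (d - d') ^ 2)) by reflexivity.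
rewrite E. unfold norm1, xc, yc, zc; simpl fst; simpl snd.
eapply Rle_trans; [apply sqrt_sum_le; [apply sqrt_pos|apply Rabs_pos]|].
pose proof (sqrt_sum_le (Rabs (a - a')) (Rabs (b - b')) (Rabs_pos _) (Rabs_pos _)). lra.
Qed.

Lemma norm1_Sym p q : norm1 (Sym p) (Sym q) = norm1 p q.
Proof.
unfold norm1, Sym, xc, yc, zc; simpl.
replace (- snd (fst p) - - snd (fst q)) with (- (snd (fst p) - snd (fst q))) by ring.
replace (- fst (fst p) - - fst (fst q)) with (- (fst (fst p) - fst (fst q))) by ring.
replace (- snd p - - snd q) with (- (snd p - snd q)) by ring.
rewrite !Rabs_Ropp. ring.
Qed.

Lemma norm1_triangle p q s : norm1 p s <= norm1 p q + norm1 q s.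
Proof.
unfold norm1.
assert (T : forall a b d, Rabs (a - d) <= Rabs (a - b) + Rabs (b - d)).
{ intros a b d. replace (a - d) with ((a - b) + (b - d)) by ring. apply Rabs_triang. }
pose proof (T (xc p) (xc q) (xc s)). pose proof (T (yc p) (yc q) (yc s)). pose proof (T (zc p) (zc q) (zc s)). lra.
Qed.

Lemma dist_to_bounds (gamma : R3 -> Prop) p q : gamma q -> 0 <= dist_to gamma p <= norm1 p q.
Proof.
intros Hq. unfold dist_to.
set (E := fun d => exists q : R3, gamma q /\ d = norm (minus p q)).
destruct (Glb_Rbar_correct E) as [Hlb Hglb].
assert (H0 : Rbar_le 0 (Glb_Rbar E)).
{ apply Hglb. intros d (q' & _ & ->). apply norm_ge_0. }
assert (H1 : Rbar_le (Glb_Rbar E) (norm (minus p q))) by (apply Hlb; exists q; auto).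
pose proof (norm_le_norm1 p q) as H2.
destruct (Glb_Rbar E) as [g| |]; simpl in *; [lra|contradiction|contradiction].
Qed.

Lemma iter_Sym_cases n : (Nat.even n = true /\ forall p, Nat.iter n Sym p = p) \/
  (Nat.even n = false /\ forall p, Nat.iter n Sym p = Sym p).
Proof.
induction n as [|n [[E IH]|[E IH]]]; [left; split; auto| |].
- right. split; [rewrite Nat.even_succ, <- Nat.negb_even, E; reflexivity|]. intros p. simpl. rewrite IH. reflexivity.
- left. split; [rewrite Nat.even_succ, <- Nat.negb_even, E; reflexivity|]. intros p. simpl. rewrite IH, Sym_Sym. reflexivity.
Qed.
Lemma iter_Sym_Sym n p : Nat.iter n Sym (Nat.iter n Sym p) = p.
Proof. destruct (iter_Sym_cases n) as [[_ E]|[_ E]]; rewrite !E, ?Sym_Sym; reflexivity. Qed.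
Lemma norm1_iter n p q : norm1 (Nat.iter n Sym p) (Nat.iter n Sym q) = norm1 p q.
Proof. destruct (iter_Sym_cases n) as [[_ E]|[_ E]]; rewrite !E, ?norm1_Sym; reflexivity. Qed.

Lemma integral_curve_continuous V psi s : integral_curve V psi -> continuous psi s.
Proof. intros Hp. apply (ex_derive_continuous psi). eexists. apply Hp. Qed.

Lemma glue_continuous (J : R -> Prop) (phi f g : R -> R3) s d : 0 < d ->
  continuous f s -> continuous g s ->
  (forall r, s <= r < s + d -> phi r = f r) -> (forall r, s - d < r <= s -> phi r = g r) ->
  filterlim phi (within J (locally s)) (locally (phi s)).
Proof.
intros Hd Cf Cg Ef Eg. apply filterlim_locally. intros eps.
destruct (proj1 (filterlim_locally _ _) Cf eps) as [d1 H1]. destruct (proj1 (filterlim_locally _ _) Cg eps) as [d2 H2].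
assert (P : 0 < Rmin d (Rmin d1 d2)) by (repeat apply Rmin_glb_lt; [exact Hd|apply cond_pos|apply cond_pos]).
exists (mkposreal _ P). intros y By _.
assert (Hy : Rabs (y - s) < Rmin d (Rmin d1 d2)) by exact By.
pose proof (Rmin_l d (Rmin d1 d2)). pose proof (Rmin_r d (Rmin d1 d2)). pose proof (Rmin_l d1 d2). pose proof (Rmin_r d1 d2).
apply Rabs_def2 in Hy.
destruct (Rle_dec s y) as [h|h].
- rewrite (Ef y ltac:(lra)), (Ef s ltac:(lra)). apply H1. change (Rabs (y - s) < d1). apply Rabs_def1; lra.
- rewrite (Eg y ltac:(lra)), (Eg s ltac:(lra)). apply H2. change (Rabs (y - s) < d2). apply Rabs_def1; lra.
Qed.

Lemma Z_at_shift mu H phi (s a : R) : Z_at mu H (fun _ => True) phi s -> Z_at mu H (fun _ => True) (fun t => phi (t + a)) (s - a).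
Proof.
intros (C & A1 & A2 & B1 & B2). unfold Z_at.
replace (s - a + a) with s by ring.
split.
{ apply (filterlim_comp _ _ _ (fun t => t + a) phi _ (within (fun _ => True) (locally s))); [|exact C].
  intros P [d Hd]. exists d. intros y By _. apply Hd; [|exact I].
  change (Rabs (y + a - s) < d). change (Rabs (y - (s - a)) < d) in By.
  apply (Rle_lt_trans _ (Rabs (y - (s - a)))); [right; f_equal; unfold Rminus; change (y + a + - s = y + - (s + - a)); lra|exact By]. }
assert (FA : forall V, follows_after (fun _ => True) V phi s -> follows_after (fun _ => True) V (fun t => phi (t + a)) (s - a)).
{ intros V (psi & Hp & d & Hd & E). exists (fun t => psi (t + a)). split; [apply integral_curve_shift, Hp|].
  exists d. split; [exact Hd|]. intros t _ Ht. apply E; [exact I|lra]. }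
assert (FB : forall V, follows_before (fun _ => True) V phi s -> follows_before (fun _ => True) V (fun t => phi (t + a)) (s - a)).
{ intros V (psi & Hp & d & Hd & E). exists (fun t => psi (t + a)). split; [apply integral_curve_shift, Hp|].
  exists d. split; [exact Hd|]. intros t _ Ht. apply E; [exact I|lra]. }
repeat split; auto.
Qed.

Section Cycle.
Variables mu H : R.
Hypothesis Hmu : 0 < mu.
Variable s0 : R.
Hypothesis Hs0 : 0 < s0 < PI.
Hypothesis HV0 : Vc mu s0 = 0.
Variable ss : R.
Hypothesis Hss : 0 < ss < s0.
Hypothesis HH : H < H_crit mu.
Hypothesis He : eta mu (PI + ss) = H.
Let c := 1 + mu ^ 2.
Let ret := flight_time mu s0.
Let fixpt := (x0 mu (PI + ss), y0 mu (PI + ss)).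
Let T := PI + ss.
Let cp : 0 < c. Proof. unfold c. nra. Qed.
Let fl := flow mu H.

Lemma fixpt_D : Defs.D fixpt.
Proof.
unfold Defs.D, fixpt. simpl. rewrite (x0_U mu s0 Hs0 ss) by lra. rewrite (y0_V mu s0 Hs0 ss) by lra. fold c.
pose proof (U_pos mu Hmu ss ltac:(lra)).
pose proof (V_decr mu Hmu ss s0 ltac:(lra) ltac:(lra) ltac:(lra)) as HV. rewrite HV0 in HV.
split; apply Rdiv_lt_0_compat; auto.
Qed.
Lemma fixpt_V : Vc mu ss = c * snd fixpt.
Proof. unfold fixpt. simpl. rewrite (y0_V mu s0 Hs0 ss) by lra. fold c. field. lra. Qed.
Lemma fixpt_U : Uc mu ss = c * fst fixpt.
Proof. unfold fixpt. simpl. rewrite (x0_U mu s0 Hs0 ss) by lra. fold c. field. lra. Qed.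
Lemma fixpt_fixed : F mu H fixpt = fixpt.
Proof.
pose proof (fixed_point_eq mu H Hmu s0 Hs0 HV0 ss ltac:(lra) He) as Fx.
destruct (F_explicit mu H Hmu s0 Hs0 HV0 fixpt ss ltac:(lra) fixpt_V) as [E1 E2]. fold c in E1, E2.
rewrite <- fixpt_V, <- fixpt_U, Fx in E2.
destruct (F mu H fixpt) as [a b]. simpl in E1, E2. rewrite fixpt_U in E1.
rewrite (surjective_pairing fixpt). f_equal.
- apply Rmult_eq_reg_l with c; lra.
- apply Rmult_eq_reg_l with c; [|lra]. rewrite <- fixpt_V. lra.
Qed.
Lemma fixpt_iter n : Nat.iter n (F mu H) fixpt = fixpt.
Proof. induction n as [|n IH]; [reflexivity|]. simpl. rewrite IH. apply fixpt_fixed. Qed.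
Lemma fixpt_ret : ret (snd fixpt) = T.
Proof. unfold ret, flight_time. fold c. rewrite <- fixpt_V. rewrite (phase_V mu Hmu s0 Hs0 HV0 ss ltac:(lra)). reflexivity. Qed.
Lemma T_pos : 0 < T. Proof. unfold T. pose proof PI_RGT_0. lra. Qed.
Lemma flight_T : Sym (fl fixpt T) = to_Sigma fixpt.
Proof.
destruct fixpt_D as [_ Dy]. pose proof (F_flow mu H Hmu s0 Hs0 HV0 fixpt ltac:(lra)) as E.
rewrite fixpt_fixed in E. fold ret in E. rewrite fixpt_ret in E. exact E.
Qed.

(** The periodic trajectory: the flight of duration [T] from the fixed point, then
    its image under [Sym], and so on in both directions of time. *)
Definition cyc (s : R) : R3 :=
  let k := Int_part (s / T) in
  if Z.even k then fl fixpt (s - IZR k * T) else Sym (fl fixpt (s - IZR k * T)).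

Lemma cyc_base s : 0 <= s < T -> cyc s = fl fixpt s.
Proof.
intros Hs. pose proof T_pos. unfold cyc.
assert (E : Int_part (s / T) = 0%Z).
{ symmetry. apply Int_part_spec. split.
  - apply Rmult_lt_reg_r with T; [lra|]. unfold Rdiv. rewrite Rmult_minus_distr_r, Rmult_assoc, Rinv_l; lra.
  - apply Rle_mult_inv_pos; lra. }
rewrite E. simpl. f_equal. ring.
Qed.
Lemma cyc_shift s : cyc (s + T) = Sym (cyc s).
Proof.
pose proof T_pos. unfold cyc.
assert (E : Int_part ((s + T) / T) = (Int_part (s / T) + 1)%Z).
{ symmetry. apply Int_part_spec. rewrite plus_IZR. replace ((s + T) / T) with (s / T + 1) by (field; lra).
  destruct (base_Int_part (s / T)). lra. }
rewrite E, Z.even_add. rewrite plus_IZR.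
replace (s + T - (IZR (Int_part (s / T)) + 1) * T) with (s - IZR (Int_part (s / T)) * T) by ring.
simpl Z.even at 1. destruct (Z.even (Int_part (s / T))); simpl; [reflexivity|]. rewrite Sym_Sym. reflexivity.
Qed.
Lemma cyc_0 : cyc 0 = to_Sigma fixpt.
Proof. rewrite cyc_base by (pose proof T_pos; lra). apply flow_0. Qed.

Lemma cyc_induction (P : R -> Prop) : (forall s, 0 <= s < T -> P s) -> (forall s, P s -> P (s + T)) ->
  (forall s, P s -> P (s - T)) -> forall s, P s.
Proof.
intros P0 Pu Pd s. pose proof T_pos.
destruct (base_Int_part (s / T)) as [B1 B2].
set (k := Int_part (s / T)) in *.
assert (Hr : 0 <= s - IZR k * T < T).
{ split.
  - assert (IZR k * T <= s / T * T) by (apply Rmult_le_compat_r; lra). replace (s / T * T) with s in H1 by (field; lra). lra.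
  - assert (s / T * T < (IZR k + 1) * T) by (apply Rmult_lt_compat_r; lra). replace (s / T * T) with s in H1 by (field; lra). lra. }
replace s with ((s - IZR k * T) + IZR k * T) by ring. generalize (P0 _ Hr). generalize (s - IZR k * T). clear -Pu Pd.
intros r Pr. clearbody k.
assert (Up : forall n : nat, P (r + INR n * T)).
{ induction n as [|n IH]; [simpl; rewrite Rmult_0_l, Rplus_0_r; exact Pr|].
  rewrite S_INR. replace (r + (INR n + 1) * T) with (r + INR n * T + T) by ring. apply Pu, IH. }
assert (Dn : forall n : nat, P (r - INR n * T)).
{ induction n as [|n IH]; [simpl; rewrite Rmult_0_l, Rminus_0_r; exact Pr|].
  rewrite S_INR. replace (r - (INR n + 1) * T) with (r - INR n * T - T) by ring. apply Pd, IH. }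
destruct (Z.le_gt_cases 0 k) as [h|h].
- rewrite <- (Z2Nat.id k h), <- INR_IZR_INZ. apply Up.
- replace (r + IZR k * T) with (r - INR (Z.to_nat (- k)) * T); [apply Dn|].
  rewrite INR_IZR_INZ, Z2Nat.id by lia. rewrite opp_IZR. ring.
Qed.

(** By [cyc_shift] it suffices to treat [0 <= s < T]: the open interval, where the
    cycle is above the plane, and the instant 0, where the flight starts and the
    reflected flight ends. *)
Lemma cyc_Z_at s : Z_at mu H (fun _ => True) cyc s.
Proof.
revert s. pose proof T_pos as TP. destruct fixpt_D as [Dx Dy].
assert (Before : forall u, - T <= u < 0 -> cyc u = Sym (fl fixpt (u + T))).
{ intros u Hu. rewrite <- (Sym_Sym (cyc u)), <- cyc_shift, cyc_base by lra. reflexivity. }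
assert (Z0 : forall s, 0 < s < T -> 0 < zc (cyc s)).
{ intros s Hs. rewrite cyc_base by lra. unfold fl, flow, zc. simpl.
  apply (zfl_pos_before mu Hmu s0 Hs0 HV0 (snd fixpt)); [lra|]. fold ret. rewrite fixpt_ret. exact Hs. }
apply cyc_induction.
- intros s Hs. destruct (Req_dec s 0) as [->|Hne].
  + assert (Up : crossing_up (cyc 0)).
    { rewrite cyc_0. unfold crossing_up, in_Sigma_c, on_Sigma, to_Sigma, xc, yc, zc; simpl.
      repeat split; [|exact Dy]. apply Rmult_lt_0_compat; assumption. }
    assert (Zz : zc (cyc 0) = 0) by (rewrite cyc_0; reflexivity).
    assert (EA : forall r, 0 <= r < 0 + T -> cyc r = fl fixpt r) by (intros r Hr; apply cyc_base; lra).
    assert (EB : forall r, 0 - T < r <= 0 -> cyc r = Sym (fl fixpt (r + T))).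
    { intros r Hr. destruct (Req_dec r 0) as [->|]; [|apply Before; lra]. rewrite cyc_0, Rplus_0_l. symmetry. apply flight_T. }
    assert (IB : integral_curve (fieldY mu H) (fun r => Sym (fl fixpt (r + T)))).
    { apply (Sym_integral_X mu H (fun r => fl fixpt (r + T))), integral_curve_shift, flow_integral_curve. }
    split; [|split; [|split; [|split]]].
    * apply (glue_continuous _ cyc (fl fixpt) (fun r => Sym (fl fixpt (r + T))) 0 T TP); auto.
      -- apply (integral_curve_continuous (fieldX mu H)), flow_integral_curve.
      -- apply (integral_curve_continuous _ _ _ IB).
    * intros _. exists (fl fixpt). split; [apply flow_integral_curve|]. exists T. split; [exact TP|]. intros r _ Hr. apply EA, Hr.
    * intros [h|h]; [lra|]. destruct h as [_ h], Up as [_ h']. lra.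
    * intros [h|h]; [lra|]. destruct h as [_ h], Up as [_ h']. lra.
    * intros _. exists (fun r => Sym (fl fixpt (r + T))). split; [exact IB|]. exists T. split; [exact TP|]. intros r _ Hr. apply EB, Hr.
  + assert (Hz : 0 < zc (cyc s)) by (apply Z0; lra).
    assert (Nup : ~ crossing_up (cyc s)) by (intros [[h _] _]; unfold on_Sigma in h; lra).
    assert (Ndn : ~ crossing_down (cyc s)) by (intros [[h _] _]; unfold on_Sigma in h; lra).
    set (d := Rmin s (T - s)).
    assert (Hd : 0 < d) by (apply Rmin_glb_lt; lra).
    assert (d <= s) by apply Rmin_l. assert (d <= T - s) by apply Rmin_r.
    assert (EA : forall r, s - d < r < s + d -> cyc r = fl fixpt r) by (intros r Hr; apply cyc_base; lra).
    split; [|split; [|split; [|split]]].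
    * apply (glue_continuous _ cyc (fl fixpt) (fl fixpt) s d Hd); try (apply (integral_curve_continuous (fieldX mu H)), flow_integral_curve);
      intros r Hr; apply EA; lra.
    * intros _. exists (fl fixpt). split; [apply flow_integral_curve|]. exists d. split; [exact Hd|]. intros r _ Hr. apply EA. lra.
    * intros [h|h]; [lra|contradiction].
    * intros _. exists (fl fixpt). split; [apply flow_integral_curve|]. exists d. split; [exact Hd|]. intros r _ Hr. apply EA. lra.
    * intros [h|h]; [lra|contradiction].
- intros s Hs. pose proof (Z_at_Sym _ _ _ _ _ (Z_at_shift mu H cyc s (- T) Hs)) as Q.
  replace (s - - T) with (s + T) in Q by ring.
  assert (E : cyc = (fun t => Sym (cyc (t + - T)))).
  { apply functional_extensionality. intros t. rewrite <- cyc_shift. f_equal. ring. }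
  rewrite E. exact Q.
- intros s Hs. pose proof (Z_at_Sym _ _ _ _ _ (Z_at_shift mu H cyc s T Hs)) as Q.
  assert (E : cyc = (fun t => Sym (cyc (t + T)))).
  { apply functional_extensionality. intros t. rewrite cyc_shift, Sym_Sym. reflexivity. }
  rewrite E. exact Q.
Qed.

Definition cycle (q : R3) : Prop := exists s, cyc s = q.
Lemma cycle_Sym q : cycle q -> cycle (Sym q).
Proof. intros [s <-]. exists (s + T). apply cyc_shift. Qed.
Lemma cycle_iter n q : cycle q -> cycle (Nat.iter n Sym q).
Proof. intros Hq. induction n as [|n IH]; [exact Hq|]. apply cycle_Sym, IH. Qed.
Lemma cycle_iter_inv n q : cycle (Nat.iter n Sym q) -> cycle q.
Proof. intros Hq. rewrite <- (iter_Sym_Sym n q). apply cycle_iter, Hq. Qed.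
Lemma cycle_flow t : 0 <= t <= T -> cycle (fl fixpt t).
Proof.
intros Ht. destruct (Req_dec t T) as [->|].
- apply (cycle_iter_inv 1). simpl. rewrite flight_T. exists 0. apply cyc_0.
- exists t. apply cyc_base. lra.
Qed.

Lemma cyc_Sigma s : on_Sigma (cyc s) -> cyc s = to_Sigma fixpt \/ cyc s = Sym (to_Sigma fixpt).
Proof.
revert s. destruct fixpt_D as [Dx Dy].
apply (cyc_induction (fun s => on_Sigma (cyc s) -> cyc s = to_Sigma fixpt \/ cyc s = Sym (to_Sigma fixpt))).
- intros s Hs Hon. left. destruct (Req_dec s 0) as [->|Hne]; [apply cyc_0|exfalso].
  rewrite cyc_base in Hon by lra. unfold on_Sigma, fl, flow, zc in Hon; simpl in Hon.
  pose proof (zfl_pos_before mu Hmu s0 Hs0 HV0 (snd fixpt) s ltac:(lra)) as P. fold ret in P. rewrite fixpt_ret in P.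
  specialize (P ltac:(lra)). unfold fixpt in P. simpl in P. lra.
- intros s IH Hon. rewrite cyc_shift in *. unfold on_Sigma in *.
  assert (Z : zc (cyc s) = 0) by (unfold Sym, zc in Hon |- *; simpl in Hon; lra).
  destruct (IH Z) as [E|E]; rewrite E, ?Sym_Sym; auto.
- intros s IH Hon. assert (E0 : cyc (s - T) = Sym (cyc s)).
  { rewrite <- (Sym_Sym (cyc (s - T))), <- cyc_shift. do 2 f_equal. ring. }
  rewrite E0 in *. unfold on_Sigma in *.
  assert (Z : zc (cyc s) = 0) by (unfold Sym, zc in Hon |- *; simpl in Hon; lra).
  destruct (IH Z) as [E|E]; rewrite E, ?Sym_Sym; auto.
Qed.

Lemma cycle_crossing : crossing_periodic_orbit mu H cycle.
Proof.
destruct fixpt_D as [Dx Dy]. pose proof T_pos. split; [|split].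
- exists cyc, (T + T). split; [|split; [lra|split; [|split; auto]]].
  + intros s _. apply cyc_Z_at.
  + intros s. rewrite <- Rplus_assoc, !cyc_shift, Sym_Sym. reflexivity.
- exists (to_Sigma fixpt). split; [exists 0; apply cyc_0|reflexivity].
- intros q [s <-] Hon. split; [exact Hon|].
  assert (P : 0 < fst fixpt * snd fixpt) by (apply Rmult_lt_0_compat; assumption).
  destruct (cyc_Sigma s Hon) as [-> | ->]; unfold Sym, to_Sigma, xc, yc; simpl in *; lra.
Qed.

Lemma cycle_simple : simple_period cycle.
Proof.
destruct fixpt_D as [Dx Dy].
exists (to_Sigma fixpt), (Sym (to_Sigma fixpt)). split.
- intros E. apply (f_equal xc) in E. unfold Sym, to_Sigma, xc, yc in E; simpl in *. lra.
- intros q. split.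
  + intros [[s <-] Hon]. apply cyc_Sigma, Hon.
  + assert (C0 : cycle (to_Sigma fixpt)) by (exists 0; apply cyc_0).
    intros [-> | ->]; (split; [auto using cycle_Sym|]); unfold on_Sigma, Sym, to_Sigma, zc; simpl; ring.
Qed.

Lemma chain_to_fixpt (u : nat -> R * R) : chain_of_flights mu H u -> (forall n, 0 <= snd (u n)) ->
  is_lim_seq (fun n => fst (u n)) (fst fixpt) /\ is_lim_seq (fun n => snd (u n)) (snd fixpt).
Proof. intros Hu Hp. apply (chain_limit_F mu H Hmu s0 Hs0 HV0 ss ltac:(lra) u HH He Hu Hp). Qed.

Lemma D_infty_limit p : D_infty mu H p ->
  is_lim_seq (fun n => fst (Nat.iter n (F mu H) p)) (fst fixpt) /\ is_lim_seq (fun n => snd (Nat.iter n (F mu H) p)) (snd fixpt).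
Proof.
intros [_ Hd]. apply chain_to_fixpt; [intros n; reflexivity|]. intros n. destruct (Hd n). lra.
Qed.
End Cycle.

(** * Orbital convergence and uniqueness *)

Lemma flow_lipschitz mu H (Hmu : 0 < mu) : exists M, 0 < M /\ forall p p' t, 0 <= t <= 2 * PI ->
  norm1 (flow mu H p t) (flow mu H p' t) <= M * (Rabs (fst p - fst p') + Rabs (snd p - snd p')).
Proof.
set (e := exp (mu * (2 * PI))). assert (E0 : 0 < e) by apply exp_pos.
set (b := e * (1 + mu)). assert (B0 : 0 < b) by (apply Rmult_lt_0_compat; lra).
pose proof (Rabs_pos H) as H0.
assert (HB : 0 <= Rabs H * b) by (apply Rmult_le_pos; lra).
assert (HE : 0 <= 4 * mu * Rabs H * e) by (apply Rmult_le_pos; [apply Rmult_le_pos|]; lra).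
exists (1 + Rabs H + Rabs H * b + 4 * mu * Rabs H * e + b + e). split; [lra|].
intros [x y] [x' y'] t Ht. cbn [fst snd].
set (dx := Rabs (x - x')). set (dy := Rabs (y - y')).
assert (Dx : 0 <= dx) by apply Rabs_pos. assert (Dy : 0 <= dy) by apply Rabs_pos.
assert (He : exp (mu * t) <= e) by (unfold e; apply exp_mono; apply Rmult_le_compat_l; lra).
pose proof (exp_pos (mu * t)) as P.
assert (Sb : Rabs (sin t) <= 1) by (apply Rabs_le; apply SIN_bound).
assert (Cb : Rabs (cos t) <= 1) by (apply Rabs_le; apply COS_bound).
assert (Z : Rabs (zfl mu y t - zfl mu y' t) <= e * dy).
{ replace (zfl mu y t - zfl mu y' t) with (exp (mu * t) * (sin t * (y - y'))) by (unfold zfl; field; nra).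
  rewrite !Rabs_mult, (Rabs_pos_eq (exp (mu * t))) by lra. fold dy.
  apply Rmult_le_compat; try lra. apply Rmult_le_pos; [apply Rabs_pos|lra].
  replace dy with (1 * dy) at 2 by ring. apply Rmult_le_compat_r; lra. }
assert (Yb : Rabs (yfl mu y t - yfl mu y' t) <= b * dy).
{ replace (yfl mu y t - yfl mu y' t) with (exp (mu * t) * ((cos t + mu * sin t) * (y - y'))) by (unfold yfl; ring).
  rewrite !Rabs_mult, (Rabs_pos_eq (exp (mu * t))) by lra. fold dy. unfold b. rewrite Rmult_assoc.
  apply Rmult_le_compat; try lra. apply Rmult_le_pos; [apply Rabs_pos|lra].
  apply Rmult_le_compat_r; [lra|]. eapply Rle_trans; [apply Rabs_triang|]. rewrite Rabs_mult, (Rabs_pos_eq mu) by lra.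
  assert (mu * Rabs (sin t) <= mu * 1) by (apply Rmult_le_compat_l; lra). lra. }
assert (Xb : Rabs (xfl mu H x y t - xfl mu H x' y' t) <= dx + Rabs H * dy + Rabs H * (b * dy) + 4 * mu * Rabs H * (e * dy)).
{ replace (xfl mu H x y t - xfl mu H x' y' t) with
    (exp (- (2 * mu * t)) * ((x - x') + - (H * (y - y'))) + (H * (yfl mu y t - yfl mu y' t) + - (4 * mu * H * (zfl mu y t - zfl mu y' t))))
    by (unfold xfl; ring).
  eapply Rle_trans; [apply Rabs_triang|].
  assert (A1 : Rabs (exp (- (2 * mu * t)) * ((x - x') + - (H * (y - y')))) <= dx + Rabs H * dy).
  { rewrite Rabs_mult, Rabs_pos_eq by (left; apply exp_pos).
    assert (exp (- (2 * mu * t)) <= 1). { rewrite <- exp_0. apply exp_mono. assert (0 <= 2 * mu * t) by (apply Rmult_le_pos; lra). lra. }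
    assert (Rabs (x - x' + - (H * (y - y'))) <= dx + Rabs H * dy).
    { eapply Rle_trans; [apply Rabs_triang|]. rewrite Rabs_Ropp, Rabs_mult. fold dx dy. lra. }
    pose proof (Rabs_pos (x - x' + - (H * (y - y')))). pose proof (exp_pos (- (2 * mu * t))). nra. }
  assert (A2 : Rabs (H * (yfl mu y t - yfl mu y' t) + - (4 * mu * H * (zfl mu y t - zfl mu y' t))) <= Rabs H * (b * dy) + 4 * mu * Rabs H * (e * dy)).
  { eapply Rle_trans; [apply Rabs_triang|]. rewrite Rabs_Ropp, !Rabs_mult, (Rabs_pos_eq 4), (Rabs_pos_eq mu) by lra.
    apply Rplus_le_compat; apply Rmult_le_compat_l; try lra. apply Rmult_le_pos; lra. }
  lra. }
unfold norm1, flow, xc, yc, zc. cbn [fst snd].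
assert (0 <= Rabs H * dy) by (apply Rmult_le_pos; lra).
assert (0 <= Rabs H * dx) by (apply Rmult_le_pos; lra). assert (0 <= Rabs H * b * dx) by (apply Rmult_le_pos; lra).
assert (0 <= 4 * mu * Rabs H * e * dx) by (apply Rmult_le_pos; lra). assert (0 <= b * dx) by (apply Rmult_le_pos; lra).
assert (0 <= e * dx) by (apply Rmult_le_pos; lra).
lra.
Qed.

Section Orbits.
Variables mu H : R.
Hypothesis Hmu : 0 < mu.
Variable s0 : R.
Hypothesis Hs0 : 0 < s0 < PI.
Hypothesis HV0 : Vc mu s0 = 0.
Variable ss : R.
Hypothesis Hss : 0 < ss < s0.
Hypothesis HH : H < H_crit mu.
Hypothesis He : eta mu (PI + ss) = H.
Let c := 1 + mu ^ 2.
Let ret := flight_time mu s0.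
Let fixpt := (x0 mu (PI + ss), y0 mu (PI + ss)).
Let T := PI + ss.
Let cp : 0 < c. Proof. unfold c. nra. Qed.
Let fl := flow mu H.
Let cycle := cycle mu H ss.
Let contact := contact_time mu H s0.
Let FD : Defs.D fixpt := fixpt_D mu Hmu s0 Hs0 HV0 ss Hss.
Let ret_rg y (h : 0 <= y) : PI < ret y < 2 * PI := flight_time_range mu Hmu s0 Hs0 HV0 y h.

(** As [V] is strictly decreasing, values close to [V ss] are taken only to the left
    of any given point beyond [ss].  A flight shorter
    than [T] will be compared with the initial part of the periodic one, so that the
    excess over [T] is the quantity to control. *)
Lemma flight_time_upper (y : nat -> R) d : 0 < d -> (forall n, 0 <= y n) -> is_lim_seq y (snd fixpt) ->
  exists N, forall n, (N <= n)%nat -> ret (y n) < T + d.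
Proof.
intros Hd Hy Hlim.
set (s1 := Rmin (ss + d) ((ss + PI) / 2)).
assert (H1 : s1 <= ss + d) by apply Rmin_l. assert (H2 : s1 <= (ss + PI) / 2) by apply Rmin_r.
assert (H3 : ss < s1) by (apply Rmin_glb_lt; lra).
pose proof (V_decr mu Hmu ss s1 ltac:(lra) H3 ltac:(lra)) as HV.
assert (HVp : Vc mu ss = c * snd fixpt) by exact (fixpt_V mu s0 Hs0 ss Hss).
rewrite HVp in HV. assert (Ey : exists yp, snd fixpt = yp) by (eexists; reflexivity). destruct Ey as [yp Ey]. rewrite Ey in HV, Hlim.
apply is_lim_seq_spec in Hlim.
assert (Heps : 0 < (c * yp - Vc mu s1) / c) by (apply Rdiv_lt_0_compat; [lra|exact cp]).
destruct (Hlim (mkposreal _ Heps)) as [N HN]. exists N. intros n Hn. specialize (HN n Hn). simpl in HN.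
apply Rabs_def2 in HN. destruct HN as [_ HN].
assert (HV1 : Vc mu s1 < c * y n).
{ apply Rmult_lt_reg_r with (/ c); [apply Rinv_0_lt_compat, cp|].
  replace (c * y n * / c) with (y n) by (field; lra).
  replace (Vc mu s1 * / c) with (yp - (c * yp - Vc mu s1) / c) by (field; lra). lra. }
destruct (flight_time_spec mu Hmu s0 Hs0 HV0 (y n) (Hy n)) as (s & Es & Hs & EV).
unfold ret. rewrite Es. fold c in EV.
assert (s < s1); [|unfold T; lra].
apply Rnot_le_lt. intros h. destruct (Req_dec s1 s) as [E|E].
- rewrite E, EV in HV1. lra.
- pose proof (V_decr mu Hmu s1 s ltac:(lra) ltac:(lra) ltac:(lra)). lra.
Qed.

(** At each time, reflect until the current flight is above the plane and compare it
    with the flight from the fixed point at the same time [r] after launching, or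
    at [T] if [r] exceeds [T]: the launching points are close by convergence of the
    chain, and [r] exceeds [T] by little. *)
Theorem orbital_convergence p phi : D_infty mu H p -> forward_trajectory mu H phi -> phi 0 = to_Sigma p ->
  converges_orbitally phi cycle.
Proof.
intros Hp Hphi E0.
destruct (D_infty_limit mu H Hmu s0 Hs0 HV0 ss Hss HH He p Hp) as [Lx Ly].
set (pn n := Nat.iter n (F mu H) p) in *.
assert (HD : forall n, Defs.D (pn n)) by (intros n; apply (iter_F_D mu H p Hp n)).
assert (Hy : forall n, 0 <= snd (pn n)) by (intros n; destruct (HD n); lra).
destruct (flow_lipschitz mu H Hmu) as (M & HM & HL).
unfold converges_orbitally. apply is_lim_spec. intros eps.
assert (He2 : 0 < eps / 6) by (pose proof (cond_pos eps); lra).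
set (e2 := mkposreal _ He2).
assert (Cd : exists d, 0 < d /\ forall t, Rabs (t - T) < d -> norm1 (fl fixpt t) (fl fixpt T) < eps / 2).
{ destruct (flow_continuous mu H fixpt T) as (Cx & Cy & Cz).
  destruct (proj1 (filterlim_locally _ _) Cx e2) as [d1 D1]. destruct (proj1 (filterlim_locally _ _) Cy e2) as [d2 D2].
  destruct (proj1 (filterlim_locally _ _) Cz e2) as [d3 D3].
  exists (Rmin d1 (Rmin d2 d3)). split; [repeat apply Rmin_glb_lt; apply cond_pos|]. intros t Ht.
  pose proof (Rmin_l d1 (Rmin d2 d3)). pose proof (Rmin_r d1 (Rmin d2 d3)). pose proof (Rmin_l d2 d3). pose proof (Rmin_r d2 d3).
  assert (B1 := D1 t ltac:(change (Rabs (t - T) < d1); lra)). assert (B2 := D2 t ltac:(change (Rabs (t - T) < d2); lra)).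
  assert (B3 := D3 t ltac:(change (Rabs (t - T) < d3); lra)).
  change (Rabs (xc (fl fixpt t) - xc (fl fixpt T)) < eps / 6) in B1. change (Rabs (yc (fl fixpt t) - yc (fl fixpt T)) < eps / 6) in B2.
  change (Rabs (zc (fl fixpt t) - zc (fl fixpt T)) < eps / 6) in B3. unfold norm1. lra. }
destruct Cd as (d & Hd & Cd).
destruct (flight_time_upper (fun n => snd (pn n)) d Hd Hy Ly) as [Na HNa].
assert (He3 : 0 < eps / (4 * M)) by (apply Rdiv_lt_0_compat; [apply cond_pos|lra]).
apply is_lim_seq_spec in Lx, Ly.
destruct (Lx (mkposreal _ He3)) as [Nx HNx]. destruct (Ly (mkposreal _ He3)) as [Ny HNy]. simpl in HNx, HNy.
set (N := (Na + Nx + Ny)%nat).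
exists (contact p N). intros t Ht.
destruct (locate mu H Hmu s0 Hs0 HV0 p Hy N t ltac:(unfold contact in Ht; lra)) as (n & Hn & Hc1 & Hc2).
fold contact in Hc1, Hc2.
set (r := t - contact p n).
assert (Ec : contact p (S n) = contact p n + ret (snd (pn n))) by reflexivity.
assert (Hr : 0 <= r < ret (snd (pn n))) by (unfold r; lra).
pose proof (ret_rg _ (Hy n)) as Hrr.
assert (Efl : Nat.iter n Sym (phi t) = fl (pn n) r).
{ pose proof (follow_chain mu H Hmu s0 Hs0 HV0 (fun s => 0 <= s) phi 0 p Hphi ltac:(intros; lra) E0 n (fun m _ => HD m) r) as FC.
  fold ret contact in FC. specialize (FC ltac:(fold (pn n); lra)). replace (0 + contact p n + r) with t in FC by (unfold r; ring). exact FC. }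
set (r' := Rmin r T).
assert (TP : 0 < T) by (unfold T; pose proof PI_RGT_0; lra).
assert (Hr' : 0 <= r' <= T) by (unfold r'; split; [apply Rmin_glb; lra|apply Rmin_r]).
assert (G : cycle (Nat.iter n Sym (fl fixpt r'))).
{ apply (cycle_iter mu H s0 Hs0 ss Hss). apply (cycle_flow mu H Hmu s0 Hs0 HV0 ss Hss He). exact Hr'. }
assert (D1 : norm1 (fl (pn n) r) (fl fixpt r) < eps / 2).
{ eapply Rle_lt_trans; [apply HL; lra|].
  specialize (HNx n ltac:(lia)). specialize (HNy n ltac:(lia)).
  apply Rlt_le_trans with (M * (eps / (4 * M) + eps / (4 * M))); [apply Rmult_lt_compat_l; [exact HM|apply Rplus_lt_compat; [exact HNx|exact HNy]]|]. right. field. lra. }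
assert (D2 : norm1 (fl fixpt r) (fl fixpt r') < eps / 2).
{ unfold r', Rmin. destruct (Rle_dec r T) as [h|h].
  - unfold norm1. rewrite !Rminus_diag, Rabs_R0. pose proof (cond_pos eps). lra.
  - apply Cd. specialize (HNa n ltac:(lia)). simpl in HNa. apply Rabs_def1; lra. }
pose proof (dist_to_bounds cycle (phi t) _ G) as [B1 B2].
assert (B3 : norm1 (phi t) (Nat.iter n Sym (fl fixpt r')) = norm1 (fl (pn n) r) (fl fixpt r')).
{ rewrite <- Efl, <- (norm1_iter n), iter_Sym_Sym. reflexivity. }
pose proof (norm1_triangle (fl (pn n) r) (fl fixpt r) (fl fixpt r')).
rewrite Rminus_0_r, Rabs_pos_eq by exact B1. lra.
Qed.

(** Each landing is a crossing point, so it has nonzero coordinates of the same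
    sign; the abscissa of an image under [F] is a positive multiple of
    [U s], so this sign is plus. *)
Lemma crossing_D_infty chi p : Z_trajectory mu H (fun _ => True) chi ->
  (forall s, on_Sigma (chi s) -> in_Sigma_c (chi s)) -> chi 0 = to_Sigma p -> Defs.D p -> D_infty mu H p.
Proof.
intros Hchi Hcr E0 Dp. split; [exact Dp|].
assert (A : forall n m, (m <= n)%nat -> Defs.D (Nat.iter m (F mu H) p)).
{ induction n as [|n IH]; intros m Hm; [replace m with 0%nat by lia; exact Dp|].
  destruct (Nat.eq_dec m (S n)) as [->|]; [|apply IH; lia].
  set (q := Nat.iter n (F mu H) p). assert (Dq : Defs.D q) by (apply IH; lia). destruct Dq as [Qx Qy].
  pose proof (ret_rg (snd q) ltac:(lra)) as Hr. pose proof PI_RGT_0.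
  pose proof (follow_chain mu H Hmu s0 Hs0 HV0 (fun _ => True) chi 0 p Hchi (fun _ _ => I) E0 n IH (ret (snd q))) as FC. specialize (FC ltac:(fold q; split; [lra|right; reflexivity])).
  fold q in FC. pose proof (F_flow mu H Hmu s0 Hs0 HV0 q ltac:(lra)) as FF. fold ret in FF. rewrite <- FC in FF.
  change (Sym (Nat.iter n Sym ?z)) with (Nat.iter (S n) Sym z) in FF.
  set (s1 := 0 + contact_time mu H s0 p n + ret (snd q)) in *.
  change (Nat.iter (S n) (F mu H) p) with (F mu H q).
  assert (On : on_Sigma (chi s1)).
  { destruct (iter_Sym_cases (S n)) as [[_ E]|[_ E]]; rewrite E in FF.
    - rewrite FF. reflexivity.
    - unfold on_Sigma. apply (f_equal zc) in FF. unfold Sym, to_Sigma, zc in FF |- *. simpl in FF. lra. }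
  destruct (Hcr s1 On) as [_ Hxy].
  assert (Hprod : 0 < fst (F mu H q) * snd (F mu H q)).
  { assert (E : xc (Nat.iter (S n) Sym (chi s1)) * yc (Nat.iter (S n) Sym (chi s1)) = xc (chi s1) * yc (chi s1)).
    { destruct (iter_Sym_cases (S n)) as [[_ E]|[_ E]]; rewrite E; [reflexivity|]. unfold Sym, xc, yc. simpl. ring. }
    rewrite FF in E. change (fst (F mu H q) * snd (F mu H q) = xc (chi s1) * yc (chi s1)) in E. rewrite E. exact Hxy. }
  assert (Hfst : 0 < fst (F mu H q)).
  { destruct (flight_time_spec mu Hmu s0 Hs0 HV0 (snd q) ltac:(lra)) as (s & _ & Hs & EV).
    destruct (F_explicit mu H Hmu s0 Hs0 HV0 q s Hs EV) as [EU _]. pose proof (U_pos mu Hmu s ltac:(lra)).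
    fold c in EU. apply Rmult_lt_reg_l with c; [exact cp|]. lra. }
  split; [exact Hfst|]. apply Rmult_lt_reg_l with (fst (F mu H q)); lra. }
intros n. apply (A n n). lia.
Qed.

(** After one period [P] the trajectory is again at its starting point, hence at the
    end of a flight, after an even number [n] of flights.  So [p] is a periodic
    point of [F], and as its orbit converges it is the fixed point. *)
Lemma periodic_start chi p P : Z_trajectory mu H (fun _ => True) chi ->
  (forall s, on_Sigma (chi s) -> in_Sigma_c (chi s)) -> chi 0 = to_Sigma p -> Defs.D p ->
  0 < P -> (forall s, chi (s + P) = chi s) -> p = fixpt.
Proof.
intros Hchi Hcr E0 Dp HP Hper.
pose proof (crossing_D_infty chi p Hchi Hcr E0 Dp) as Hinf.
set (pn n := Nat.iter n (F mu H) p).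
assert (HD : forall n, Defs.D (pn n)) by (intros n; apply (iter_F_D mu H p Hinf n)).
assert (Hy : forall n, 0 <= snd (pn n)) by (intros n; destruct (HD n); lra).
destruct (locate mu H Hmu s0 Hs0 HV0 p Hy 0%nat P ltac:(simpl; lra)) as (n & _ & Hc1 & Hc2).
fold contact in Hc1, Hc2.
set (r := P - contact p n).
assert (Ec : contact p (S n) = contact p n + ret (snd (pn n))) by reflexivity.
assert (Hr : 0 <= r < ret (snd (pn n))) by (unfold r; lra).
pose proof (follow_chain mu H Hmu s0 Hs0 HV0 (fun _ => True) chi 0 p Hchi (fun _ _ => I) E0 n (fun m _ => HD m) r) as FC.
fold ret contact in FC. specialize (FC ltac:(fold (pn n); lra)). replace (0 + contact p n + r) with (0 + P) in FC by (unfold r; ring).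
rewrite Hper, E0 in FC. fold (pn n) in FC.
assert (Hr0 : r = 0).
{ destruct (Req_dec r 0) as [|Hne]; [assumption|exfalso].
  pose proof (zfl_pos_before mu Hmu s0 Hs0 HV0 (snd (pn n)) r (Hy n) ltac:(fold ret; lra)) as Z.
  apply (f_equal zc) in FC. change (zc (flow mu H (pn n) r)) with (zfl mu (snd (pn n)) r) in FC.
  destruct (iter_Sym_cases n) as [[_ E]|[_ E]]; rewrite E in FC; unfold Sym, to_Sigma, zc in FC; simpl in FC; lra. }
rewrite Hr0, flow_0 in FC.
assert (Hn : n <> 0%nat).
{ intros ->. unfold r in Hr0. simpl in Hr0. lra. }
assert (Epn : pn n = p).
{ destruct (HD n) as [Nx Ny]. destruct Dp as [Px Py].
  destruct (iter_Sym_cases n) as [[_ E]|[_ E]]; rewrite E in FC.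
  - unfold to_Sigma in FC. injection FC as F1 F2. rewrite (surjective_pairing (pn n)), (surjective_pairing p). congruence.
  - exfalso. apply (f_equal xc) in FC. unfold Sym, to_Sigma, xc, yc in FC. simpl in FC. lra. }
assert (Ek : forall k, pn (k * n)%nat = p).
{ induction k as [|k IH]; [reflexivity|]. simpl. unfold pn in *. rewrite Nat.iter_add, IH. exact Epn. }
destruct (D_infty_limit mu H Hmu s0 Hs0 HV0 ss Hss HH He p Hinf) as [Lx Ly]. fold fixpt in Lx, Ly.
assert (Sub : forall f : R * R -> R, is_lim_seq (fun n => f (pn n)) (f fixpt) -> f p = f fixpt).
{ intros f Lf.
  assert (L : is_lim_seq (fun k => f (pn (k * n)%nat)) (f fixpt)).
  { apply (is_lim_seq_subseq (fun m => f (pn m)) (f fixpt) (fun k => (k * n)%nat)); [|exact Lf].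
    intros Q [N HN]. exists N. intros k Hk. apply HN. nia. }
  assert (L2 : is_lim_seq (fun k => f (pn (k * n)%nat)) (f p)).
  { apply is_lim_seq_ext with (fun _ => f p); [intros k; rewrite Ek; reflexivity|apply is_lim_seq_const]. }
  apply is_lim_seq_unique in L, L2. congruence. }
rewrite (surjective_pairing p), (surjective_pairing fixpt). f_equal; [apply (Sub fst Lx)|apply (Sub snd Ly)].
Qed.

Lemma follow_cycle chi : Z_trajectory mu H (fun _ => True) chi -> chi 0 = to_Sigma fixpt ->
  forall s, 0 <= s -> chi s = cyc mu H ss s.
Proof.
intros Hchi E0 s Hs.
assert (Hy : forall n, 0 <= snd (Nat.iter n (F mu H) fixpt)).
{ intros n. unfold fixpt. rewrite (fixpt_iter mu H Hmu s0 Hs0 HV0 ss Hss He n). fold fixpt. destruct FD. lra. }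
assert (HD : forall m, Defs.D (Nat.iter m (F mu H) fixpt)).
{ intros n. unfold fixpt. rewrite (fixpt_iter mu H Hmu s0 Hs0 HV0 ss Hss He n). exact FD. }
destruct (locate mu H Hmu s0 Hs0 HV0 fixpt Hy 0%nat s ltac:(simpl; lra)) as (n & _ & Hc1 & Hc2).
fold contact in Hc1, Hc2.
assert (Hr : 0 <= s - contact fixpt n <= ret (snd (Nat.iter n (F mu H) fixpt))).
{ change (contact fixpt (S n)) with (contact fixpt n + ret (snd (Nat.iter n (F mu H) fixpt))) in Hc2. lra. }
assert (Hcyc : Z_trajectory mu H (fun _ => True) (cyc mu H ss)).
{ intros t _. apply (cyc_Z_at mu H Hmu s0 Hs0 HV0 ss Hss He). }
pose proof (follow_chain mu H Hmu s0 Hs0 HV0 (fun _ => True) chi 0 fixpt Hchi (fun _ _ => I) E0 n (fun m _ => HD m) _ Hr) as F1.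
pose proof (follow_chain mu H Hmu s0 Hs0 HV0 (fun _ => True) _ 0 fixpt Hcyc (fun _ _ => I) (cyc_0 mu H s0 Hs0 ss Hss) n (fun m _ => HD m) _ Hr) as F2.
fold contact in F1, F2. replace (0 + contact fixpt n + (s - contact fixpt n)) with s in F1, F2 by ring.
rewrite <- (iter_Sym_Sym n (chi s)), F1, <- F2, iter_Sym_Sym. reflexivity.
Qed.

(** Reflected and shifted in time so as to start at an upward crossing, a crossing
    periodic trajectory starts at the fixed point and follows the cycle; periodicity
    carries the equality over to negative times. *)
Theorem cycle_unique gamma' : crossing_periodic_orbit mu H gamma' -> forall q, gamma' q <-> cycle q.
Proof.
intros ((phi & P & Hphi & HP & Hper & Hg) & (q0 & Hq0 & On0) & Hcr).
assert (PerZ : forall n s, phi (s + INR n * P) = phi s).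
{ induction n as [|n IH]; intros s; [simpl; f_equal; ring|]. rewrite S_INR.
  replace (s + (INR n + 1) * P) with ((s + INR n * P) + P) by ring. rewrite Hper. apply IH. }
destruct (proj1 (Hg q0) Hq0) as [a Ea].
destruct (Hcr q0 Hq0 On0) as [_ Hxy].
(* [e] is 1 when the crossing at time [a] is downward. *)
assert (K : exists e p, Nat.iter e Sym q0 = to_Sigma p /\ Defs.D p).
{ destruct (Rlt_dec 0 (yc q0)) as [h|h].
  - exists 0%nat, (xc q0, yc q0). split; [apply R3_eq; try reflexivity; exact On0|]. split; cbn [fst snd]; [|exact h].
    apply Rmult_lt_reg_r with (yc q0); [exact h|]. rewrite Rmult_0_l. exact Hxy.
  - exists 1%nat, (- yc q0, - xc q0). split; [apply R3_eq; try reflexivity; unfold on_Sigma in On0; unfold Sym, to_Sigma, zc in *; simpl; lra|].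
    assert (h1 : yc q0 < 0) by (apply Rnot_lt_le in h; destruct h as [h|h]; [exact h|]; rewrite h, Rmult_0_r in Hxy; lra).
    assert (h2 : xc q0 < 0).
    { apply Rmult_lt_reg_r with (- yc q0); lra. }
    split; cbn [fst snd]; lra. }
destruct K as (e & p & Ep & Dp).
set (chi s := Nat.iter e Sym (phi (s + a))).
assert (Z1 : Z_trajectory mu H (fun _ => True) chi).
{ apply (Z_trajectory_iter mu H _ (fun s => phi (s + a)) e). intros s _.
  pose proof (Z_at_shift mu H phi (s + a) a (Hphi (s + a) I)) as Q. replace (s + a - a) with s in Q by ring. exact Q. }
assert (Z2 : chi 0 = to_Sigma p) by (unfold chi; rewrite Rplus_0_l, Ea; exact Ep).
assert (Z3 : forall s, on_Sigma (chi s) -> in_Sigma_c (chi s)).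
{ intros s On. assert (On' : on_Sigma (phi (s + a))).
  { unfold chi in On. destruct (iter_Sym_cases e) as [[_ E]|[_ E]]; rewrite E in On; [exact On|].
    unfold on_Sigma, Sym, zc in *. simpl in On. lra. }
  destruct (Hcr (phi (s + a)) (proj2 (Hg _) (ex_intro _ (s + a) eq_refl)) On') as [_ Hpos].
  split; [exact On|]. unfold chi. destruct (iter_Sym_cases e) as [[_ E]|[_ E]]; rewrite E; [exact Hpos|].
  unfold Sym, xc, yc in *. simpl. lra. }
assert (Z4 : forall s, chi (s + P) = chi s).
{ intros s. unfold chi. f_equal. replace (s + P + a) with (s + a + P) by ring. apply Hper. }
assert (Epst : p = fixpt) by (apply (periodic_start chi p P); assumption).
subst p.
pose proof (follow_cycle chi Z1 Z2) as Hfol.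
assert (ChiPer : forall n s, chi (s + INR n * P) = chi s).
{ intros n s. unfold chi. f_equal. replace (s + INR n * P + a) with (s + a + INR n * P) by ring. apply PerZ. }
assert (Back : forall f : R -> R3, forall Q, 0 < Q -> (forall n s, f (s + INR n * Q) = f s) -> forall s, exists t, 0 <= t /\ f t = f s).
{ intros f Q HQ Hf s. destruct (INR_unbounded (- s / Q)) as [n Hn]. exists (s + INR n * Q). split; [|apply Hf].
  assert (- s < INR n * Q); [|lra]. apply Rmult_lt_reg_r with (/ Q); [apply Rinv_0_lt_compat; lra|].
  rewrite Rmult_assoc, Rinv_r by lra. lra. }
assert (TP : 0 < T) by (unfold T; pose proof PI_RGT_0; lra).
assert (CycPer : forall n s, cyc mu H ss (s + INR n * (T + T)) = cyc mu H ss s).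
{ induction n as [|n IH]; intros s; [simpl; f_equal; ring|]. rewrite S_INR.
  replace (s + (INR n + 1) * (T + T)) with (s + INR n * (T + T) + T + T) by ring.
  unfold T at 3 4. rewrite !(cyc_shift mu H s0 Hs0 ss Hss), Sym_Sym. apply IH. }
intros q. split.
- intros Gq. destruct (proj1 (Hg q) Gq) as [s Es].
  destruct (Back chi P HP ChiPer (s - a)) as (t & Ht & Et).
  assert (Eq : chi (s - a) = Nat.iter e Sym q) by (unfold chi; f_equal; rewrite <- Es; f_equal; ring).
  apply (cycle_iter_inv mu H s0 Hs0 ss Hss e). exists t. rewrite <- Hfol by exact Ht. congruence.
- intros Gq. destruct (cycle_iter mu H s0 Hs0 ss Hss e q Gq) as [s Es].
  destruct (Back (cyc mu H ss) (T + T) ltac:(lra) CycPer s) as (t & Ht & Et).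
  apply Hg. exists (t + a). rewrite <- (iter_Sym_Sym e (phi (t + a))).
  change (Nat.iter e Sym (phi (t + a))) with (chi t). rewrite Hfol, Et, Es by exact Ht. apply iter_Sym_Sym.
Qed.
End Orbits.

Theorem theorem2 (mu H tg t : R)
  (hmu : 0 < mu)
  (htg : is_t_g mu tg)
  (hH : H_g mu tg < H < H_crit mu)
  (ht : PI < t < tg)
  (hetat : eta mu t = H) :
  (forall p : R * R, D_infty mu H p ->
     filterlim (fun n : nat => Nat.iter n (F mu H) p) eventually
       (locally (x0 mu t, y0 mu t))) /\
  (exists gamma : R3 -> Prop,
     crossing_periodic_orbit mu H gamma /\
     simple_period gamma /\
     gamma (to_Sigma (x0 mu t, y0 mu t)) /\
     (forall (p : R * R) (phi : R -> R3),
        D_infty mu H p -> forward_trajectory mu H phi ->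
        phi 0 = to_Sigma p -> converges_orbitally phi gamma) /\
     (forall gamma' : R3 -> Prop, crossing_periodic_orbit mu H gamma' ->
        forall q : R3, gamma' q <-> gamma q)) /\
  ~ (exists (gamma' : R3 -> Prop) (q1 q2 q3 : R3),
       crossing_periodic_orbit mu H gamma' /\
       q1 <> q2 /\ q1 <> q3 /\ q2 <> q3 /\
       (gamma' q1 /\ on_Sigma q1) /\
       (gamma' q2 /\ on_Sigma q2) /\
       (gamma' q3 /\ on_Sigma q3)) /\
  (forall u : nat -> R * R,
     chain_of_flights mu H u ->
     0 < fst (u 0%nat) -> 0 <= snd (u 0%nat) ->
     (forall n : nat, (1 <= n)%nat -> 0 <= snd (u n)) ->
     filterlim u eventually (locally (x0 mu t, y0 mu t)) /\
     exists N : nat, forall n : nat,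
       (1 <= n)%nat -> snd (u n) = 0 -> (n <= N)%nat).
Proof.
destruct htg as [Htg Etg]. destruct hH as [_ HH].
set (s0 := tg - PI). set (ss := t - PI).
assert (Hs0 : 0 < s0 < PI) by (unfold s0; lra).
assert (Hss : 0 < ss < s0) by (unfold ss, s0; lra).
assert (HV0 : Vc mu s0 = 0).
{ pose proof (y0_V mu s0 Hs0 s0 ltac:(lra)) as E. unfold y0 in E. replace (PI + s0) with tg in E by (unfold s0; ring).
  rewrite Etg in E. assert (0 < 1 + mu ^ 2) by nra.
  assert (E2 : Vc mu s0 / (1 + mu ^ 2) = 0) by (rewrite <- E; ring).
  apply Rmult_eq_reg_r with (/ (1 + mu ^ 2)); [|apply Rinv_neq_0_compat; lra]. rewrite Rmult_0_l. exact E2. }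
assert (Et : t = PI + ss) by (unfold ss; ring).
rewrite Et in *.
assert (Lim2 : forall u : nat -> R * R, is_lim_seq (fun n => fst (u n)) (x0 mu (PI + ss)) -> is_lim_seq (fun n => snd (u n)) (y0 mu (PI + ss)) ->
  filterlim u eventually (locally (x0 mu (PI + ss), y0 mu (PI + ss)))).
{ intros u Lx Ly. apply filterlim_locally. intros eps.
  pose proof (proj1 (filterlim_locally _ _) Lx eps) as [N1 H1]. pose proof (proj1 (filterlim_locally _ _) Ly eps) as [N2 H2].
  exists (N1 + N2)%nat. intros n Hn. split; [apply H1; lia|apply H2; lia]. }
assert (Simple := cycle_simple mu H hmu s0 Hs0 HV0 ss Hss).
assert (Uniq := cycle_unique mu H hmu s0 Hs0 HV0 ss Hss HH hetat).
split; [|split; [|split]].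
- intros p Hp. destruct (D_infty_limit mu H hmu s0 Hs0 HV0 ss Hss HH hetat p Hp) as [Lx Ly]. apply Lim2; assumption.
- exists (cycle mu H ss). split; [apply (cycle_crossing mu H hmu s0 Hs0 HV0 ss Hss hetat)|].
  split; [exact Simple|]. split; [exists 0; apply (cyc_0 mu H s0 Hs0 ss Hss)|]. split; [|exact Uniq].
  intros p phi. apply (orbital_convergence mu H hmu s0 Hs0 HV0 ss Hss HH hetat).
- intros (g & q1 & q2 & q3 & Hg & N12 & N13 & N23 & [G1 O1] & [G2 O2] & [G3 O3]).
  destruct Simple as (a & b & _ & Hab). apply (Uniq g Hg) in G1, G2, G3.
  destruct (proj1 (Hab q1) (conj G1 O1)), (proj1 (Hab q2) (conj G2 O2)), (proj1 (Hab q3) (conj G3 O3)); congruence.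
- intros u Hu _ Hy0 Hy.
  assert (Hyn : forall n, 0 <= snd (u n)) by (intros [|n]; [exact Hy0|apply Hy; lia]).
  destruct (chain_to_fixpt mu H hmu s0 Hs0 HV0 ss Hss HH hetat u Hu Hyn) as [Lx Ly].
  split; [apply Lim2; assumption|].
  destruct (fixpt_D mu hmu s0 Hs0 HV0 ss Hss) as [_ Dy]. simpl in Dy.
  apply is_lim_seq_spec in Ly. destruct (Ly (mkposreal _ Dy)) as [N HN]. exists N. intros n _ Hn0.
  apply Nat.nlt_ge. intros h. specialize (HN n ltac:(lia)). simpl in HN. rewrite Hn0 in HN.
  rewrite Rabs_left1 in HN by lra. lra.
Qed.
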